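(* Let $\{x_j\}_{j\in[n]}\subset\mathbb{R}^d$ be points and let $\sigma$ be a permutation of the set $\{x_j\}_{j\in[n]}$. The $\mathsf{MOT}$ problem with cost $$C_{j_1,\dots,j_k}=\|\sigma(x_{j_1})-x_{j_k}\|^2+\sum_{t=1}^{k-1}\|x_{j_{t+1}}-x_{j_t}\|^2,\qquad (j_1,\dots,j_k)\in[n]^k,$$ can be solved in $d\cdot\mathrm{poly}(n,k)$ time. The solution is returned as a sparse tensor with at most $nk-k+1$ non-zeros.
   Context: $[n]=\{1,\dots,n\}$; $\Delta_n$ is the probability simplex in $\mathbb{R}^n$; $\|\cdot\|$ is the Euclidean norm. The $\mathsf{MOT}$ problem with cost $C\in(\mathbb{R}^n)^{\otimes k}$ is: given marginals $\mu_1,\dots,\mu_k\in\Delta_n$, find an optimal solution of $\min\langle P,C\rangle$ over all entrywise non-negative $P\in(\mathbb{R}^n)^{\otimes k}$ with $m_i(P)=\mu_i$ for all $i\in[k]$, where $[m_i(P)]_j=\sum_{\vec{j}\in[n]^k:\,j_i=j}P_{\vec{j}}$. (In the generalized Euler flow application, the marginals are uniform, $\mu_t=\mathbf{1}_n/n$.) The input consists of the points, the permutation $\sigma$ and the marginals, with entries of bit complexity at most $\mathrm{poly}(n,k)$; runtimes count arithmetic operations, and the problem is solved exactly. *)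

(* Defs.v *)
From mathcomp Require Import all_boot all_order all_algebra.
From mathcomp Require Import perm reals.

Set Implicit Arguments.
Unset Strict Implicit.
Unset Printing Implicit Defensive.

Import Order.TTheory GRing.Theory Num.Theory.
Local Open Scope ring_scope.

(* (R^n)^{\otimes k}; the multi-index j = (j_1, ..., j_k) has entries j i. *)
Definition multi_index (n k : nat) := {ffun 'I_k -> 'I_n}.
Definition tensor (R : Type) (n k : nat) := multi_index n k -> R.

Section MOT.
Variables (R : realType) (n k : nat).
Implicit Types (C P Q : tensor R n k) (mu : 'I_k -> 'rV[R]_n).

Definition in_simplex (v : 'rV[R]_n) : Prop :=
  (forall a, 0 <= v 0 a) /\ \sum_a v 0 a = 1.

Definition marginal P (i : 'I_k) : 'rV[R]_n :=
  \row_a \sum_(j : multi_index n k | j i == a) P j.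

Definition inner P C : R := \sum_(j : multi_index n k) P j * C j.

Definition feasible mu P : Prop :=
  (forall j, 0 <= P j) /\ (forall i, marginal P i = mu i).

Definition MOT_solution C mu P : Prop :=
  feasible mu P /\ forall Q, feasible mu Q -> inner P C <= inner Q C.

End MOT.

(* The library's norm on row vectors is the sup norm. *)
Definition enorm (R : realType) (d : nat) (v : 'rV[R]_d) : R :=
  Num.sqrt (\sum_l v 0 l ^+ 2).

Section EulerFlow.
Variables (R : realType) (n d : nat) (x : 'I_n -> 'rV[R]_d).

(* The set {x_j}; points with different indices may coincide. *)
Definition point_set := seq_sub (codom x).

Definition point (j : 'I_n) : point_set := SeqSub (codom_f x j).

(* With k + 1 marginals: j_1 is j ord0, j_{k+1} is j ord_max, and the sum runs
   over the k pairs of consecutive positions. *)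
Definition euler_cost (k : nat) (sigma : {perm point_set}) :
    tensor R n k.+1 :=
  fun j =>
    enorm (val (sigma (point (j ord0))) - x (j ord_max)) ^+ 2
    + \sum_(t < k)
        enorm (x (j (lift ord0 t)) - x (j (widen_ord (leqnSn k) t))) ^+ 2.

(* s lists sigma by indices; it is unique when the x_j are distinct. *)
Definition encodes (sigma : {perm point_set}) (s : 'I_n -> 'I_n) : Prop :=
  forall j, val (sigma (point j)) = x (s j).

End EulerFlow.

Definition real_vectors (R : realType) (I : Type) (m : nat)
    (v : I -> 'rV[rat]_m) : I -> 'rV[R]_m :=
  fun i => map_mx ratr (v i).

Definition nbits (m : nat) : nat := (trunc_log 2 m).+1.
Definition bit_complexity (q : rat) : nat :=
  (nbits `|numq q|%N + nbits `|denq q|%N)%N.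

(* f(n, k) = poly(n, k) *)
Definition poly_bounded (f : nat -> nat -> nat) : Prop :=
  exists c : nat, forall n k : nat, (f n k <= c * (n + k).+1 ^ c)%N.

(* A uniform unit-cost machine over the ordered field of rationals: a program
   is a fixed piece of syntax acting on finitely many named, unbounded,
   randomly accessible arrays, some of natural numbers (for indices and
   counters) and some of rationals. There is no rounding operation and no
   conversion from rationals to naturals except through comparisons. *)

Inductive nexp : Type :=
  | NConst of nat
  | NGet of nat & nexp          (* array name, position *)
  | NAdd of nexp & nexp
  | NSub of nexp & nexp         (* truncated *)
  | NMul of nexp & nexp.

Inductive qexp : Type :=
  | QOfNat of nexp
  | QGet of nat & nexp
  | QAdd of qexp & qexp
  | QSub of qexp & qexp
  | QMul of qexp & qexp
  | QDiv of qexp & qexp.        (* x / 0 = 0 *)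

Inductive bexp : Type :=
  | NLe of nexp & nexp
  | QLe of qexp & qexp
  | BNot of bexp
  | BAnd of bexp & bexp.

Inductive cmd : Type :=
  | Skip
  | NSet of nat & nexp & nexp   (* array name, position, value *)
  | QSet of nat & nexp & qexp
  | Seq of cmd & cmd
  | If of bexp & cmd & cmd
  | While of bexp & cmd.

Record state : Type := State {
  nmem : nat -> nat -> nat;
  qmem : nat -> nat -> rat }.

Definition update (T : Type) (m : nat -> nat -> T) (a i : nat) (v : T) :
    nat -> nat -> T :=
  fun a' i' => if (a' == a) && (i' == i) then v else m a' i'.

Fixpoint neval (st : state) (e : nexp) : nat :=
  match e with
  | NConst m => m
  | NGet a i => nmem st a (neval st i)
  | NAdd e1 e2 => (neval st e1 + neval st e2)%N
  | NSub e1 e2 => (neval st e1 - neval st e2)%N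
  | NMul e1 e2 => (neval st e1 * neval st e2)%N
  end.

Fixpoint qeval (st : state) (e : qexp) : rat :=
  match e with
  | QOfNat e1 => (neval st e1)%:R
  | QGet a i => qmem st a (neval st i)
  | QAdd e1 e2 => qeval st e1 + qeval st e2
  | QSub e1 e2 => qeval st e1 - qeval st e2
  | QMul e1 e2 => qeval st e1 * qeval st e2
  | QDiv e1 e2 => qeval st e1 / qeval st e2
  end.

Fixpoint beval (st : state) (b : bexp) : bool :=
  match b with
  | NLe e1 e2 => (neval st e1 <= neval st e2)%N
  | QLe e1 e2 => qeval st e1 <= qeval st e2
  | BNot b1 => ~~ beval st b1
  | BAnd b1 b2 => beval st b1 && beval st b2
  end.

(* Every constant, memory access, arithmetic operation, comparison and
   connective costs one. *)
Fixpoint ncost (e : nexp) : nat :=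
  match e with
  | NConst _ => 1
  | NGet _ i => (ncost i).+1
  | NAdd e1 e2 | NSub e1 e2 | NMul e1 e2 => (ncost e1 + ncost e2).+1
  end.

Fixpoint qcost (e : qexp) : nat :=
  match e with
  | QOfNat e1 => (ncost e1).+1
  | QGet _ i => (ncost i).+1
  | QAdd e1 e2 | QSub e1 e2 | QMul e1 e2 | QDiv e1 e2 =>
      (qcost e1 + qcost e2).+1
  end.

Fixpoint bcost (b : bexp) : nat :=
  match b with
  | NLe e1 e2 => (ncost e1 + ncost e2).+1
  | QLe e1 e2 => (qcost e1 + qcost e2).+1
  | BNot b1 => (bcost b1).+1
  | BAnd b1 b2 => (bcost b1 + bcost b2).+1
  end.

(* exec c st t st': started in st, the command c halts in st' after t steps. *)
Inductive exec : cmd -> state -> nat -> state -> Prop :=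
  | ExecSkip st : exec Skip st 1 st
  | ExecNSet st a i e :
      exec (NSet a i e) st (ncost i + ncost e).+1
        (State (update (nmem st) a (neval st i) (neval st e)) (qmem st))
  | ExecQSet st a i e :
      exec (QSet a i e) st (ncost i + qcost e).+1
        (State (nmem st) (update (qmem st) a (neval st i) (qeval st e)))
  | ExecSeq c1 c2 st st1 st2 t1 t2 :
      exec c1 st t1 st1 -> exec c2 st1 t2 st2 ->
      exec (Seq c1 c2) st (t1 + t2)%N st2
  | ExecIfTrue b c1 c2 st st1 t :
      beval st b -> exec c1 st t st1 ->
      exec (If b c1 c2) st (bcost b + t)%N st1
  | ExecIfFalse b c1 c2 st st1 t :
      ~~ beval st b -> exec c2 st t st1 ->
      exec (If b c1 c2) st (bcost b + t)%N st1
  | ExecWhileFalse b c st :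
      ~~ beval st b -> exec (While b c) st (bcost b) st
  | ExecWhileTrue b c st st1 st2 t1 t2 :
      beval st b -> exec c st t1 st1 -> exec (While b c) st1 t2 st2 ->
      exec (While b c) st (bcost b + t1 + t2)%N st2.

(* Natural-number array 0 holds n, d, k and array 1 the table of sigma;
   rational array 0 holds the coordinates of the points (x_j at positions
   j * d, ..., j * d + d - 1) and array 1 the marginals (mu_i at positions
   i * n, ..., i * n + n - 1). All other cells are 0. *)
Definition input_state (n d k : nat) (x : 'I_n -> 'rV[rat]_d)
    (s : 'I_n -> 'I_n) (mu : 'I_k -> 'rV[rat]_n) : state :=
  State
    (fun a => match a with
      | 0 => nth 0%N [:: n; d; k]
      | 1 => nth 0%N [seq val (s j) | j <- enum 'I_n]
      | _ => fun=> 0%N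
      end)
    (fun a => match a with
      | 0 => nth 0 [seq x j 0 l | j <- enum 'I_n, l <- enum 'I_d]
      | 1 => nth 0 [seq mu i 0 b | i <- enum 'I_k, b <- enum 'I_n]
      | _ => fun=> 0
      end).

Definition sparse_tensor (n k : nat) := seq (multi_index n k * rat).

Definition tensor_of (R : realType) (n k : nat) (L : sparse_tensor n k) :
    tensor R n k :=
  fun j => \sum_(e <- L | e.1 == j) ratr e.2.

(* Natural-number array 2 holds the number of listed entries at position 0,
   array 3 the multi-index of the r-th entry at positions
   r * k, ..., r * k + k - 1, and rational array 2 its value at position r. *)
Definition outputs (n k : nat) (st : state) (L : sparse_tensor n k) : Prop :=
  nmem st 2 0 = size L /\
  forall r : 'I_(size L),
    (forall i : 'I_k,
       nmem st 3 (r * k + i)%N = (tnth (in_tuple L) r).1 i :> nat) /\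
    qmem st 2 r = (tnth (in_tuple L) r).2.

(* Main.v *)
Require Import Defs.
From mathcomp Require Import all_boot all_order all_algebra.
From mathcomp Require Import perm reals ring lra zify.

Set Implicit Arguments.
Unset Strict Implicit.
Unset Printing Implicit Defensive.

Import Order.TTheory GRing.Theory Num.Theory.

(** The cost only couples consecutive indices and the two ends of a
    multi-index, so the objective depends on a tensor [P] through the masses
    [X (t, a, b, b')] of the multi-indices that start at [a] and pass from [b]
    at time [t] to [b'] at time [t + 1], the time after the last one being
    again at [a]. These masses form a flow in [n] copies, one for each [a], of
    a graph with [K] layers of [n] nodes, [K] being the number of marginals.
    Conservation in each copy and the marginals, which add up over the copies,
    are linear equations with coefficients 0, 1 and -1 in the [K * n ^ 3]
    unknowns [X]. Conversely a non-negative solution is a combination of closed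
    paths, that is, of multi-indices. So the exponentially large problem has
    the same value as this linear program of polynomial size
    ([euler_cost_cells], [applyA_mix], [lower_bound], [answer_cost]).

    The linear program is solved by following the central path with exact
    rational arithmetic. The product coupling of the marginals gives an
    explicit interior point [x0] of the face spanned by the cells of positive
    product mass, and every feasible flow lies in this face. The pair of [x0]
    and of the slack [1 / x0] is exactly central for the objective [1 / x0]. A
    Newton step stays near the central path when its parameter changes by a
    factor [1 + 1 / 8N] or [1 - 1 / 8N] ([newton_step]). A first phase raises
    the parameter until exchanging the objective [1 / x0] for the cost hardly
    changes the centrality ([phase1_stop], [phase1_switch]); a second phase
    lowers it ([phase2_step]).

    There is no rounding on the machine, so the solver has to hit the optimum.
    In each round of the second phase both iterates are moved to vertices,
    along directions that do not increase the cost, by rank-one projections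
    ([purified_step]); the duality gap of the two vertices is at most the gap
    of the iterates. By Cramer's rule the coordinates of a vertex have
    denominators at most [N`!] times those of the data, so a gap that is small
    enough is zero ([cramer_int], [phase2_stop]). The machine tests the gap for
    zero; bit lengths appear only in the number of rounds, which is polynomial
    in them and in [n] and [K] and linear in [d], the data consisting of [n * d]
    coordinates ([rounds1_le], [rounds2_le]). Otherwise [d] only enters the
    computation of the [n ^ 2] squared distances ([dist_time]).

    The optimal flow is then decomposed into at most [K * n ^ 3] closed paths,
    by taking the bottleneck of one path after the other ([decomp_roundP]). The
    vector of the weights of the paths is moved to a vertex once more, now for
    the marginal equations, whose rank is at most [n + (K - 1) * (n - 1)]; this
    leaves [n * K - K + 1] paths ([answer_size]).

    The program is written in a language of counted loops, whose running time
    is a polynomial in the loop bounds ([exec_run], [time_bound_poly]); only the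
    loops of the two phases end by a test ([while_rule]). *)

(** * A language of counted loops *)

(** The fragment of the machine language in which the number of rounds of every
    loop is known in advance: [PFor v L p] takes its bound from the cell 0 of
    the array [L] and counts in the cell 0 of the array [v]. *)
Inductive prg : Type :=
  | PN of nat & nexp & nexp
  | PQ of nat & nexp & qexp
  | PSeq of prg & prg
  | PIf of bexp & prg & prg
  | PFor of nat & nat & prg.

Definition var (v : nat) : nexp := NGet v (NConst 0).
Definition qvar (v : nat) : qexp := QGet v (NConst 0).

Definition set_counter (st : state) (v i : nat) : state :=
  State (update (nmem st) v 0 i) (qmem st).

Fixpoint sem (p : prg) (st : state) : state :=
  match p with
  | PN a i e => State (update (nmem st) a (neval st i) (neval st e)) (qmem st)
  | PQ a i e => State (nmem st) (update (qmem st) a (neval st i) (qeval st e))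
  | PSeq p1 p2 => sem p2 (sem p1 st)
  | PIf b p1 p2 => if beval st b then sem p1 st else sem p2 st
  | PFor v L p1 =>
      set_counter
        (iteri (nmem st L 0) (fun i s => sem p1 (set_counter s v i)) st)
        v (nmem st L 0)
  end.

Fixpoint compile (p : prg) : cmd :=
  match p with
  | PN a i e => NSet a i e
  | PQ a i e => QSet a i e
  | PSeq p1 p2 => Seq (compile p1) (compile p2)
  | PIf b p1 p2 => If b (compile p1) (compile p2)
  | PFor v L p1 =>
      Seq (NSet v (NConst 0) (NConst 0))
        (While (BNot (NLe (var L) (var v)))
           (Seq (compile p1) (NSet v (NConst 0) (NAdd (var v) (NConst 1)))))
  end.

Fixpoint modN (p : prg) : seq nat :=
  match p with
  | PN a _ _ => [:: a]
  | PQ _ _ _ => [::]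
  | PSeq p1 p2 | PIf _ p1 p2 => modN p1 ++ modN p2
  | PFor v _ p1 => v :: modN p1
  end.

Fixpoint modQ (p : prg) : seq nat :=
  match p with
  | PN _ _ _ => [::]
  | PQ a _ _ => [:: a]
  | PSeq p1 p2 | PIf _ p1 p2 => modQ p1 ++ modQ p2
  | PFor _ _ p1 => modQ p1
  end.

(** Loop bounds are read from a reserved block of names that loops never
    write, so that the running time of a program depends on these alone. *)
Definition is_size (a : nat) : bool := (10 <= a < 20).

Fixpoint wf (p : prg) : bool :=
  match p with
  | PN a _ _ => ~~ is_size a
  | PQ _ _ _ => true
  | PSeq p1 p2 | PIf _ p1 p2 => wf p1 && wf p2
  | PFor v L p1 =>
      [&& is_size L, ~~ is_size v, v \notin modN p1 & wf p1]
  end.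

(** The 12 is the price of testing and incrementing the counter, the 9 that of
    setting it to zero and of the last test. *)
Fixpoint time_bound (p : prg) (sz : nat -> nat) : nat :=
  match p with
  | PN _ i e => (ncost i + ncost e).+1
  | PQ _ i e => (ncost i + qcost e).+1
  | PSeq p1 p2 => time_bound p1 sz + time_bound p2 sz
  | PIf b p1 p2 => bcost b + (time_bound p1 sz + time_bound p2 sz)
  | PFor _ L p1 => sz L * (time_bound p1 sz + 12) + 9
  end.

Lemma update_neq (T : Type) (m : nat -> nat -> T) a i v b j :
  b != a -> update m a i v b j = m b j.
Proof. by rewrite /update => /negbTE ->. Qed.

Lemma update_eq (T : Type) (m : nat -> nat -> T) a i v :
  update m a i v a i = v.
Proof. by rewrite /update !eqxx. Qed.

Lemma nmem_sem p st a i :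
  a \notin modN p -> nmem (sem p st) a i = nmem st a i.
Proof.
elim: p st => [b j e|b j e|p1 IH1 p2 IH2|b p1 IH1 p2 IH2|v L p1 IH] st //=.
- by rewrite inE => h; rewrite update_neq.
- by rewrite mem_cat => /norP[h1 h2]; rewrite IH2 ?IH1.
- by rewrite mem_cat => /norP[h1 h2]; case: ifP => _; [rewrite IH1|rewrite IH2].
- rewrite inE => /norP[h1 h2]; rewrite update_neq //.
  elim: (nmem st L 0) => [//|m IHm] /=.
  by rewrite IH //= update_neq.
Qed.

Lemma qmem_sem p st a i :
  a \notin modQ p -> qmem (sem p st) a i = qmem st a i.
Proof.
elim: p st => [b j e|b j e|p1 IH1 p2 IH2|b p1 IH1 p2 IH2|v L p1 IH] st //=.
- by rewrite inE => h; rewrite update_neq.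
- by rewrite mem_cat => /norP[h1 h2]; rewrite IH2 ?IH1.
- by rewrite mem_cat => /norP[h1 h2]; case: ifP => _; [rewrite IH1|rewrite IH2].
- by move=> h; elim: (nmem st L 0) => [//|m IHm] /=; rewrite IH.
Qed.

Lemma modN_wf p a : wf p -> is_size a -> a \notin modN p.
Proof.
elim: p => [b j e|b j e|p1 IH1 p2 IH2|b p1 IH1 p2 IH2|v L p1 IH] //=.
- by move=> h ha; rewrite inE; apply: contraNneq h => <-.
- by move=> /andP[w1 w2] h; rewrite mem_cat negb_or IH1 ?IH2.
- by move=> /andP[w1 w2] h; rewrite mem_cat negb_or IH1 ?IH2.
- move=> /and4P[_ hv _ w] h; rewrite inE negb_or IH // andbT.
  by apply: contraNneq hv => <-.
Qed.

Lemma size_sem p st a : wf p -> is_size a -> nmem (sem p st) a 0 = nmem st a 0.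
Proof. by move=> w h; rewrite nmem_sem // modN_wf. Qed.

Fixpoint loop_sizes (p : prg) : seq nat :=
  match p with
  | PN _ _ _ | PQ _ _ _ => [::]
  | PSeq p1 p2 | PIf _ p1 p2 => loop_sizes p1 ++ loop_sizes p2
  | PFor _ L p1 => L :: loop_sizes p1
  end.

Lemma loop_sizes_wf p a : wf p -> a \in loop_sizes p -> is_size a.
Proof.
elim: p => [b j e|b j e|p1 IH1 p2 IH2|b p1 IH1 p2 IH2|v L p1 IH] //=.
- by move=> /andP[w1 w2]; rewrite mem_cat => /orP[/IH1->|/IH2->].
- by move=> /andP[w1 w2]; rewrite mem_cat => /orP[/IH1->|/IH2->].
- by move=> /and4P[hL _ _ w]; rewrite inE => /orP[/eqP->//|/IH->].
Qed.

Lemma eq_time_bound p sz sz' :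
  {in loop_sizes p, sz =1 sz'} -> time_bound p sz = time_bound p sz'.
Proof.
elim: p => [b j e|b j e|p1 IH1 p2 IH2|b p1 IH1 p2 IH2|v L p1 IH] //= h.
- by rewrite IH1 ?IH2 // => a ha; apply: h; rewrite mem_cat ha ?orbT.
- by rewrite IH1 ?IH2 // => a ha; apply: h; rewrite mem_cat ha ?orbT.
- by rewrite IH ?h ?inE ?eqxx // => a ha; apply: h; rewrite inE ha orbT.
Qed.

(** The meaning of a program is used through the equations below only. Sealing
    it keeps the comparison of memory cells after different blocks from
    unrolling the loops of these blocks. *)
Fact run_key : unit. Proof. exact: tt. Qed.
Definition run : prg -> state -> state := locked_with run_key sem.

Lemma runE : run = sem.
Proof. by rewrite /run unlock. Qed.

Lemma runS p q st : run (PSeq p q) st = run q (run p st).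
Proof. by rewrite runE. Qed.

Lemma runN a i e st : run (PN a i e) st =
  State (update (nmem st) a (neval st i) (neval st e)) (qmem st).
Proof. by rewrite runE. Qed.

Lemma runQ a i e st : run (PQ a i e) st =
  State (nmem st) (update (qmem st) a (neval st i) (qeval st e)).
Proof. by rewrite runE. Qed.

Lemma runIf b p q st :
  run (PIf b p q) st = if beval st b then run p st else run q st.
Proof. by rewrite runE. Qed.

Lemma nmem_run p st a i : a \notin modN p -> nmem (run p st) a i = nmem st a i.
Proof. by rewrite runE; apply: nmem_sem. Qed.

Lemma qmem_run p st a i : a \notin modQ p -> qmem (run p st) a i = qmem st a i.
Proof. by rewrite runE; apply: qmem_sem. Qed.

Lemma size_run p st a : wf p -> is_size a -> nmem (run p st) a 0 = nmem st a 0.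
Proof. by rewrite runE; apply: size_sem. Qed.

(** The bound is computed from the initial sizes: they never change, hence
    every round of a loop obeys the same bound. *)
Lemma exec_run p st : wf p ->
  exists2 t, (t <= time_bound p (fun a => nmem st a 0))
    & exec (compile p) st t (run p st).
Proof.
rewrite runE; elim: p st => [b j e|b j e|p1 IH1 p2 IH2|b p1 IH1 p2 IH2|v L p1 IH] st /=.
- by move=> _; eexists; last exact: ExecNSet.
- by move=> _; eexists; last exact: ExecQSet.
- move=> /andP[w1 w2]; have [t1 l1 e1] := IH1 st w1.
  have [t2 l2 e2] := IH2 (sem p1 st) w2.
  exists (t1 + t2); last exact: ExecSeq e1 e2.
  apply: leq_add => //; apply: leq_trans l2 _.
  rewrite (eq_time_bound (sz' := fun a => nmem st a 0)) // => a /(loop_sizes_wf w2).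
  exact: size_sem.
- move=> /andP[w1 w2]; case: ifP => hb.
    have [t1 l1 e1] := IH1 st w1; exists (bcost b + t1).
      by rewrite leq_add2l; apply: leq_trans l1 (leq_addr _ _).
    exact: ExecIfTrue.
  have [t1 l1 e1] := IH2 st w2; exists (bcost b + t1).
    by rewrite leq_add2l; apply: leq_trans l1 (leq_addl _ _).
  by apply: ExecIfFalse; rewrite ?hb.
- move=> /and4P[hL hv hvp w]; set m := nmem st L 0.
  set F := fun (i : nat) s => sem p1 (set_counter s v i).
  set T := time_bound p1 (fun a => nmem st a 0).
  have sF i a : is_size a -> nmem (iteri i F st) a 0 = nmem st a 0.
    move=> ha; elim: i => [//|i IHi] /=; rewrite size_sem //= update_neq //.
    by apply: contraNneq hv => <-.
  have vL : L != v by apply: contraNneq hv => <-.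
  have test i : beval (set_counter (iteri i F st) v i)
      (BNot (NLe (var L) (var v))) = (i < m).
    by rewrite /= update_eq update_neq // sF // -ltnNge.
  have loop j i : (j + i = m) ->
      exists2 t, (t <= j * (T + 12) + 6) &
      exec (While (BNot (NLe (var L) (var v)))
           (Seq (compile p1) (NSet v (NConst 0) (NAdd (var v) (NConst 1)))))
        (set_counter (iteri i F st) v i) t (set_counter (iteri m F st) v m).
    elim: j i => [|j IHj] i; rewrite ?add0n => hij.
      rewrite hij; exists 6 => //; apply: ExecWhileFalse.
      by rewrite test ltnn.
    have [t1 l1 e1] := IH (set_counter (iteri i F st) v i) w.
    have /IHj[t2 l2 e2] : (j + i.+1 = m) by rewrite addnS -addSn.
    exists (6 + (t1 + 6) + t2).
      have : (t1 <= T).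
        apply: leq_trans l1 _; rewrite /T (eq_time_bound (sz' := fun a => nmem st a 0)) //.
        move=> a /(loop_sizes_wf w) ha /=; rewrite update_neq ?sF //.
        by apply: contraNneq hv => <-.
      lia.
    apply: ExecWhileTrue; first by rewrite test -hij; lia.
      apply: ExecSeq e1 _; exact: ExecNSet.
    rewrite /= nmem_sem //= update_eq addn1.
    exact: e2.
  have [t l e] := loop m 0 (addn0 _).
  exists (3 + t); first lia.
  by apply: ExecSeq e; exact: ExecNSet.
Qed.

Fixpoint loop_depth (p : prg) : nat :=
  match p with
  | PN _ _ _ | PQ _ _ _ => 0
  | PSeq p1 p2 | PIf _ p1 p2 => maxn (loop_depth p1) (loop_depth p2)
  | PFor _ _ p1 => (loop_depth p1).+1
  end.

(** A loop multiplies the time of its body by one size. *)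
Lemma time_bound_poly p : exists c, forall sz S, (0 < S) ->
  (forall a, a \in loop_sizes p -> sz a <= S) -> (time_bound p sz <= c * S ^ loop_depth p).
Proof.
elim: p => [b j e|b j e|p1 [c1 IH1] p2 [c2 IH2]|b p1 [c1 IH1] p2 [c2 IH2]
           |v L p1 [c IH]] /=.
- by exists (ncost j + ncost e).+1 => sz S _ _; rewrite expn0 muln1.
- by exists (ncost j + qcost e).+1 => sz S _ _; rewrite expn0 muln1.
- exists (c1 + c2) => sz S S0 hS; rewrite mulnDl.
  have h1 a : a \in loop_sizes p1 -> sz a <= S by move=> ha; apply: hS; rewrite mem_cat ha.
  have h2 a : a \in loop_sizes p2 -> sz a <= S by move=> ha; apply: hS; rewrite mem_cat ha orbT.
  apply: leq_add; [apply: leq_trans (IH1 _ _ S0 h1) _|apply: leq_trans (IH2 _ _ S0 h2) _];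
    by rewrite leq_mul2l leq_pexp2l ?orbT // ?leq_maxl ?leq_maxr.
- exists (bcost b + (c1 + c2)) => sz S S0 hS; rewrite !mulnDl.
  apply: leq_add; first by rewrite leq_pmulr // expn_gt0 S0.
  have h1 a : a \in loop_sizes p1 -> sz a <= S by move=> ha; apply: hS; rewrite mem_cat ha.
  have h2 a : a \in loop_sizes p2 -> sz a <= S by move=> ha; apply: hS; rewrite mem_cat ha orbT.
  apply: leq_add; [apply: leq_trans (IH1 _ _ S0 h1) _|apply: leq_trans (IH2 _ _ S0 h2) _];
    by rewrite leq_mul2l leq_pexp2l ?orbT // ?leq_maxl ?leq_maxr.
- exists (c + 21) => sz S S0 hS.
  have h1 : (time_bound p1 sz + 12 <= (c + 12) * S ^ loop_depth p1).
    rewrite mulnDl leq_add ?IH // ?leq_pmulr // ?expn_gt0 ?S0 //.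
    by move=> a ha; apply: hS; rewrite inE ha orbT.
  have h2 := leq_mul (hS L (mem_head _ _)) h1.
  rewrite expnS; apply: leq_trans (leq_add h2 (leqnn 9)) _.
  have : (0 < S * S ^ loop_depth p1) by rewrite muln_gt0 S0 expn_gt0 S0.
  nia.
Qed.

(** Loop invariants: [P i] describes the memory before round [i]. *)
Lemma for_run (P : nat -> state -> Prop) v L p st :
  P 0 st ->
  (forall i s, (i < nmem st L 0) -> P i s -> P i.+1 (run p (set_counter s v i))) ->
  exists2 s, P (nmem st L 0) s
    & run (PFor v L p) st = set_counter s v (nmem st L 0).
Proof.
rewrite runE => P0 step; eexists; last by [].
have : (nmem st L 0 <= nmem st L 0) by [].
elim: {1 3 4}(nmem st L 0) => [//|m IH] lm /=.
by apply: step => //; apply: IH; apply: ltnW.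
Qed.

(** * Array comprehensions *)

Fixpoint qreads (e : qexp) : seq nat :=
  match e with
  | QOfNat _ => [::]
  | QGet a _ => [:: a]
  | QAdd e1 e2 | QSub e1 e2 | QMul e1 e2 | QDiv e1 e2 => qreads e1 ++ qreads e2
  end.

Lemma eq_neval st st' e :
  (forall a i, nmem st a i = nmem st' a i) -> neval st e = neval st' e.
Proof.
by move=> h; elim: e => [//|a e IH|e1 IH1 e2 IH2|e1 IH1 e2 IH2|e1 IH1 e2 IH2] /=;
  rewrite ?IH ?IH1 ?IH2 ?h.
Qed.

Lemma eq_qeval st st' e :
  (forall a i, nmem st a i = nmem st' a i) ->
  (forall a i, a \in qreads e -> qmem st a i = qmem st' a i) ->
  qeval st e = qeval st' e.
Proof.
move=> h; elim: e => [e|a e|e1 IH1 e2 IH2|e1 IH1 e2 IH2|e1 IH1 e2 IH2|e1 IH1 e2 IH2] /= hq.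
- by rewrite (eq_neval _ h).
- by rewrite (eq_neval _ h) hq ?inE.
all: by rewrite IH1 ?IH2 // => a i ha; apply: hq; rewrite mem_cat ha ?orbT.
Qed.

(* Comprehensions use the names 20 and 21 for their indices and the rational
   name 19 for an accumulator. *)
Notation vi := (var 20).
Notation vj := (var 21).

Definition at_index (st : state) (i j : nat) : state :=
  set_counter (set_counter st 20 i) 21 j.

(** Maps over an array and sums of an array are both obtained from this form,
    by a range of length 1. *)
Definition vec_sum (A L1 L2 : nat) (e : qexp) : prg :=
  PFor 20 L1 (PSeq (PQ 19 (NConst 0) (QOfNat (NConst 0)))
    (PSeq (PFor 21 L2 (PQ 19 (NConst 0) (QAdd (qvar 19) e)))
      (PQ A vi (qvar 19)))).

Definition matQ (A L1 L2 : nat) (e : qexp) : prg :=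
  PFor 20 L1 (PFor 21 L2 (PQ A (NAdd (NMul vi (var L2)) vj) e)).

Definition matN (A L1 L2 : nat) (e : nexp) : prg :=
  PFor 20 L1 (PFor 21 L2 (PN A (NAdd (NMul vi (var L2)) vj) e)).


Lemma is_size_neq L a : is_size L -> ~~ is_size a -> L != a.
Proof. by move=> h; apply: contraNneq => <-. Qed.


Lemma update_off (T : Type) (m : nat -> nat -> T) a i v b j :
  (b != a) || (j != i) -> update m a i v b j = m b j.
Proof. by rewrite /update -negb_and => /negbTE ->. Qed.

Lemma eq_update (T : Type) (m m' : nat -> nat -> T) a i v b j :
  ((b != a) || (j != i) -> m b j = m' b j) ->
  update m a i v b j = update m' a i v b j.
Proof. by rewrite /update -negb_and; case: ifP => // _; apply. Qed.

Lemma sum_loopP L e s : is_size L -> 19 \notin qreads e ->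
  qmem s 19 0 = 0%R ->
  let s' := run (PFor 21 L (PQ 19 (NConst 0) (QAdd (qvar 19) e))) s in
  qmem s' 19 0 = (\sum_(j < nmem s L 0) qeval (set_counter s 21 j) e)%R /\
  (forall a l, (a != 21) || (l != 0) -> nmem s' a l = nmem s a l).
Proof.
move=> sL r19 q0.
pose P j s' := [/\ forall a l, (a != 21) || (l != 0) -> nmem s' a l = nmem s a l,
  forall a l, a != 19 -> qmem s' a l = qmem s a l &
  qmem s' 19 0 = (\sum_(i < j) qeval (set_counter s 21 i) e)%R].
have [|j s' _ [P1 P2 P3]|s' [F _ E] -> /=] := @for_run P 21 L
  (PQ 19 (NConst 0) (QAdd (qvar 19) e)) s.
- by split; rewrite // big_ord0.
- rewrite runQ; split=> [a l ha|a l ha|] /=.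
  + by rewrite update_off ?P1.
  + by rewrite update_neq ?P2.
  + rewrite update_eq big_ord_recr /= P3; congr (_ + _)%R; apply: eq_qeval => a l.
      by apply: eq_update => /P1.
    by move=> ha; rewrite P2 //; apply: contraNneq r19 => <-.
- by split=> // a l h; rewrite update_off ?F.
Qed.

Lemma vec_sumP A L1 L2 e st p :
  is_size L2 -> A != 19 ->
  A \notin qreads e -> 19 \notin qreads e -> (p < nmem st L1 0) ->
  qmem (run (vec_sum A L1 L2 e) st) A p
  = (\sum_(j < nmem st L2 0) qeval (at_index st p j) e)%R.
Proof.
move=> s2 hA rA r19 ltp.
pose P i s := [/\ forall a l, (a != 20) || (l != 0) ->
    (a != 21) || (l != 0) -> nmem s a l = nmem st a l,
  forall a l, a != A -> a != 19 -> qmem s a l = qmem st a l &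
  forall l, (l < i) -> qmem s A l =
    (\sum_(j < nmem st L2 0) qeval (at_index st l j) e)%R].
rewrite /vec_sum; set body := PSeq _ _.
have [//||s [_ _ Ps] ->] := @for_run P 20 L1 body st; last exact: Ps.
move=> i s lti [P1 P2 P3] {ltp}.
have L20 : L2 != 20 by apply: is_size_neq.
have L21 : L2 != 21 by apply: is_size_neq.
set s0 := run (PQ 19 (NConst 0) (QOfNat (NConst 0))) (set_counter s 20 i).
have E0 : s0 = State (nmem (set_counter s 20 i)) (update (qmem s) 19 0 0%R) by rewrite /s0 runQ.
have q0 : qmem s0 19 0 = 0%R by rewrite E0 /= update_eq.
have [] := sum_loopP s2 r19 q0; set s' := run _ s0 => E F.
have -> : run body (set_counter s 20 i) = run (PQ A vi (qvar 19)) s' by rewrite /body !runS.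
have fQ a l : a != 19 -> qmem s' a l = qmem s a l.
  by move=> h; rewrite /s' qmem_run ?inE // E0 /= update_neq.
clearbody s'; rewrite E0 in E F => {E0 q0 s0}.
have v20 : nmem s' 20 0 = i by rewrite F //= update_eq.
have {}E : qmem s' 19 0 = (\sum_(j < nmem st L2 0) qeval (at_index st i j) e)%R.
  rewrite E /= [update _ _ _ _ L2 _]update_neq // P1 ?L20 ?L21 //.
  apply: eq_bigr => j _; apply: eq_qeval => a m.
    by apply: eq_update => h2; apply: eq_update => h1; apply: P1.
  move=> ha; have a19 : a != 19 by apply: contraNneq r19 => <-.
  by rewrite /= update_neq // P2 //; apply: contraNneq rA => <-.
have {}F a l : (a != 20) || (l != 0) -> (a != 21) || (l != 0) ->
    nmem s' a l = nmem st a l.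
  by move=> h1 h2; rewrite F //= update_off // P1.
rewrite runQ; split=> [//|a l h1 h2|l] /=.
  by rewrite update_neq // fQ // P2.
rewrite v20 ltnS leq_eqVlt; have [-> _|nl] := eqVneq l i.
  by rewrite update_eq E.
by move=> /= ltl; rewrite update_off ?nl ?orbT // fQ // P3.
Qed.

Lemma mat_pos_inj m i j i' j' : (j < m) -> (j' < m) ->
  (i * m + j == i' * m + j') = (i == i') && (j == j').
Proof.
move=> h h'; apply/eqP/andP => [E|[/eqP-> /eqP->]] //.
have m0 : (0 < m) by case: m h {h' E}.
have := congr1 (divn^~ m) E; rewrite /= !divnMDl // !divn_small // !addn0 => Ei.
by move: E; rewrite Ei => /addnI ->.
Qed.

(** A double loop that writes one cell per round fills a grid; [view] is the
    array written, [Q] what the other rounds may rely upon. *)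
Lemma grid_run (T : Type) (view : state -> nat -> T) (V : nat -> nat -> T)
    (Q : state -> Prop) L1 L2 body st (m := nmem st L2 0) :
  Q st -> (forall s, Q s -> nmem s L2 0 = m) ->
  (forall s v x, v \in [:: 20; 21] -> Q s -> Q (set_counter s v x)) ->
  (forall s v x p, v \in [:: 20; 21] -> view (set_counter s v x) p = view s p) ->
  (forall s x y, Q s -> nmem s 20 0 = x -> nmem s 21 0 = y ->
     [/\ Q (run body s), nmem (run body s) 20 0 = x &
       forall p, view (run body s) p = if p == x * m + y then V x y else view s p]) ->
  forall i j, i < nmem st L1 0 -> j < m ->
  view (run (PFor 20 L1 (PFor 21 L2 body)) st) (i * m + j) = V i j.
Proof.
move=> Q0 QL Qv Vv step i j lti ltj.
pose P i s := Q s /\ forall x y, x < i -> y < m -> view s (x * m + y) = V x y.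
have [//||s [_ Ps] ->] := @for_run P 20 L1 (PFor 21 L2 body) st; last by rewrite Vv ?Ps.
move=> {lti ltj i j} i s _ [Qs Ps]; set s1 := set_counter s 20 i.
have Q1 : Q s1 by apply: Qv.
pose R j s' := [/\ Q s', nmem s' 20 0 = i & forall x y,
  (x < i) && (y < m) || (x == i) && (y < j) -> view s' (x * m + y) = V x y].
have [||s' [Q' _ R'] ->] := @for_run R 21 L2 body s1; rewrite ?(QL _ Q1).
- split; rewrite /= ?update_eq // => x y.
  by rewrite ltn0 andbF orbF Vv // => /andP[]; apply: Ps.
- move=> j s' ltj [Q' i' R']; set s2 := set_counter s' 21 j.
  have [||Qb ib Vb] := step s2 i j (Qv _ 21 j isT Q'); rewrite /= ?update_eq //.
  split=> // x y hxy; have ym : y < m.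
    by case/orP: hxy => /andP[_ //]; rewrite ltnS => /leq_ltn_trans; apply.
  rewrite Vb mat_pos_inj //; case: ifP => [/andP[/eqP-> /eqP->] //|/negbT].
  rewrite negb_and Vv // => ne; apply: R'; move: ne hxy; rewrite ltnS (leq_eqVlt y).
  by case: (x =P i) => //= -> /negbTE ->; rewrite ltnn.
- rewrite (QL _ Q1) in R'; split; first exact: Qv.
  move=> x y; rewrite ltnS leq_eqVlt Vv // => h hy; apply: R'.
  by rewrite hy !andbT orbC.
Qed.

Lemma matQP A L1 L2 e st i j :
  is_size L2 -> A \notin qreads e ->
  i < nmem st L1 0 -> j < nmem st L2 0 ->
  qmem (run (matQ A L1 L2 e) st) A (i * nmem st L2 0 + j)
  = qeval (at_index st i j) e.
Proof.
move=> s2 rA; have L20 : L2 != 20 by apply: is_size_neq.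
have L21 : L2 != 21 by apply: is_size_neq.
apply: (@grid_run _ (fun s => qmem s A) (fun x y => qeval (at_index st x y) e)
  (fun s => (forall a l, (a != 20) || (l != 0) -> (a != 21) || (l != 0) ->
       nmem s a l = nmem st a l) /\ forall a l, a != A -> qmem s a l = qmem st a l)) => //.
- by move=> s [R _]; rewrite R ?L20 ?L21.
- move=> s v x; rewrite !inE => hv [R R']; split=> //= a l h h'.
  by rewrite update_off ?R //; case/orP: hv => /eqP->.
- move=> s x y [R R'] hx hy; rewrite runQ; split=> //=.
    by split=> // a l h /=; rewrite update_neq ?R'.
  move=> p; rewrite [nmem s L2 0]R ?L20 ?L21 // hx hy /update eqxx /=; case: ifP => // _.
  apply: eq_qeval => a l /=; last by move=> ha; apply: R'; apply: contraNneq rA => <-.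
  rewrite /update; case: ifP => [/andP[/eqP-> /eqP->] //|/negbT].
  rewrite negb_and => h2; case: ifP => [/andP[/eqP-> /eqP->] //|/negbT].
  by rewrite negb_and => h1; apply: R.
Qed.

Lemma matNP A L1 L2 e st i j :
  is_size L2 -> ~~ is_size A -> A != 20 -> A != 21 ->
  (forall s s', (forall a l, a != A -> nmem s a l = nmem s' a l) ->
     neval s e = neval s' e) ->
  i < nmem st L1 0 -> j < nmem st L2 0 ->
  nmem (run (matN A L1 L2 e) st) A (i * nmem st L2 0 + j)
  = neval (at_index st i j) e.
Proof.
move=> s2 sA A20 A21 rA; have L20 : L2 != 20 by apply: is_size_neq.
have L21 : L2 != 21 by apply: is_size_neq.
have LA : L2 != A by apply: is_size_neq.
apply: (@grid_run _ (fun s => nmem s A)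
  (fun x y => neval (at_index st x y) e) (fun s => forall a l, a != A ->
     (a != 20) || (l != 0) -> (a != 21) || (l != 0) -> nmem s a l = nmem st a l)) => //.
- by move=> s R; rewrite R ?L20 ?L21 ?LA.
- move=> s v x; rewrite !inE => hv R a l h0 h h' /=.
  by rewrite update_off ?R //; case/orP: hv => /eqP->.
- by move=> s v x p; rewrite !inE => hv /=; rewrite update_neq //; case/orP: hv => /eqP->.
- move=> s x y R hx hy; rewrite runN; split=> /=.
  + by move=> a l h0 h h'; rewrite /= update_neq ?R.
  + by rewrite update_neq // eq_sym.
  move=> p; rewrite [nmem s L2 0]R ?L20 ?L21 ?LA // hx hy /update eqxx /=; case: ifP => // _.
  apply: rA => a l ha /=.
  rewrite /update; case: ifP => [/andP[/eqP-> /eqP->] //|/negbT].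
  rewrite negb_and => h2; case: ifP => [/andP[/eqP-> /eqP->] //|/negbT].
  by rewrite negb_and => h1; apply: R.
Qed.

Local Open Scope ring_scope.

(** * Projections by rank-one elimination *)

Section Elimination.
Variables (F : realFieldType) (N : nat).
Implicit Types (Q : 'M[F]_N) (a b u v w y z g : 'cV[F]_N).

Definition dot u v : F := \sum_i u i 0 * v i 0.

Lemma dotE u v : dot u v = (u^T *m v) 0 0.
Proof. by rewrite mxE; apply: eq_bigr => i _; rewrite mxE. Qed.

Lemma dotC u v : dot u v = dot v u.
Proof. by apply: eq_bigr => i _; rewrite mulrC. Qed.

Lemma dotDr u v w : dot u (v + w) = dot u v + dot u w.
Proof. by rewrite !dotE mulmxDr mxE. Qed.

Lemma dotZr u c v : dot u (c *: v) = c * dot u v.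
Proof. by rewrite !dotE -scalemxAr mxE. Qed.

Lemma dotBr u v w : dot u (v - w) = dot u v - dot u w.
Proof. by rewrite dotDr -scaleN1r dotZr mulN1r. Qed.

Lemma dotDl u v w : dot (v + w) u = dot v u + dot w u.
Proof. by rewrite dotC dotDr !(dotC u). Qed.

Lemma dotBl u v w : dot (v - w) u = dot v u - dot w u.
Proof. by rewrite dotC dotBr !(dotC u). Qed.

Lemma dotZl u c v : dot (c *: v) u = c * dot v u.
Proof. by rewrite dotC dotZr dotC. Qed.

Lemma dot0r u : dot u 0 = 0.
Proof. by rewrite dotE mulmx0 mxE. Qed.

Lemma dot0l u : dot 0 u = 0. Proof. by rewrite dotC dot0r. Qed.

Lemma dot_delta i u : dot (delta_mx i 0) u = u i 0.
Proof.
rewrite /dot (bigD1 i) //= mxE !eqxx mul1r big1 ?addr0 // => j /negbTE nj.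
by rewrite mxE nj mul0r.
Qed.

Lemma dot_sym Q u v : Q^T = Q -> dot u (Q *m v) = dot v (Q *m u).
Proof.
move=> hQ; rewrite [RHS]dotC !dotE trmx_mul hQ mulmxA.
by [].
Qed.

Definition psd Q : Prop := Q^T = Q /\ forall u, 0 <= dot u (Q *m u).

(** A positive semidefinite form that vanishes at [a] pairs to zero with
    everything: otherwise it would take negative values near [a]. *)
Lemma psd_kernel Q a : psd Q -> dot a (Q *m a) = 0 -> Q *m a = 0.
Proof.
move=> [hs hp] ha; apply/colP => i; rewrite [in RHS]mxE -dot_delta.
set e := delta_mx i 0; set b := dot e (Q *m a); set c := dot e (Q *m e).
have h t : 0 <= c + 2 * t * b.
  have := hp (e + t *: a); rewrite mulmxDr -scalemxAr !dotDl !dotDr !dotZl !dotZr.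
  by rewrite ha (dot_sym a e hs) -/b -/c; lra.
have c0 : 0 <= c by apply: hp.
have [//|nb] := eqVneq b 0.
have := h (- (c + 1) / (2 * b)).
have -> : c + 2 * (- (c + 1) / (2 * b)) * b = -1 by field; rewrite nb.
lra.
Qed.

(** Rank-one elimination: the image of the result is the part of the image of
    [Q] orthogonal to [a]. When [a] is already orthogonal to the image, the
    convention [0^-1 = 0] leaves [Q] unchanged. *)
Definition elim Q a : 'M[F]_N :=
  Q - (dot a (Q *m a))^-1 *: (Q *m a *m (Q *m a)^T).

Lemma elim_mul Q a y : Q^T = Q ->
  elim Q a *m y = Q *m y - ((dot a (Q *m a))^-1 * dot a (Q *m y)) *: (Q *m a).
Proof.
move=> hs; have E : (Q *m a)^T *m y = (dot a (Q *m y))%:M.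
  by rewrite trmx_mul hs -mulmxA [LHS]mx11_scalar -dotE.
by rewrite /elim mulmxBl -scalemxAl -(mulmxA (Q *m a)) E mul_mx_scalar scalerA.
Qed.

Lemma psd_elim Q a : psd Q -> psd (elim Q a).
Proof.
move=> [hs hp]; split.
  by rewrite /elim linearB /= hs linearZ /= trmx_mul trmxK.
move=> u; rewrite elim_mul // dotBr dotZr.
set d := dot a (Q *m a); rewrite (dot_sym u a hs).
have [d0|nd] := eqVneq d 0; first by rewrite d0 invr0 !mul0r subr0 hp.
have d0 : 0 < d by rewrite lt_def nd hp.
set c := dot a (Q *m u).
have := hp (u - (c / d) *: a); rewrite mulmxBr -scalemxAr !dotBl !dotBr !dotZl !dotZr.
rewrite (dot_sym u a hs) -/c -/d.
suff -> : dot u (Q *m u) - c / d * c - (c / d * c - c / d * (c / d * d))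
  = dot u (Q *m u) - d^-1 * c * c by [].
by field.
Qed.

Lemma elim_orth Q a y : psd Q -> dot a (elim Q a *m y) = 0.
Proof.
move=> hQ; rewrite elim_mul ?dotBr ?dotZr; last by case: hQ.
have [d0|nd] := eqVneq (dot a (Q *m a)) 0; last by field.
by rewrite (dot_sym a y) ?(psd_kernel hQ d0) ?dot0r ?mulr0 ?subr0 //; case: hQ.
Qed.

Lemma elim_keep Q a b : Q^T = Q -> (forall y, dot b (Q *m y) = 0) ->
  forall y, dot b (elim Q a *m y) = 0.
Proof. by move=> hs h y; rewrite elim_mul // dotBr dotZr !h mulr0 subr0. Qed.

Lemma elim_fix Q a y : Q^T = Q -> dot a (Q *m y) = 0 -> elim Q a *m y = Q *m y.
Proof. by move=> hs h; rewrite elim_mul // h mulr0 scale0r subr0. Qed.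

Lemma elim_range Q a y : Q^T = Q -> exists y', elim Q a *m y = Q *m y'.
Proof.
move=> hs; rewrite elim_mul //.
by eexists (y - _ *: a); rewrite mulmxBr -scalemxAr.
Qed.

(** Eliminating vectors one after the other projects onto the subspace
    orthogonal to all of them, as far as the image of [Q] goes. *)
Fixpoint elimn (a : nat -> 'cV[F]_N) (r : nat) Q : 'M[F]_N :=
  if r is r'.+1 then elim (elimn a r' Q) (a r') else Q.

Section Elimn.
Variables (a : nat -> 'cV[F]_N) (Q : 'M[F]_N).
Hypothesis hQ : psd Q.

Lemma psd_elimn r : psd (elimn a r Q).
Proof. by elim: r => //= r IH; apply: psd_elim. Qed.

Lemma sym_elimn r : (elimn a r Q)^T = elimn a r Q.
Proof. by case: (psd_elimn r). Qed.

Lemma elimn_orth r i y : (i < r)%N -> dot (a i) (elimn a r Q *m y) = 0.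
Proof.
elim: r i y => // r IH i y; rewrite ltnS leq_eqVlt => /orP[/eqP->|lt] /=.
  exact/elim_orth/psd_elimn.
by apply: elim_keep => [|u]; [apply: sym_elimn|apply: IH].
Qed.

Lemma elimn_keep b r : (forall y, dot b (Q *m y) = 0) ->
  forall y, dot b (elimn a r Q *m y) = 0.
Proof.
move=> h; elim: r => [//|r IH] y /=.
by apply: elim_keep IH y; apply: sym_elimn.
Qed.

Lemma elimn_fix r y : (forall i, (i < r)%N -> dot (a i) (Q *m y) = 0) ->
  elimn a r Q *m y = Q *m y.
Proof.
elim: r => [//|r IH] h /=; have E : elimn a r Q *m y = Q *m y.
  by apply: IH => i lt; apply: h; rewrite ltnS ltnW.
by rewrite elim_fix ?sym_elimn // E // h.
Qed.

Lemma elimn_range r y : exists y', elimn a r Q *m y = Q *m y'.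
Proof.
elim: r y => [|r IH] y /=; first by exists y.
have [y1 ->] := elim_range (a r) y (sym_elimn r); exact: IH.
Qed.

End Elimn.

Definition diag w : 'M[F]_N := \matrix_(i, j) (w i 0 *+ (i == j)).

Lemma diag_mul w u i : (diag w *m u) i 0 = w i 0 * u i 0.
Proof.
rewrite mxE (bigD1 i) //= !mxE eqxx mulr1n big1 ?addr0 // => j nj.
by rewrite mxE eq_sym (negbTE nj) mulr0n mul0r.
Qed.

Lemma psd_diag w : (forall i, 0 <= w i 0) -> psd (diag w).
Proof.
move=> h; split.
  by apply/matrixP => i j; rewrite !mxE eq_sym; case: eqP => [->|].
move=> u; apply: sumr_ge0 => i _; rewrite diag_mul.
by have := mulr_ge0 (h i) (sqr_ge0 (u i 0)); rewrite expr2; nra.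
Qed.

(** ** Vertices *)

Definition nnz z : nat := #|[set i | z i 0 != 0]|.

(** The points of [z + Im Q] with non-negative entries form a polyhedron; its
    vertices are the points that no direction can leave within their face. *)
Definition vertex Q z : Prop := forall y,
  (forall i, z i 0 = 0 -> (Q *m y) i 0 = 0) -> Q *m y = 0.

(** The unit vector of the coordinate [r] if [z] vanishes there, and 0
    otherwise: by the convention on division, [z / z] is 0 or 1. A straight
    formula saves the machine a test. *)
Definition zero_row z (r : nat) : 'cV[F]_N :=
  \col_i ((r == i)%:R * (1 - z i 0 / z i 0)).

Lemma zero_rowE z i :
  zero_row z (i : 'I_N) = (if z i 0 == 0 then delta_mx i 0 else 0).
Proof.
apply/colP => j; rewrite mxE; case: eqVneq => [E|nE] /=.
  have -> : i = j by apply/val_inj.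
  case: eqVneq => [->|nz]; first by rewrite invr0 mulr0 subr0 mulr1 !mxE !eqxx.
  by rewrite divff // subrr mulr0 mxE.
rewrite mul0r; case: ifP => _; rewrite !mxE //.
by case: eqVneq => // E; rewrite E eqxx in nE.
Qed.

Definition clear z Q := elimn (zero_row z) N Q.

Lemma clear_zero Q z : psd Q ->
  forall i y, z i 0 = 0 -> (clear z Q *m y) i 0 = 0.
Proof.
move=> hQ i y z0; have := elimn_orth (zero_row z) hQ y (ltn_ord i).
by rewrite zero_rowE z0 eqxx dot_delta.
Qed.

Lemma clear_fix Q z y : psd Q -> (forall i, z i 0 = 0 -> (Q *m y) i 0 = 0) ->
  clear z Q *m y = Q *m y.
Proof.
move=> hQ h; apply: elimn_fix => // i lt.
rewrite (_ : i = Ordinal lt) // zero_rowE; case: eqP => [/h <-|_].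
  by rewrite dot_delta.
by rewrite dot0l.
Qed.

Section Purify.
Variables (Q0 : 'M[F]_N) (z0 g : 'cV[F]_N).
Hypothesis hQ0 : psd Q0.

(** The invariant of the walk to a vertex. The image of [Q] lies in that of
    [Q0] and contains the directions of [Q0] that keep the zero entries of the
    current point [z]; the [it] rounds made so far have reached a vertex or
    removed as many entries from the support. *)
Record purified (Q : 'M[F]_N) (z : 'cV[F]_N) (it : nat) : Prop := Purified {
  pur_psd : psd Q;
  pur_range : forall y, exists y', Q *m y = Q0 *m y';
  pur_fix : forall y, (forall i, z i 0 = 0 -> (Q0 *m y) i 0 = 0) ->
    Q *m y = Q0 *m y;
  pur_ge0 : forall i, 0 <= z i 0;
  pur_supp : forall i, z0 i 0 = 0 -> z i 0 = 0;
  pur_move : exists y, z = z0 + Q0 *m y;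
  pur_cost : dot g z <= dot g z0;
  pur_progress : vertex Q0 z \/ (nnz z + it <= N)%N }.

Lemma purified0 : (forall i, 0 <= z0 i 0) -> purified Q0 z0 0.
Proof.
move=> h; split=> //; first by move=> y; exists y.
  by exists 0; rewrite mulmx0 addr0.
by right; rewrite addn0 -[X in (_ <= X)%N]card_ord; apply: max_card.
Qed.

Lemma purified_end Q z : purified Q z N -> vertex Q0 z.
Proof.
case=> _ _ _ _ _ _ _ [//|h] y hy; apply/colP => i; rewrite [RHS]mxE; apply: hy.
have /eqP : nnz z = 0%N by lia.
rewrite cards_eq0 => /eqP E; apply/eqP; apply: contraT => nz.
by have := in_set0 i; rewrite -E inE nz.
Qed.

(** One round: as [g] is positive on the support of [z], a nonzero direction
    along which the cost does not increase has a negative entry inside that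
    support, so moving along it until an entry vanishes shrinks the support. *)
Lemma purified_step Q z it (jj : 'I_N) (sg rho : F) :
  let Q1 := clear z Q in let v := sg *: col jj Q1 in
  purified Q z it ->
  (forall i, z0 i 0 != 0 -> 0 < g i 0) ->
  (Q1 jj jj = 0 -> forall j, Q1 j j = 0) ->
  sg = (if dot g (col jj Q1) <= 0 then 1 else -1) ->
  (forall i, - v i 0 / z i 0 <= rho) ->
  (rho = 0 \/ exists i, rho = - v i 0 / z i 0) -> 0 <= rho ->
  purified Q1 (z + rho^-1 *: v) it.+1.
Proof.
move=> Q1 v [hQ hr hf hz hs hm hc hp] g0 hjj sgE hrho rhoE rho0.
have hQ1 : psd Q1 by apply: psd_elimn.
have r1 y : exists y', Q1 *m y = Q0 *m y'.
  by have [y1 E] := elimn_range (zero_row z) hQ N y; rewrite [Q1 *m y]E.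
have Qf y : (forall i, z i 0 = 0 -> (Q0 *m y) i 0 = 0) -> Q1 *m y = Q0 *m y.
  by move=> h; rewrite -(hf y h); apply: clear_fix => // i zi; rewrite hf // h.
have cE : col jj Q1 = Q1 *m delta_mx jj 0 by rewrite colE.
have vz i : z i 0 = 0 -> v i 0 = 0.
  by move=> zi; rewrite mxE cE clear_zero ?mulr0.
have [Q1jj|Q1jj] := eqVneq (Q1 jj jj) 0.
  have Q10 u : Q1 *m u = 0.
    have Z j : Q1 *m (delta_mx j 0 : 'cV_N) = 0.
      apply: (psd_kernel hQ1); rewrite dot_delta -colE; first by rewrite mxE hjj.
    have -> : Q1 = 0 by apply/matrixP => i j; have /colP/(_ i) := Z j; rewrite -colE !mxE.
    by rewrite mul0mx.
  have v0 : v = 0 by rewrite /v cE Q10 scaler0.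
  rewrite v0 scaler0 addr0; split=> //.
  by left=> y hy; rewrite -Qf.
have vne : v != 0.
  apply: contraNneq Q1jj => /colP/(_ jj); rewrite !mxE sgE.
  by case: ifP => _; rewrite ?mul1r ?mulN1r => /eqP; rewrite ?oppr_eq0.
have gv : dot g v <= 0.
  by rewrite dotZr sgE; case: ifP => h; rewrite ?mul1r // mulN1r oppr_le0 ltW // ltNge h.
have [i0 vi0] : exists i, v i 0 < 0.
  apply/existsP; apply: contraT => /existsPn hv; case/eqP: vne.
  have hv' i : 0 <= v i 0 by rewrite leNgt hv.
  have gv0 i : 0 <= g i 0 * v i 0.
    have [/vz ->|zi] := eqVneq (z i 0) 0; first by rewrite mulr0.
    by rewrite mulr_ge0 // ltW // g0 //; apply: contraNneq zi => /hs ->.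
  apply/colP => i; rewrite [RHS]mxE.
  have /eqP : dot g v = 0 by apply/le_anti; rewrite gv sumr_ge0.
  rewrite psumr_eq0 // => /allP/(_ i); rewrite mem_index_enum => /(_ isT) /=.
  have [/vz ->//|zi] := eqVneq (z i 0) 0.
  rewrite mulf_eq0 => /orP[|/eqP //]; rewrite gt_eqF // g0 //.
  by apply: contraNneq zi => /hs ->.
have zi0 : 0 < z i0 0.
  by rewrite lt_def hz andbT; apply/eqP => /vz E; rewrite E ltxx in vi0.
have rho_gt0 : 0 < rho.
  by apply: lt_le_trans (hrho i0); rewrite divr_gt0 // oppr_gt0.
split=> //.
- move=> y hy; apply: Qf => i zi; apply: hy; rewrite mxE [X in _ + X]mxE.
  by rewrite zi vz // mulr0 addr0.
- move=> i; rewrite mxE [X in _ + X]mxE.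
  have [zi|zi] := eqVneq (z i 0) 0; first by rewrite zi vz // mulr0 addr0.
  have zp : 0 < z i 0 by rewrite lt_def zi hz.
  have := hrho i; rewrite ler_pdivrMr // => h.
  have -> : z i 0 + rho^-1 * v i 0 = (z i 0 * rho + v i 0) / rho.
    by field; rewrite gt_eqF.
  by rewrite divr_ge0 // -[v i 0]opprK subr_ge0 mulrC.
- by move=> i /hs zi; rewrite mxE [X in _ + X]mxE zi vz // mulr0 addr0.
- have [y ->] := hm; have [y' E] := r1 (delta_mx jj 0).
  exists (y + (rho^-1 * sg) *: y').
  by rewrite mulmxDr -scalemxAr -E -cE addrA scalerA.
- rewrite dotDr dotZr; apply: le_trans hc; rewrite gerDl.
  by rewrite mulr_ge0_le0 // invr_ge0.
- right; case: hp => [hv|hn].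
    case/eqP: Q1jj; have [y' E] := r1 (delta_mx jj 0).
    have Z : Q0 *m y' = 0.
      by apply: hv => i zi; rewrite -E clear_zero.
    have /colP/(_ jj) : col jj Q1 = 0 by rewrite cE E.
    by rewrite !mxE.
  have [i rE] : exists i, rho = - v i 0 / z i 0.
    by case: rhoE => // E; rewrite E ltxx in rho_gt0.
  have zi : z i 0 != 0.
    by apply: contraTneq rho_gt0 => zi; rewrite rE zi invr0 mulr0 ltxx.
  have vi : v i 0 != 0.
    by apply: contraTneq rho_gt0 => vi; rewrite rE vi oppr0 mul0r ltxx.
  suff : (nnz (z + rho^-1 *: v) < nnz z)%N by lia.
  apply: proper_card; apply/properP; split.
    apply/subsetP => j; rewrite !inE; apply: contraNneq => zj.
    by rewrite mxE [X in _ + X]mxE zj vz // mulr0 addr0.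
  exists i; rewrite inE // negbK mxE [X in _ + X]mxE rE.
  by apply/eqP; field; rewrite ?oppr_eq0 zi vi.
Qed.

End Purify.
End Elimination.

(** * Newton steps along the central path *)

Section Newton.
Variables (F : realFieldType) (N m : nat) (a : nat -> 'cV[F]_N).
Variable S : {set 'I_N}.
Implicit Types (u v x s y t : 'cV[F]_N).

(** Differences of feasible points supported on [S]. *)
Definition direction v : Prop :=
  (forall r, (r < m)%N -> dot (a r) v = 0) /\ (forall i, i \notin S -> v i 0 = 0).

Definition interior x s : Prop := forall i,
  if i \in S then 0 < x i 0 /\ 0 < s i 0 else x i 0 = 0 /\ s i 0 = 0.

Definition quot x s : 'cV[F]_N := \col_i (x i 0 / s i 0).

(** Multiplied by the weights [s / x], this is the projection onto the
    directions that is orthogonal for these weights. *)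
Definition proj x s : 'M[F]_N := elimn a m (diag (quot x s)).

(** With [W] the diagonal of [s / x] and [P] the projection, this is [W - W P
    W]. Its image consists of the vectors on [S] orthogonal to all directions,
    the moves of the slack. *)
Definition dual_proj x s : 'M[F]_N := \matrix_(i, j)
  (s i 0 / x i 0 *+ (i == j) - s i 0 / x i 0 * proj x s i j * (s j 0 / x j 0)).

Definition hprod x y : 'cV[F]_N := \col_i (x i 0 * y i 0).

Lemma dual_proj_mul x s y i : (dual_proj x s *m y) i 0 =
  s i 0 / x i 0 * (y i 0 - (proj x s *m hprod (quot s x) y) i 0).
Proof.
have E : s i 0 / x i 0 * y i 0 = \sum_j (s i 0 / x i 0 *+ (i == j)) * y j 0.
  rewrite (bigD1 i) //= eqxx mulr1n big1 ?addr0 // => j /negbTE nj.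
  by rewrite eq_sym nj mulr0n mul0r.
rewrite mulrBr E mxE [(proj x s *m _) i 0]mxE mulr_sumr -sumrB.
by apply: eq_bigr => j _; rewrite !mxE /=; ring.
Qed.

Section Interior.
Variables (x s : 'cV[F]_N).
Hypothesis hxs : interior x s.

Lemma int_in i : i \in S -> 0 < x i 0 /\ 0 < s i 0.
Proof. by have := hxs i; case: ifP. Qed.

Lemma int_notin i : i \notin S -> x i 0 = 0 /\ s i 0 = 0.
Proof. by have := hxs i; case: ifP. Qed.

Lemma int_ge0 i : 0 <= x i 0 /\ 0 <= s i 0.
Proof. by have := hxs i; case: ifP => _ [h1 h2]; [rewrite !ltW|rewrite h1 h2]. Qed.

Lemma int_supp i : (x i 0 == 0) = (i \notin S) /\ (s i 0 == 0) = (i \notin S).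
Proof.
by have := hxs i; case: ifP => _ /= [h1 h2]; [rewrite !gt_eqF|rewrite h1 h2 !eqxx].
Qed.

Lemma psd_weight : psd (diag (quot x s)).
Proof.
by apply: psd_diag => i; rewrite mxE divr_ge0 //; case: (int_ge0 i).
Qed.

Lemma psd_proj : psd (proj x s).
Proof. exact: psd_elimn psd_weight _. Qed.

Lemma proj_direction y : direction (proj x s *m y).
Proof.
split=> [r lt|i iS]; first exact: elimn_orth psd_weight _ _ _ _.
rewrite -dot_delta; apply: elimn_keep psd_weight _ _ _ _ => u.
by rewrite dot_delta diag_mul mxE (int_notin iS).1 !mul0r.
Qed.

Lemma weight_quot v : (forall i, i \notin S -> v i 0 = 0) ->
  diag (quot x s) *m hprod (quot s x) v = v.
Proof.
move=> h; apply/colP => i; rewrite diag_mul !mxE.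
case: (boolP (i \in S)) => [/int_in[x0 s0]|/h ->]; last by rewrite !mulr0.
by field; rewrite !gt_eqF.
Qed.

Lemma proj_fix v : direction v -> proj x s *m hprod (quot s x) v = v.
Proof.
move=> [h1 h2]; rewrite -[RHS](weight_quot h2); apply: elimn_fix psd_weight _ _ _.
by move=> r lt; rewrite weight_quot // h1.
Qed.

Lemma dot_hprod u v w : dot u (hprod w v) = dot (hprod w u) v.
Proof. by apply: eq_bigr => i _; rewrite !mxE; ring. Qed.

Lemma dual_proj_dir v y : direction v -> dot v (dual_proj x s *m y) = 0.
Proof.
move=> hv.
have -> : dual_proj x s *m y = hprod (quot s x)
    (y - proj x s *m hprod (quot s x) y).
  by apply/colP => i; rewrite dual_proj_mul !mxE.
rewrite dot_hprod dotBr dot_sym; last by case: psd_proj.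
by rewrite proj_fix // -dot_hprod dotC subrr.
Qed.

Lemma dual_proj_notin y i : i \notin S -> (dual_proj x s *m y) i 0 = 0.
Proof. by move=> /int_notin[_ h]; rewrite dual_proj_mul h !mul0r. Qed.

Lemma dual_proj_fix t : (forall v, direction v -> dot v t = 0) ->
  (forall i, i \notin S -> t i 0 = 0) ->
  dual_proj x s *m hprod (quot x s) t = t.
Proof.
move=> h1 h2.
have E : hprod (quot s x) (hprod (quot x s) t) = t.
  apply/colP => i; rewrite !mxE.
  case: (boolP (i \in S)) => [/int_in[x0 s0]|/h2 ->]; last by rewrite !mulr0.
  by field; rewrite !gt_eqF.
have Z : proj x s *m t = 0.
  apply/colP => i; rewrite [RHS]mxE -dot_delta dot_sym; last by case: psd_proj.
  by rewrite dotC h1 //; apply: proj_direction.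
apply/colP => i; rewrite dual_proj_mul E Z [X in _ - X]mxE subr0.
by rewrite -[in RHS]E !mxE.
Qed.

(** As the matrix fixes its image, up to weights, the form is a weighted sum of
    squares of the image. *)
Lemma psd_dual_proj : psd (dual_proj x s).
Proof.
split.
  apply/matrixP => i j; rewrite !mxE.
  have := psd_proj.1 => /matrixP/(_ i j); rewrite mxE => ->.
  by rewrite eq_sym; case: eqP => [->|_]; rewrite ?mulr1n ?mulr0n; ring.
move=> u; set p := dual_proj x s *m u.
have E : dual_proj x s *m hprod (quot x s) p = p.
  apply: dual_proj_fix => [v hv|i hi]; first exact: dual_proj_dir.
  exact: dual_proj_notin.
have hs : (dual_proj x s)^T = dual_proj x s.
  apply/matrixP => i j; rewrite !mxE.
  have := psd_proj.1 => /matrixP/(_ i j); rewrite mxE => ->.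
  by rewrite eq_sym; case: eqP => [->|_]; rewrite ?mulr1n ?mulr0n; ring.
have -> : dot u p = dot p (hprod (quot x s) p).
  by rewrite -[in LHS]E (dot_sym u) // dotC.
apply: sumr_ge0 => i _; rewrite [hprod _ _ _ _]mxE.
rewrite mulrCA mulr_ge0 -?expr2 ?sqr_ge0 // mxE divr_ge0 //; by case: (int_ge0 i).
Qed.

End Interior.

(** Zero exactly on the central path, where all products [x i * s i] are [mu]. *)
Definition off_center x s mu : F := \sum_(i in S) (x i 0 * s i 0 - mu) ^+ 2.

Lemma near_center x s mu i : 16 * off_center x s mu <= mu ^+ 2 -> i \in S ->
  16 * (x i 0 * s i 0 - mu) ^+ 2 <= mu ^+ 2.
Proof.
move=> hc iS; apply: le_trans hc; rewrite ler_wpM2l // /off_center (bigD1 i) //= lerDl.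
by apply: sumr_ge0 => j _; apply: sqr_ge0.
Qed.

Lemma sum_sqr_le (I : finType) (P : pred I) (f : I -> F) :
  \sum_(i | P i) f i ^+ 2 <= (\sum_(i | P i) `|f i|) ^+ 2.
Proof.
rewrite expr2 mulr_suml; apply: ler_sum => i Pi.
rewrite -[f i ^+ 2]ger0_norm ?sqr_ge0 // normrX expr2 ler_wpM2l // (bigD1 i) //= lerDl.
by apply: sumr_ge0.
Qed.

Definition newton_rhs x s mu : 'cV[F]_N := \col_i ((mu - x i 0 * s i 0) / x i 0).

Lemma newton_dsE x s mu (y : 'cV[F]_N) i :
  (newton_rhs x s mu - hprod (quot s x) y) i 0 =
  (mu - x i 0 * s i 0) / x i 0 - s i 0 / x i 0 * y i 0.
Proof. by rewrite !mxE. Qed.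

(** A full Newton step towards a nearby target. The error after the step is
    the vector of the products [dx i * ds i]; since [dx] and [ds] are orthogonal,
    the sum of their moduli is at most half the weighted norm of the residual,
    which is quadratically small. *)
Lemma newton_step x s mu mu' :
  let dx := proj x s *m newton_rhs x s mu' in
  let ds := newton_rhs x s mu' - hprod (quot s x) dx in
  interior x s -> 0 < mu -> `|mu' - mu| * (8 * N)%:R <= mu -> (0 < N)%N ->
  16 * off_center x s mu <= mu ^+ 2 ->
  [/\ direction dx, forall v, direction v -> dot v ds = 0,
      interior (x + dx) (s + ds) &
      64 * off_center (x + dx) (s + ds) mu' <= mu' ^+ 2].
Proof.
move=> dx ds hxs mu0 hmu' N0 hc.
have dirx : direction dx by apply: proj_direction.
have dsE i : ds i 0 = (mu' - x i 0 * s i 0) / x i 0 - s i 0 / x i 0 * dx i 0.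
  exact: newton_dsE.
have dird v : direction v -> dot v ds = 0.
  move=> hv; rewrite dotBr dot_hprod (dot_sym (hprod _ _)); last by case: (psd_proj hxs).
  by rewrite proj_fix // dotC subrr.
pose e := `|mu' - mu|; have e0 : 0 <= e by apply: normr_ge0.
have NR : 1 <= N%:R :> F by rewrite ler1n.
have hN : e * (8 * N%:R) <= mu by move: hmu'; rewrite natrM.
have e8 : 8 * e <= mu by nra.
have eN : e ^+ 2 * N%:R * 64 <= mu ^+ 2 by rewrite !expr2; nra.
have mu8 : 7 * mu <= 8 * mu'.
  have : - e <= mu' - mu by rewrite lerNl /e -normrN ler_norm.
  lra.
have close i : i \in S -> 3 * mu <= 4 * (x i 0 * s i 0).
  by move=> /(near_center hc); rewrite !expr2 => h; have := ltW mu0; nra.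
pose r i := mu' - x i 0 * s i 0.
(* [r i] is [(mu' - mu) - (x s - mu)]: twice the squares of both parts. *)
have sumr : \sum_(i in S) r i ^+ 2 <= 5 / 32 * mu ^+ 2.
  apply: (@le_trans _ _ (\sum_(i in S) (2 * (x i 0 * s i 0 - mu) ^+ 2 + 2 * e ^+ 2))).
    apply: ler_sum => i _; have -> : e ^+ 2 = (mu' - mu) ^+ 2.
      by rewrite -normrX ger0_norm ?sqr_ge0.
    rewrite /r !expr2; set y := _ * s i 0.
    have := sqr_ge0 (y - mu + (mu' - mu)); rewrite expr2; nra.
  rewrite big_split /= -mulr_sumr -/(off_center x s mu) sumr_const.
  have : #|S|%:R <= N%:R :> F by rewrite ler_nat -[X in (_ <= X)%N]card_ord max_card.
  rewrite -[X in _ -> _ + X <= _]mulr_natr => cS.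
  have := ler_wpM2l (_ : 0 <= 2 * e ^+ 2) cS => /(_ _) h.
  have {}h := h (mulr_ge0 (ler0n _ 2) (sqr_ge0 e)); lra.
have eqn i : i \in S -> s i 0 * dx i 0 + x i 0 * ds i 0 = r i.
  move=> /(int_in hxs)[x0 s0].
  by rewrite dsE /r; field; rewrite gt_eqF.
have off i : i \notin S -> dx i 0 = 0 /\ ds i 0 = 0.
  move=> iS; rewrite dirx.2 //; split=> //.
  by rewrite dsE dirx.2 // (int_notin hxs iS).1 invr0 !mulr0 subr0.
have prod0 : \sum_(i in S) dx i 0 * ds i 0 = 0.
  rewrite -[RHS](dird dx dirx) /dot [RHS](bigID (fun i => i \in S)) /=.
  by rewrite [X in _ + X]big1 ?addr0 // => i /off[-> _]; rewrite mul0r.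
pose T := \sum_(i in S) `|dx i 0 * ds i 0|.
(* The sum of the [dx * ds] is 0, so it may be subtracted twice to complete the
   squares [((s dx) ^ 2 + (x ds) ^ 2) / (x s)], which dominate [2 * |dx * ds|]. *)
have hT : T <= 5 / 48 * mu.
  have E : 2 * T <= \sum_(i in S) (r i ^+ 2 / (x i 0 * s i 0) - 2 * (dx i 0 * ds i 0)).
    rewrite /T mulr_sumr; apply: ler_sum => i iS; rewrite -(eqn i iS).
    have [x0 s0] := int_in hxs iS.
    set p := dx i 0; set q := ds i 0.
    have -> : (s i 0 * p + x i 0 * q) ^+ 2 / (x i 0 * s i 0) - 2 * (p * q)
      = ((s i 0 * p) ^+ 2 + (x i 0 * q) ^+ 2) / (x i 0 * s i 0).
      by field; rewrite !gt_eqF.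
    rewrite ler_pdivlMr ?mulr_gt0 //.
    have -> : 2 * `|p * q| * (x i 0 * s i 0) = 2 * `|(s i 0 * p) * (x i 0 * q)|.
      rewrite !normrM (gtr0_norm x0) (gtr0_norm s0); ring.
    set A := s i 0 * p; set B := x i 0 * q.
    have := sqr_ge0 (A - B); have := sqr_ge0 (A + B); rewrite !expr2.
    by case: (lerP 0 (A * B)) => h; rewrite ?(ger0_norm h) ?(ltr0_norm h); lra.
  have : 2 * T <= 4 / (3 * mu) * \sum_(i in S) r i ^+ 2.
    apply: le_trans E _; rewrite sumrB -mulr_sumr prod0 mulr0 subr0 mulr_sumr.
    apply: ler_sum => i iS; have [x0 s0] := int_in hxs iS.
    rewrite mulrC ler_wpM2r ?sqr_ge0 // -[4 / _]invf_div lef_pV2 ?posrE ?mulr_gt0 //.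
      by have := close i iS; lra.
    by rewrite ?invr_gt0 //; lra.
  have c0 : 0 <= 4 / (3 * mu) by rewrite divr_ge0 // mulr_ge0 // ltW.
  have := ler_wpM2l c0 sumr => h1 h2; rewrite -subr_ge0.
  have -> : 5 / 48 * mu - T = (4 / (3 * mu) * (5 / 32 * mu ^+ 2) - 2 * T) / 2.
    by field; rewrite gt_eqF.
  by rewrite divr_ge0 // subr_ge0; apply: le_trans h2 h1.
have T0 : 0 <= T by apply: sumr_ge0 => i _; apply: normr_ge0.
have err i : i \in S -> (x i 0 + dx i 0) * (s i 0 + ds i 0) = mu' + dx i 0 * ds i 0.
  by move=> iS; have := eqn i iS; rewrite /r; lra.
split=> // [i|].
  have := hxs i; rewrite [(x + dx) i 0]mxE [(s + ds) i 0]mxE; case: ifP => [iS [x0 s0]|/negbT iS [-> ->]]; last first.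
    by have [-> ->] := off i iS; rewrite !addr0.
  have dT : `|dx i 0 * ds i 0| <= T.
    by rewrite /T (bigD1 i) //= lerDl; apply: sumr_ge0.
  have P : 0 < (x i 0 + dx i 0) * (s i 0 + ds i 0).
    rewrite err //; have : - T <= dx i 0 * ds i 0.
      by rewrite lerNl; apply: le_trans dT; rewrite -normrN ler_norm.
    lra.
  have P2 : 0 < s i 0 * (x i 0 + dx i 0) + x i 0 * (s i 0 + ds i 0).
    have := eqn i iS; have := mulr_gt0 x0 s0; rewrite /r; lra.
  move: P P2; set A := x i 0 + _; set B := s i 0 + _ => P P2.
  case: (ltrP 0 A) => hA; first by rewrite -(pmulr_rgt0 _ hA).
  have B0 : B <= 0 by rewrite leNgt; apply/negP => h; nra.
  nra.
apply: (@le_trans _ _ (64 * T ^+ 2)).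
  rewrite ler_wpM2l // /T; apply: le_trans (sum_sqr_le _ _).
  rewrite /off_center le_eqVlt; apply/orP; left; apply/eqP.
  apply: eq_bigr => i iS; congr (_ ^+ 2).
  by rewrite [(x + dx) i 0]mxE [(s + ds) i 0]mxE err //; ring.
have : T ^+ 2 <= (5 / 48 * mu) ^+ 2 by rewrite lerXn2r ?nnegrE //; lra.
have : (7 / 8 * mu) ^+ 2 <= mu' ^+ 2 by rewrite lerXn2r ?nnegrE //; lra.
have := sqr_ge0 mu; rewrite !expr2; lra.
Qed.

Lemma dot_center x s mu : interior x s -> 0 < mu ->
  16 * off_center x s mu <= mu ^+ 2 -> dot x s <= (2 * N)%:R * mu.
Proof.
move=> hxs mu0 hc; rewrite /dot.
apply: (@le_trans _ _ (\sum_(i < N) 2 * mu)).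
  apply: ler_sum => i _; case: (boolP (i \in S)) => [iS|/(int_notin hxs)[-> _]].
    by have := near_center hc iS; rewrite !expr2; nra.
  by rewrite mul0r; lra.
by rewrite sumr_const card_ord -mulr_natl natrM; lra.
Qed.

End Newton.

Lemma bernoulli (F : realFieldType) (e : F) n : 0 <= e -> 1 + e *+ n <= (1 + e) ^+ n.
Proof.
move=> e0; elim: n => [|n IH]; first by rewrite mulr0n addr0 expr0.
rewrite exprS mulrS; have : 0 <= e *+ n by rewrite mulrn_wge0.
nra.
Qed.

(** * Denominators of vertices *)

Definition small_int (q : rat) : Prop := q \is a Num.int /\ `|q| <= 1.

(** The Leibniz formula has [p`!] terms, all of modulus at most 1. *)
Lemma det_small p (U : 'M[rat]_p) : (forall i j, small_int (U i j)) ->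
  \det U \is a Num.int /\ `|\det U| <= p`!%:R.
Proof.
move=> h; split.
  apply: rpred_sum => s _; apply: rpredM; first by rewrite rpredX // rpredN rpred1.
  by apply: rpred_prod => i _; case: (h i (s i)).
apply: le_trans (ler_norm_sum _ _ _) _.
rewrite -card_Sn -sum1_card natr_sum; apply: ler_sum => s _.
rewrite normrM normrX normrN1 expr1n mul1r normr_prod; apply: prodr_ile1 => i _.
by rewrite normr_ge0; case: (h i (s i)).
Qed.

Lemma int_norm_ge1 (q : rat) : q \is a Num.int -> q != 0 -> 1 <= `|q|.
Proof.
by move=> /intrP[k ->]; rewrite intr_eq0 -intr_norm -[1]/(1%:~R) ler_int; lia.
Qed.

(** An injective system contains an invertible square one, whose determinant
    clears the denominators of the solution. *)
Lemma cramer_int p q (M : 'M[rat]_(p, q)) (z : 'cV[rat]_q) (E : rat) :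
  (forall i j, small_int (M i j)) ->
  (forall y : 'cV_q, M *m y = 0 -> y = 0) ->
  (forall i, E * (M *m z) i 0 \is a Num.int) ->
  exists D : nat, [/\ (0 < D <= q`!)%N & forall j, D%:R * E * z j 0 \is a Num.int].
Proof.
move=> hM hk hz.
have rkM : row_full M.
  rewrite /row_full -mxrank_tr -[_ == _]/(row_free M^T) -kermx_eq0.
  apply/eqP/row_matrixP => i; rewrite row0.
  have : (row i (kermx M^T) <= kermx M^T)%MS by apply: row_sub.
  move/sub_kermxP => h; apply: trmx_inj; rewrite trmx0; apply: hk.
  by apply: trmx_inj; rewrite trmx_mul trmxK h trmx0.
pose f := fullrankfun rkM; pose U := rowsub f M.
have uU : U \in unitmx by apply: fullrowsub_unit.
have hU i j : small_int (U i j) by rewrite mxE.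
have [dI dB] := det_small hU.
have d0 : \det U != 0 by move: uU; rewrite unitmxE unitfE.
have /intrP[k Ek] := dI.
have E1 : `|k|%N%:R = `|\det U| by rewrite Ek -intr_norm -pmulrn natr_absz.
exists `|k|%N; split.
  apply/andP; split; last by rewrite -(ler_nat rat) E1.
  by rewrite -(ltr_nat rat) E1 normr_gt0.
have hz' i : E * (U *m z) i 0 \is a Num.int by rewrite mul_rowsub_mx mxE.
have hdet j : \det U * E * z j 0 \is a Num.int.
  have -> : \det U * E * z j 0 = E * ((\adj U) *m (U *m z)) j 0.
    by rewrite mulmxA mul_adj_mx mul_scalar_mx mxE; ring.
  rewrite mxE mulr_sumr; apply: rpred_sum => i _; rewrite mulrCA rpredM //.
  rewrite mxE /cofactor rpredM ?rpredX ?rpredN ?rpred1 //.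
  have [] // := @det_small _ (row' i (col' j U)).
  by move=> i' j'; rewrite !mxE.
move=> j; rewrite E1; case: (lerP 0 (\det U)) => h; rewrite ?(ger0_norm h) ?(ltr0_norm h) //.
by rewrite !mulNr rpredN hdet.
Qed.

Section Vertices.
Variables (N m : nat) (a : nat -> 'cV[rat]_N) (S : {set 'I_N}).
Hypothesis a_small : forall r i, (r < m)%N -> small_int (a r i 0).
Implicit Types (x s t c v : 'cV[rat]_N).

Lemma small_int0 : small_int 0.
Proof. by split; rewrite ?normr0 // rpred0. Qed.

Lemma small_int1 : small_int 1.
Proof. by split; rewrite ?normr1 // rpred1. Qed.

(** A vertex solves the linear constraints together with the equations that set
    its zero entries to zero, and this system is injective. *)
Lemma primal_vertex_int x (E : rat) :
  (forall v, (forall r, (r < m)%N -> dot (a r) v = 0) ->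
     (forall i, x i 0 = 0 -> v i 0 = 0) -> v = 0) ->
  (forall r, (r < m)%N -> E * dot (a r) x \is a Num.int) ->
  exists D : nat, (0 < D <= N`!)%N /\ forall j, D%:R * E * x j 0 \is a Num.int.
Proof.
move=> hv hE.
pose A : 'M[rat]_(m, N) := \matrix_(r, i) a r i 0.
pose Z : 'M[rat]_N := diag (\col_i (x i 0 == 0)%:R).
have AE v r : (A *m v) r 0 = dot (a r) v.
  by rewrite mxE; apply: eq_bigr => i _; rewrite mxE.
have [||i|D [D0 hD]] := @cramer_int _ _ (col_mx A Z) x E; last by exists D.
- move=> i j; rewrite mxE; case: split => k; rewrite mxE; first exact: a_small.
  by rewrite mxE; case: eqP => _; case: eqP => _ /=; rewrite ?mulr0n ?mulr1n;
    first [exact: small_int0|exact: small_int1].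
- move=> y; rewrite mul_col_mx -[0 in X in X -> _]col_mx0 => /eq_col_mx[h1 h2].
  apply: hv => [r lt|i xi].
    by have /colP/(_ (Ordinal lt)) := h1; rewrite AE mxE.
  by have /colP/(_ i) := h2; rewrite diag_mul mxE xi eqxx mul1r mxE.
- rewrite mul_col_mx mxE; case: split => k; first by rewrite AE hE.
  rewrite diag_mul mxE; case: eqP => [->|_]; by rewrite ?mulr0 ?mul0r ?mulr0 rpred0.
Qed.

Let AS : 'M[rat]_(m, N) := \matrix_(r, i) (a r i 0 *+ (i \in S)).

Lemma AS_mul v (r : 'I_m) : (forall i, i \notin S -> v i 0 = 0) ->
  (AS *m v) r 0 = dot (a r) v.
Proof.
move=> h; rewrite mxE; apply: eq_bigr => i _; rewrite mxE.
by case: (boolP (i \in S)) => [|/h ->]; rewrite ?mulr1n ?mulr0.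
Qed.

(** The double orthogonal complement within the coordinates of [S]. *)
Lemma orth_rowspace t : (forall v, direction m a S v -> dot v t = 0) ->
  (forall i, i \notin S -> t i 0 = 0) -> (t^T <= AS)%MS.
Proof.
move=> h1 h2; rewrite submxE; apply/eqP/matrixP => i j.
rewrite ord1 [RHS]mxE; pose v : 'cV[rat]_N := \col_k (cokermx AS k j *+ (k \in S)).
have -> : (t^T *m cokermx AS) 0 j = dot v t.
  rewrite mxE; apply: eq_bigr => k _; rewrite !mxE.
  by case: (boolP (k \in S)) => [_|/h2 ->]; rewrite ?mulr1n ?mul0r ?mulr0 // mulrC.
apply: h1; split; last by move=> k /negbTE kS; rewrite mxE kS.
move=> r lt; have := mulmx_coker AS => /matrixP/(_ (Ordinal lt) j); rewrite !mxE => E.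
rewrite -[RHS]E; apply: eq_bigr => k _; rewrite !mxE.
by case: (k \in S); rewrite ?mulr0n ?mulr1n ?mulr0 ?mul0r.
Qed.

(** The slack is [c + y B] for a basis [B] of the row space, and at a vertex
    its zero entries determine [y]. *)
Lemma dual_vertex_int s c (E : rat) :
  (forall v, direction m a S v -> dot v (s - c) = 0) ->
  (forall i, i \notin S -> s i 0 = 0 /\ c i 0 = 0) ->
  (forall t, (forall v, direction m a S v -> dot v t = 0) ->
     (forall i, i \notin S -> t i 0 = 0) ->
     (forall i, s i 0 = 0 -> t i 0 = 0) -> t = 0) ->
  (forall i, E * c i 0 \is a Num.int) ->
  exists D : nat, (0 < D <= N`!)%N /\ forall j, D%:R * E * s j 0 \is a Num.int.
Proof.
move=> h1 h2 hv hE.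
pose B := rowsub (maxrankfun AS) AS.
have hB r i : small_int (B r i).
  rewrite !mxE; case: (i \in S); rewrite ?mulr1n ?mulr0n; last exact: small_int0.
  exact: a_small.
have h2' i : i \notin S -> (s - c) i 0 = 0.
  by move=> /h2[hs hc]; rewrite !mxE hs hc subr0.
have : ((s - c)^T <= B)%MS by rewrite eq_maxrowsub; apply: orth_rowspace.
move=> /submxP[y Ey].
have yE i : s i 0 - c i 0 = (y *m B) 0 i by rewrite -Ey !mxE.
pose M : 'M[rat]_(N, \rank AS) := \matrix_(i, r) (B r i *+ (s i 0 == 0)).
have ME (z : 'rV_(\rank AS)) i : (M *m z^T) i 0 = (z *m B) 0 i *+ (s i 0 == 0).
  rewrite !mxE -sumrMnl; apply: eq_bigr => r _; rewrite [M i r]mxE [z^T _ _]mxE.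
  by rewrite mulrnAl mulrC.
have [||i|D [D0 hD]] := @cramer_int _ _ M y^T E.
- move=> i r; rewrite [M i r]mxE; case: eqP => _; rewrite ?mulr1n ?mulr0n.
    exact: hB.
  exact: small_int0.
- move=> z Mz; have tE : (z^T *m B)^T = 0.
    apply: hv => [v hvd|i iS|i si].
    + rewrite dotC dotE trmxK -mulmxA.
      suff -> : B *m v = 0 by rewrite mulmx0 mxE.
      by apply/colP => r; rewrite mul_rowsub_mx mxE AS_mul ?hvd.1 ?mxE //; apply: hvd.2.
    + rewrite !mxE big1 // => r _; rewrite !mxE (negbTE iS) mulr0n mulr0 //.
    + by rewrite mxE; have := ME z^T i; rewrite trmxK Mz si eqxx mulr1n mxE => <-.
  apply: trmx_inj; rewrite trmx0.
  have := maxrowsub_free AS; rewrite -kermx_eq0 => /eqP ker0.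
  have : (z^T <= kermx B)%MS by apply/sub_kermxP; apply: trmx_inj; rewrite tE trmx0.
  by rewrite /B ker0 submx0 => /eqP.
- rewrite ME -yE; case: eqP => [->|_]; last by rewrite mulr0n mulr0 rpred0.
  by rewrite mulr1n sub0r mulrN rpredN.
exists D; split.
  case/andP: D0 => -> /= /leq_trans; apply; apply: leq_fact.
  exact: rank_leq_col.
move=> j; have -> : s j 0 = c j 0 + (y *m B) 0 j by rewrite -yE; ring.
rewrite mulrDr rpredD //; first by rewrite -mulrA rpredM // rpred_nat.
rewrite mxE mulr_sumr; apply: rpred_sum => r _; rewrite mulrA rpredM //.
  by have := hD r; rewrite mxE.
by case: (hB r j).
Qed.

End Vertices.

(** A non-negative number smaller than the inverse of its denominator is zero. *)
Lemma int_dot_eq0 N (x s : 'cV[rat]_N) (D1 D2 K : nat) (E1 E2 : nat) :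
  (forall i, D1%:R * E1%:R * x i 0 \is a Num.int) ->
  (forall i, D2%:R * E2%:R * s i 0 \is a Num.int) ->
  (0 < D1 <= K)%N -> (0 < D2 <= K)%N -> (0 < E1)%N -> (0 < E2)%N ->
  0 <= dot x s -> dot x s * (K * K * (E1 * E2))%:R < 1 -> dot x s = 0.
Proof.
move=> h1 h2 /andP[d1 k1] /andP[d2 k2] e1 e2 g0 hlt.
apply/eqP; apply: contraTT hlt => ne; rewrite -leNgt.
pose q := (D1 * D2 * (E1 * E2))%:R * dot x s.
have qI : q \is a Num.int.
  rewrite /q /dot mulr_sumr; apply: rpred_sum => i _.
  have -> : (D1 * D2 * (E1 * E2))%:R * (x i 0 * s i 0)
    = (D1%:R * E1%:R * x i 0) * (D2%:R * E2%:R * s i 0) by rewrite !natrM; ring.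
  exact: rpredM.
have q0 : 0 <= q by rewrite mulr_ge0.
have qn : q != 0 by rewrite mulf_neq0 // pnatr_eq0; lia.
apply: le_trans (int_norm_ge1 qI qn) _; rewrite ger0_norm // /q mulrC.
by rewrite ler_wpM2l // ler_nat leq_mul // leq_mul.
Qed.

(** * The flow formulation *)

Section Cells.
Variables (n K : nat).

(** The unknown of index [cell t a b b'] is the mass of the multi-indices that
    start at [a] and pass from [b] at time [t] to [b'] at time [t + 1]; at the
    time [K] they are back at [a]. Indices are written in base [n], so that a
    division by [n] forgets [b'] and leaves the node the mass comes from. *)
Definition cell (t a b b' : nat) : nat := (((t * n + a) * n + b) * n + b')%N.
Definition ncell : nat := (K * n * n * n)%N.
(** There is one equation for each node [b] at time [t] in the copy [a],
    followed by one for each marginal. *)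
Definition row_node (t a b : nat) : nat := ((t * n + a) * n + b)%N.
Definition row_marg (t b : nat) : nat := (K.+1 * n * n + (t * n + b))%N.
Definition nrow : nat := (K.+1 * n * n + K * n)%N.

Definition cell_src (i : nat) : nat := (i %/ n)%N.
(** Adding [n] to [t * n + a] increases the time by 1. *)
Definition cell_tgt (i : nat) : nat := ((i %/ n %/ n + n) * n + i %% n)%N.
Definition cell_marg (i : nat) : nat :=
  (K.+1 * n * n + ((i %/ n %/ n %/ n) * n + (i %/ n) %% n))%N.

Lemma cell_divmod t a b b' : (a < n)%N -> (b < n)%N -> (b' < n)%N ->
  [/\ (cell t a b b' %/ n)%N = row_node t a b, (cell t a b b' %% n)%N = b',
      (cell t a b b' %/ n %/ n)%N = (t * n + a)%N,
      ((cell t a b b' %/ n) %% n)%N = b &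
      (cell t a b b' %/ n %/ n %/ n)%N = t /\
      ((cell t a b b' %/ n %/ n) %% n)%N = a].
Proof.
move=> ha hb hb'; have n0 : (0 < n)%N by case: n ha.
have E1 : (cell t a b b' %/ n)%N = row_node t a b.
  by rewrite /cell divnMDl // divn_small // addn0.
have E2 : (row_node t a b %/ n)%N = (t * n + a)%N.
  by rewrite /row_node divnMDl // divn_small // addn0.
rewrite E1 E2; split=> //.
- by rewrite /cell modnMDl modn_small.
- by rewrite /row_node modnMDl modn_small.
- by rewrite divnMDl // divn_small // addn0 modnMDl modn_small.
Qed.

Lemma cell_tgtE t a b b' : (a < n)%N -> (b < n)%N -> (b' < n)%N ->
  cell_tgt (cell t a b b') = row_node t.+1 a b'.
Proof.
move=> ha hb hb'; have [_ E2 E3 _ _] := cell_divmod t ha hb hb'.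
rewrite /cell_tgt E2 E3 /row_node mulSn; lia.
Qed.

Lemma cell_srcE t a b b' : (a < n)%N -> (b < n)%N -> (b' < n)%N ->
  cell_src (cell t a b b') = row_node t a b.
Proof. by move=> ha hb hb'; case: (cell_divmod t ha hb hb'). Qed.

Lemma cell_margE t a b b' : (a < n)%N -> (b < n)%N -> (b' < n)%N ->
  cell_marg (cell t a b b') = row_marg t b.
Proof.
by move=> ha hb hb'; have [_ _ _ E [E' _]] := cell_divmod t ha hb hb'; rewrite /cell_marg E E'.
Qed.

Lemma pos_lt p q i j : (i < p)%N -> (j < q)%N -> (i * q + j < p * q)%N.
Proof.
move=> hi hj; apply: (@leq_trans (i.+1 * q)); first by rewrite mulSn addnC ltn_add2r.
by rewrite leq_mul2r hi orbT.
Qed.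

Lemma cell_lt t a b b' : (t < K)%N -> (a < n)%N -> (b < n)%N -> (b' < n)%N ->
  (cell t a b b' < ncell)%N.
Proof. by move=> *; rewrite /cell /ncell !pos_lt. Qed.

Lemma row_node_inj t a b t' a' b' : (a < n)%N -> (b < n)%N -> (a' < n)%N -> (b' < n)%N ->
  (row_node t a b == row_node t' a' b') = [&& t == t', a == a' & b == b'].
Proof. by move=> *; rewrite mat_pos_inj // mat_pos_inj // andbA. Qed.

Lemma row_node_lt t a b : (t <= K)%N -> (a < n)%N -> (b < n)%N ->
  (row_node t a b < K.+1 * n * n)%N.
Proof. by move=> *; rewrite !pos_lt. Qed.

Lemma row_marg_inj t b t' b' : (b < n)%N -> (b' < n)%N ->
  (row_marg t b == row_marg t' b') = (t == t') && (b == b').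
Proof. by move=> *; rewrite eqn_add2l mat_pos_inj. Qed.

Lemma row_node_marg t a b t' b' : (t <= K)%N -> (a < n)%N -> (b < n)%N ->
  (row_node t a b == row_marg t' b') = false.
Proof.
move=> ht ha hb; have := row_node_lt ht ha hb; rewrite /row_marg.
case: eqP => // ->; lia.
Qed.

Section Ring.
Variable F : realFieldType.
Implicit Types X : nat -> F.

Lemma sum_pos p q X :
  \sum_(i < p * q) X i = \sum_(i < p) \sum_(j < q) X (i * q + j)%N.
Proof.
elim: p => [|p IH]; first by rewrite mul0n !big_ord0.
rewrite big_ord_recr /= -IH -!(big_mkord xpredT X) /= mulSn addnC.
rewrite (big_cat_nat (leq0n _) (leq_addr q (p * q))) /=; congr (_ + _).
rewrite -{1}[(p * q)%N]add0n big_addn addKn !big_mkord.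
by apply: eq_bigr => j _; rewrite addnC.
Qed.

Lemma sum_cells X : \sum_(i < ncell) X i =
  \sum_(t < K) \sum_(a < n) \sum_(b < n) \sum_(b' < n) X (cell t a b b').
Proof.
rewrite /ncell sum_pos (sum_pos _ _ (fun i => \sum_(j < n) X (i * n + j)%N)).
by rewrite (sum_pos _ _ (fun l => \sum_(i < n) \sum_(j < n) X ((l * n + i) * n + j)%N)).
Qed.

Lemma sum_pick p X q : \sum_(i < p) X i * (q == i :> nat)%:R =
  if (q < p)%N then X q else 0.
Proof.
case: ltnP => h.
  rewrite (bigD1 (Ordinal h)) //= eqxx mulr1 big1 ?addr0 // => i ni.
  case: eqP => E; last by rewrite mulr0.
  by case/eqP: ni; apply: val_inj.
apply: big1 => i _; case: eqP => E; last by rewrite mulr0.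
by have := ltn_ord i; rewrite -E ltnNge h.
Qed.

(** The constraint matrix: conservation at the nodes [(t, a, b)] of the copy
    [a] of the layered graph, then the marginals. *)
Definition coef (r i : nat) : F :=
  (cell_tgt i == r)%:R - (cell_src i == r)%:R + (cell_marg i == r)%:R.

Definition applyA X (r : nat) : F := \sum_(i < ncell) coef r i * X i.

Lemma applyA_cells X r : applyA X r =
  \sum_(t < K) \sum_(a < n) \sum_(b < n) \sum_(b' < n)
    ((row_node t.+1 a b' == r)%:R - (row_node t a b == r)%:R
      + (row_marg t b == r)%:R) * X (cell t a b b').
Proof.
rewrite /applyA (sum_cells (fun i => coef r i * X i)).
do 4![apply: eq_bigr => ? _].
by rewrite /coef cell_tgtE ?cell_srcE ?cell_margE.
Qed.

(** ** Closed paths *)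

Definition node (p : nat -> nat) (t : nat) : nat := if t == K then p 0%N else p t.
Definition path_cell (p : nat -> nat) (t : nat) : nat := cell t (p 0%N) (p t) (node p t.+1).
Definition valid_path (p : nat -> nat) : Prop := forall t, (t < K)%N -> (p t < n)%N.
Definition chi (p : nat -> nat) (i : nat) : F := \sum_(t < K) (path_cell p t == i)%:R.

Section Path.
Variable p : nat -> nat.
Hypotheses (K0 : (0 < K)%N) (hp : valid_path p).

Lemma node_lt t : (t <= K)%N -> (node p t < n)%N.
Proof.
rewrite /node leq_eqVlt; case: eqP => [_ _|_] /=; [exact: hp|exact: hp].
Qed.

Lemma path_cell_lt t : (t < K)%N -> (path_cell p t < ncell)%N.
Proof. by move=> h; apply: cell_lt; rewrite ?hp ?node_lt. Qed.

Lemma sum_chi X : \sum_(i < ncell) X i * chi p i = \sum_(t < K) X (path_cell p t).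
Proof.
transitivity (\sum_(i < ncell) \sum_(t < K) X i * (path_cell p t == i :> nat)%:R).
  by apply: eq_bigr => i _; rewrite mulr_sumr.
rewrite exchange_big /=; apply: eq_bigr => t _.
by rewrite sum_pick path_cell_lt.
Qed.

(** Conservation telescopes along a path, leaving its two ends. *)
Lemma applyA_chi r : applyA (chi p) r =
  (row_node K (p 0%N) (p 0%N) == r)%:R - (row_node 0 (p 0%N) (p 0%N) == r)%:R
  + \sum_(t < K) (row_marg t (p t) == r)%:R.
Proof.
rewrite /applyA sum_chi.
pose G t : F := (row_node t (p 0%N) (node p t) == r)%:R.
have -> : \sum_(t < K) coef r (path_cell p t) =
   \sum_(t < K) ((G t.+1 - G t) + (row_marg t (p t) == r)%:R).
  apply: eq_bigr => t _; have h0 := hp K0; have ht := hp (ltn_ord t).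
  have hn : (node p t.+1 < n)%N by apply: node_lt.
  rewrite /coef /path_cell cell_tgtE // cell_srcE // cell_margE // /G.
  by have -> : node p t = p t by rewrite /node (ltn_eqF (ltn_ord t)).
rewrite big_split /=; congr (_ + _).
rewrite -(big_mkord xpredT (fun t => G t.+1 - G t)) telescope_sumr //.
by rewrite /G /node eqxx (ltn_eqF K0).
Qed.

End Path.

(** In the copy [a] the mass [mu 0 a] enters at the node [(0, a, a)] and leaves
    at [(K, a, a)]. *)
Definition rhs (mu : nat -> nat -> F) (r : nat) : F :=
  \sum_(a < n) mu 0%N a * ((row_node K a a == r)%:R - (row_node 0 a a == r)%:R)
  + \sum_(t < K) \sum_(b < n) mu t b * (row_marg t b == r)%:R.

Lemma sum_pick_val (I : finType) (w : I -> F) (f : I -> nat) (G : nat -> F) :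
  (forall e, f e < n)%N ->
  \sum_e w e * G (f e) = \sum_(b < n) (\sum_(e | f e == b) w e) * G b.
Proof.
move=> hf.
transitivity (\sum_e \sum_(b < n | f e == b) w e * G (f e)).
  by apply: eq_bigr => e _; rewrite (big_pred1 (Ordinal (hf e))) // => b /=; rewrite -val_eqE eq_sym.
rewrite (exchange_big_dep xpredT) //=; apply: eq_bigr => b _.
by rewrite mulr_suml; apply: eq_bigr => e /eqP->.
Qed.

(** Through this identity a tensor with marginals [mu], as a combination of
    paths, becomes a feasible flow. *)
Lemma applyA_mix (I : finType) (w : I -> F) (p : I -> nat -> nat)
    (mu : nat -> nat -> F) r : (0 < K)%N -> (forall e, valid_path (p e)) ->
  (forall t b, (t < K)%N -> (b < n)%N -> \sum_(e | p e t == b) w e = mu t b) ->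
  applyA (fun i => \sum_e w e * chi (p e) i) r = rhs mu r.
Proof.
move=> K0 hp hmu.
have -> : applyA (fun i => \sum_e w e * chi (p e) i) r = \sum_e w e * applyA (chi (p e)) r.
  rewrite /applyA; under eq_bigr do rewrite mulr_sumr.
  rewrite exchange_big /=; apply: eq_bigr => e _; rewrite mulr_sumr.
  by apply: eq_bigr => i _; rewrite mulrCA.
under eq_bigr do rewrite applyA_chi // mulrDr mulr_sumr.
rewrite big_split /=; congr (_ + _).
  rewrite (sum_pick_val w (f := fun e => p e 0%N)
    (fun a => (row_node K a a == r)%:R - (row_node 0 a a == r)%:R)); last first.
    by move=> e; apply: hp.
  by apply: eq_bigr => a _; rewrite hmu.
rewrite exchange_big /=; apply: eq_bigr => t _.
rewrite (sum_pick_val w (f := fun e => p e t) (fun b => (row_marg t b == r)%:R)); last first.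
  by move=> e; apply: hp.
by apply: eq_bigr => b _; rewrite hmu.
Qed.

(** The product coupling, projected to cells; [cond_marg] is the law of the
    node at time [t] given that the path starts at [a]. *)
Definition cond_marg (mu : nat -> nat -> F) (t a b : nat) : F :=
  if (t == 0%N) || (t == K) then (a == b)%:R else mu t b.

Definition product_flow (mu : nat -> nat -> F) (i : nat) : F :=
  let a := ((i %/ n %/ n) %% n)%N in let t := (i %/ n %/ n %/ n)%N in
  mu 0%N a * cond_marg mu t a ((i %/ n) %% n)%N * cond_marg mu t.+1 a (i %% n)%N.

(** Given the start [a], the visits at different times are independent, hence
    the mass that enters a node and the mass that leaves it are both the
    product of [mu 0 a] and of the law of the node. *)
Lemma applyA_product (mu : nat -> nat -> F) r : (0 < K)%N ->
  (forall t, (t < K)%N -> \sum_(b < n) mu t b = 1) ->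
  applyA (product_flow mu) r = rhs mu r.
Proof.
move=> K0 hmu.
have sm t a : (t <= K)%N -> (a < n)%N -> \sum_(b < n) cond_marg mu t a b = 1.
  rewrite leq_eqVlt /cond_marg => ht ha; case h: ((t == 0%N) || (t == K)).
    transitivity (\sum_(b < n) 1 * (a == b :> nat)%:R : F).
      by apply: eq_bigr => b _; rewrite mul1r.
    have := sum_pick n (fun=> 1) a; rewrite ha; exact.
  by apply: hmu; move: h ht; case: eqP => //= _ ->.
pose G t a := \sum_(b < n) cond_marg mu t a b * (row_node t a b == r)%:R.
rewrite applyA_cells.
have -> : \sum_(t < K) \sum_(a < n) \sum_(b < n) \sum_(b' < n)
    ((row_node t.+1 a b' == r)%:R - (row_node t a b == r)%:R
      + (row_marg t b == r)%:R) * product_flow mu (cell t a b b')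
  = \sum_(t < K) \sum_(a < n) (mu 0%N a * (G t.+1 a - G t a)
      + mu 0%N a * \sum_(b < n) cond_marg mu t a b * (row_marg t b == r)%:R).
  apply: eq_bigr => t _; apply: eq_bigr => a _.
  transitivity (\sum_(b < n) (mu 0%N a * (cond_marg mu t a b * G t.+1 a)
     - mu 0%N a * (cond_marg mu t a b * (row_node t a b == r)%:R)
     + mu 0%N a * (cond_marg mu t a b * (row_marg t b == r)%:R))).
    apply: eq_bigr => b _.
    transitivity (\sum_(b' < n) (mu 0%N a * cond_marg mu t a b *
        (cond_marg mu t.+1 a b' * (row_node t.+1 a b' == r)%:R)
      + mu 0%N a * cond_marg mu t a b *
        ((row_marg t b == r)%:R - (row_node t a b == r)%:R) * cond_marg mu t.+1 a b')).
      apply: eq_bigr => b' _; rewrite /product_flow.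
      have [_ -> _ -> [-> ->]] := cell_divmod t (ltn_ord a) (ltn_ord b) (ltn_ord b').
      ring.
    by rewrite big_split /= -!mulr_sumr sm // -/(G _ _); ring.
  rewrite big_split sumrB /= -!mulr_sumr -mulr_suml (sm t a (ltnW (ltn_ord t)) (ltn_ord a)).
  by rewrite /G; ring.
under eq_bigr do rewrite big_split /=.
rewrite big_split /= /rhs; congr (_ + _).
  rewrite exchange_big /=; apply: eq_bigr => a _; rewrite -mulr_sumr; congr (_ * _).
  rewrite -(big_mkord xpredT (fun t => G t.+1 a - G t a)) telescope_sumr //.
  have E t : (t == 0%N) || (t == K) -> G t a = (row_node t a a == r)%:R.
    move=> ht; rewrite /G /cond_marg ht.
    under eq_bigr do rewrite mulrC.
    by rewrite (sum_pick _ (fun b => (row_node t a b == r)%:R)) ltn_ord.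
  by rewrite !E ?eqxx ?orbT.
apply: eq_bigr => t _; rewrite /cond_marg (ltn_eqF (ltn_ord t)) orbF.
case: eqP => [->|_].
  apply: eq_bigr => a _; congr (_ * _).
  under eq_bigr do rewrite mulrC.
  by rewrite (sum_pick _ (fun b => (row_marg 0 b == r)%:R)) ltn_ord.
by rewrite -mulr_suml hmu // mul1r.
Qed.

(** ** Balanced flows *)

(** Conservation holds everywhere except at the source [(0, a, a)] and the sink
    [(K, a, a)] of each copy. *)
Definition balanced X : Prop := forall t a b,
  (t <= K)%N -> (a < n)%N -> (b < n)%N -> ((0 < t < K)%N || (a != b)) ->
  applyA X (row_node t a b) = 0.

(** Inflow minus outflow, without the missing side at the first and last layer. *)
Lemma applyA_node X t a b : (t <= K)%N -> (a < n)%N -> (b < n)%N ->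
  applyA X (row_node t a b) =
  (if t is t'.+1 then \sum_(b1 < n) X (cell t' a b1 b) else 0)
  - (if (t < K)%N then \sum_(b' < n) X (cell t a b b') else 0).
Proof.
move=> ht ha hb; rewrite applyA_cells.
have E (t' : 'I_K) (a' b1 b2 : 'I_n) : ((row_node t'.+1 a' b2 == row_node t a b)%:R -
     (row_node t' a' b1 == row_node t a b)%:R
     + (row_marg t' b1 == row_node t a b)%:R) * X (cell t' a' b1 b2)
   = X (cell t' a' b1 b2) * (b == b2)%:R * (a == a')%:R * (t == t'.+1)%:R
   - X (cell t' a' b1 b2) * (b == b1)%:R * (a == a')%:R * (t == t')%:R.
  rewrite [row_marg _ _ == _]eq_sym row_node_marg // addr0 !row_node_inj //.
  rewrite ![_ == t]eq_sym ![_ == a]eq_sym ![_ == b]eq_sym.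
  by rewrite -!mulnb !natrM; ring.
transitivity (\sum_(t' < K) ((\sum_(b1 < n) X (cell t' a b1 b)) * (t == t'.+1)%:R
    - (\sum_(b2 < n) X (cell t' a b b2)) * (t == t')%:R)).
  apply: eq_bigr => t' _.
  transitivity (\sum_(a' < n) ((\sum_(b1 < n) X (cell t' a' b1 b)) * (t == t'.+1)%:R
    - (\sum_(b2 < n) X (cell t' a' b b2)) * (t == t')%:R) * (a == a')%:R).
    apply: eq_bigr => a' _.
    under eq_bigr => b1 _ do under eq_bigr => b2 _ do rewrite E.
    under eq_bigr do rewrite sumrB -!mulr_suml.
    rewrite sumrB -!mulr_suml mulrBl; congr (_ - _).
      rewrite mulrAC; congr (_ * _ * _); apply: eq_bigr => b1 _.
      by rewrite (sum_pick _ (fun b2 => X (cell t' a' b1 b2))) hb.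
    rewrite mulrAC; congr (_ * _ * _).
    by rewrite (sum_pick _ (fun b1 => \sum_(b2 < n) X (cell t' a' b1 b2))) hb.
  by rewrite (sum_pick _ (fun a' => (\sum_(b1 < n) X (cell t' a' b1 b)) * (t == t'.+1)%:R
    - (\sum_(b2 < n) X (cell t' a' b b2)) * (t == t')%:R)) ha.
rewrite sumrB (sum_pick _ (fun t' => \sum_(b2 < n) X (cell t' a b b2))); congr (_ - _).
case: t ht {E} => [|t] ht; first by apply: big1 => i _; rewrite mulr0.
under eq_bigr do rewrite eqSS.
by rewrite (sum_pick _ (fun t' => \sum_(b1 < n) X (cell t' a b1 b))) ht.
Qed.

Lemma applyAB X Y l r : applyA (fun i => X i - l * Y i) r = applyA X r - l * applyA Y r.
Proof.
rewrite /applyA mulr_sumr -sumrB; apply: eq_bigr => i _; ring.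
Qed.

Lemma balancedB X Y l : balanced X -> balanced Y -> balanced (fun i => X i - l * Y i).
Proof.
by move=> hX hY t a b h1 h2 h3 h4; rewrite applyAB hX ?hY // mulr0 subr0.
Qed.

Lemma balanced_rhs X (mu : nat -> nat -> F) : (forall r, (r < nrow)%N -> applyA X r = rhs mu r) -> balanced X.
Proof.
move=> h t a b ht ha hb hab; rewrite h; last first.
  by apply: leq_trans (row_node_lt ht ha hb) (leq_addr _ _).
rewrite /rhs big1 => [|a' _]; last first.
  rewrite ![_ == row_node t a b]eq_sym !row_node_inj //.
  case: (eqVneq a a') hab => [->|ne] hab; last by rewrite !andbF subrr mulr0.
  case: (eqVneq b a') hab => [_|ne']; last by rewrite !andbF subrr mulr0.
  by rewrite orbF => /andP[/gtn_eqF-> /ltn_eqF->]; rewrite subrr mulr0.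
rewrite add0r; apply: big1 => t' _; apply: big1 => b' _.
by rewrite eq_sym row_node_marg // mulr0.
Qed.

Lemma rhs_marg (mu : nat -> nat -> F) t b : (t < K)%N -> (b < n)%N -> rhs mu (row_marg t b) = mu t b.
Proof.
move=> ht hb; rewrite /rhs big1 ?add0r => [|a _]; last first.
  by rewrite !row_node_marg // subrr mulr0.
transitivity (\sum_(t' < K) mu t' b * (t == t')%:R); last first.
  by rewrite (sum_pick _ (fun t' => mu t' b)) ht.
apply: eq_bigr => t' _.
transitivity (\sum_(b' < n) mu t' b' * (t == t')%:R * (b == b')%:R).
  apply: eq_bigr => b' _; rewrite row_marg_inj // -mulnb natrM mulrA.
  by rewrite ![_ == t]eq_sym ![_ == b]eq_sym.
by rewrite (sum_pick _ (fun b' => mu t' b' * (t == t')%:R)) hb.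
Qed.

Lemma balanced_chi p : (0 < K)%N -> valid_path p -> balanced (chi p).
Proof.
move=> K0 hp t a b ht ha hb hab; rewrite applyA_chi //.
rewrite [X in _ + X]big1 ?addr0 => [|t' _]; last by rewrite eq_sym row_node_marg.
have h0 := hp _ K0; rewrite ![_ == row_node t a b]eq_sym !row_node_inj //.
case: (eqVneq a (p 0%N)) hab => [->|ne] hab; last by rewrite !andbF subrr.
case: (eqVneq b (p 0%N)) hab => [_|ne']; last by rewrite !andbF subrr.
by rewrite orbF => /andP[/gtn_eqF-> /ltn_eqF->]; rewrite subrr.
Qed.

Lemma applyA_chi_marg p t b : (0 < K)%N -> valid_path p -> (t < K)%N -> (b < n)%N ->
  applyA (chi p) (row_marg t b) = (p t == b)%:R.
Proof.
move=> K0 hp ht hb; rewrite applyA_chi // !row_node_marg ?hp // subrr add0r.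
transitivity (\sum_(t' < K) (p t' == b)%:R * (t == t')%:R : F).
  apply: eq_bigr => t' _; rewrite row_marg_inj ?hp // -mulnb natrM mulrC.
  by rewrite [t == _]eq_sym.
by rewrite (sum_pick _ (fun t' => (p t' == b)%:R)) ht.
Qed.

Section Flow.
Variable X : nat -> F.
Hypotheses (K0 : (0 < K)%N) (hX : balanced X) (X0 : forall i, (i < ncell)%N -> 0 <= X i).

Lemma cell_ge0 t a b b' : (t < K)%N -> (a < n)%N -> (b < n)%N -> (b' < n)%N ->
  0 <= X (cell t a b b').
Proof. by move=> *; apply: X0; apply: cell_lt. Qed.

Lemma sum_gt0_ex (m : nat) (f : nat -> F) : 0 < \sum_(i < m) f i ->
  exists2 i, (i < m)%N & 0 < f i.
Proof.
move=> h; have [/existsP[i hi]|] := boolP [exists i : 'I_m, 0 < f i].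
  by exists i.
move=> /existsPn hn; have : \sum_(i < m) f i <= 0.
  by apply: sumr_le0 => i _; rewrite leNgt.
by rewrite leNgt h.
Qed.

Lemma flow_next t a b1 b : (t.+1 < K)%N -> (a < n)%N -> (b1 < n)%N -> (b < n)%N ->
  0 < X (cell t a b1 b) -> exists2 b', (b' < n)%N & 0 < X (cell t.+1 a b b').
Proof.
move=> ht ha hb1 hb h; apply: (@sum_gt0_ex n (fun b' => X (cell t.+1 a b b'))).
have /eqP := hX (ltnW ht) ha hb (introT orP (or_introl (introT andP (conj isT ht)))).
rewrite (applyA_node X (ltnW ht) ha hb) ht subr_eq0 => /eqP <-.
apply: lt_le_trans h _; rewrite (bigD1 (Ordinal hb1)) //= lerDl.
by apply: sumr_ge0 => i _; rewrite cell_ge0 // ltnW.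
Qed.

(** Flow leaves the first layer at the sources only, as nothing enters there;
    likewise it ends at the sinks. *)
Lemma flow_start a b b' : (a < n)%N -> (b < n)%N -> (b' < n)%N ->
  0 < X (cell 0 a b b') -> b = a.
Proof.
move=> ha hb hb' h; apply/eqP; apply: contraT; rewrite eq_sym => ne.
have /eqP := hX (leq0n K) ha hb (introT orP (or_intror ne)).
rewrite applyA_node // K0 sub0r oppr_eq0 psumr_eq0; last first.
  by move=> i _; apply: cell_ge0.
by move=> /allP/(_ (Ordinal hb') (mem_index_enum _))/eqP E; rewrite /= E ltxx in h.
Qed.

Lemma flow_end a b b' : (a < n)%N -> (b < n)%N -> (b' < n)%N ->
  0 < X (cell K.-1 a b b') -> b' = a.
Proof.
move=> ha hb hb' h; apply/eqP; apply: contraT; rewrite eq_sym => ne.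
have /eqP := hX (leqnn K) ha hb' (introT orP (or_intror ne)).
have hK : (K.-1 < K)%N by rewrite prednK.
rewrite applyA_node // ltnn subr0 -{1}(prednK K0) psumr_eq0; last first.
  by move=> i _; apply: cell_ge0.
by move=> /allP/(_ (Ordinal hb) (mem_index_enum _))/eqP E; rewrite /= E ltxx in h.
Qed.

(** By induction on the layer, as inflow and outflow agree. *)
Lemma flow_zero : (forall a b', (a < n)%N -> (b' < n)%N -> X (cell 0 a a b') = 0) ->
  forall i, (i < ncell)%N -> X i = 0.
Proof.
move=> h0.
have hc t a b b' : (t < K)%N -> (a < n)%N -> (b < n)%N -> (b' < n)%N -> X (cell t a b b') = 0.
  elim: t a b b' => [|t IH] a b b' ht ha hb hb'; apply/eqP; apply: contraT => ne.
    have pos : 0 < X (cell 0 a b b') by rewrite lt_def ne cell_ge0.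
    by move: ne; rewrite (flow_start ha hb hb' pos) h0 // eqxx.
  have pos : 0 < X (cell t.+1 a b b') by rewrite lt_def ne cell_ge0.
  have /eqP := hX (ltnW ht) ha hb (introT orP (or_introl (introT andP (conj isT ht)))).
  rewrite (applyA_node X (ltnW ht) ha hb) ht big1 => [|i _]; last by rewrite IH // ltnW.
  rewrite sub0r oppr_eq0 psumr_eq0 => [/allP/(_ (Ordinal hb') (mem_index_enum _))/eqP //= E|j _].
    by rewrite E ltxx in pos.
  exact: cell_ge0.
move=> i hi; have n0 : (0 < n)%N.
  by rewrite lt0n; apply: contraTneq hi => n0; rewrite /ncell n0 muln0.
rewrite (divn_eq i n) (divn_eq (i %/ n) n) (divn_eq (i %/ n %/ n) n).
apply: hc; rewrite ?ltn_mod // -!divnMA ltn_divLR ?muln_gt0 ?n0 //.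
by rewrite !mulnA.
Qed.

End Flow.

Lemma path_cell_neq p t t' : valid_path p -> (t < K)%N -> (t' < K)%N -> t != t' ->
  path_cell p t != path_cell p t'.
Proof.
move=> hp ht ht' ne; have K0 : (0 < K)%N by apply: leq_ltn_trans ht.
have nl u : (u < K)%N -> (node p u.+1 < n)%N by move=> hu; apply: node_lt.
apply: contraNneq ne => E; have := congr1 cell_src E.
rewrite /path_cell (cell_srcE _ (hp _ K0) (hp _ ht) (nl _ ht)).
rewrite (cell_srcE _ (hp _ K0) (hp _ ht') (nl _ ht')) => /eqP.
by rewrite row_node_inj ?hp // => /andP[].
Qed.

Lemma chi_path_cell p t : valid_path p -> (t < K)%N -> chi p (path_cell p t) = 1.
Proof.
move=> hp ht; rewrite /chi (bigD1 (Ordinal ht)) //= eqxx big1 ?addr0 // => t' ne.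
rewrite (negbTE (path_cell_neq hp (ltn_ord t') ht _)) //.
Qed.

Lemma chi_ge0 p i : 0 <= chi p i.
Proof. by apply: sumr_ge0 => t _; rewrite ler0n. Qed.

End Ring.
End Cells.

(** * Linear algebra on arrays *)

(** The programs share the following arrays.
    Naturals: 10 [n], 11 [d], 12 [K], 13 the number of cells, 14 the number of
    equations, 15 the constant 1, 16 [K * n ^ 2], 17 [K * n], 18 [n ^ 2]; 20 to
    25 counters; 30 and 31 division and remainder by [n]; 32 a column selected
    by purification; 33 to 36 the copy, the node, the next node and the cells
    of the path under construction; 37 all paths, [K] entries each.
    Rationals: 5 [x], 6 [s], 7 the cost, 8 the initial slack, 9 [mu], 40 the
    next [mu]; 10 the matrix of a projection, 11 a spare matrix; 12 the vector
    to be eliminated, 13 its image, 14 its square; 15 to 17 the residual, [dx]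
    and [ds] of a Newton step; 18 and 19 scratch; 20 to 23 the point to be
    purified, its cost vector, a direction, the inverse step length, 29 the
    orientation; 24 and 25 the vertices; 26 the quantity tested by the phases;
    27 squared distances; 28 weights of paths; 41 the flow not yet decomposed. *)

(** Cells that a block does not write are read in the memory before it; the
    names being concrete, that it does not write them is decided by computation. *)
Ltac frame := repeat match goal with
  | |- context [qmem (run ?p ?s) ?a ?i] => rewrite (@qmem_run p s a i isT)
  | |- context [nmem (run ?p ?s) ?a ?i] => rewrite (@nmem_run p s a i isT)
  end.

Definition vec (st : state) (A N : nat) : 'cV[rat]_N := \col_i qmem st A i.
Definition mat (st : state) (A N : nat) : 'M[rat]_N := \matrix_(i, j) qmem st A (i * N + j)%N.

Lemma vecE st A N i : vec st A N i 0 = qmem st A i.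
Proof. by rewrite mxE. Qed.

Lemma vec_run p st A N : A \notin modQ p -> vec (run p st) A N = vec st A N.
Proof. by move=> h; apply/colP => i; rewrite !mxE qmem_run. Qed.

Lemma mat_run p st A N : A \notin modQ p -> mat (run p st) A N = mat st A N.
Proof. by move=> h; apply/matrixP => i j; rewrite !mxE qmem_run. Qed.

Notation c0 := (NConst 0).
Definition at2 (A : nat) : qexp := QGet A (NAdd (NMul vi (var 13)) vj).
Definition vec_map (A : nat) (e : qexp) : prg := vec_sum A 13 15 e.

(** The indicator of equality: both truncated differences are 0 only then. *)
Definition eqe (e1 e2 : nexp) : qexp :=
  QOfNat (NSub (NConst 1) (NAdd (NSub e1 e2) (NSub e2 e1))).

Lemma eqe_sub (a b : nat) : (1 - (a - b + (b - a)))%N = (a == b).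
Proof. lia. Qed.

Lemma vec_mapP A e st N p : nmem st 13 0 = N -> nmem st 15 0 = 1%N ->
  A != 19%N -> A \notin qreads e -> 19%N \notin qreads e -> (p < N)%N ->
  qmem (run (vec_map A e) st) A p = qeval (at_index st p 0) e.
Proof.
by move=> hN h1 *; rewrite vec_sumP // ?hN // h1 big_ord1.
Qed.

Definition sum_to (A : nat) (e : qexp) : prg := vec_sum A 15 13 e.

Lemma sum_toP A e st N : nmem st 13 0 = N -> nmem st 15 0 = 1%N ->
  A != 19%N -> A \notin qreads e -> 19%N \notin qreads e ->
  qmem (run (sum_to A e) st) A 0 = \sum_(j < N) qeval (at_index st 0 j) e.
Proof. by move=> hN h1 *; rewrite vec_sumP ?h1 ?hN. Qed.

Lemma matQE A e st N i j : nmem st 13 0 = N -> A \notin qreads e ->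
  (i < N)%N -> (j < N)%N ->
  qmem (run (matQ A 13 13 e) st) A (i * N + j)%N = qeval (at_index st i j) e.
Proof. by move=> <- *; rewrite matQP. Qed.

Lemma notin_sub (l l' : seq nat) b : all (mem l) l' -> b \notin l -> b \notin l'.
Proof. by move=> /allP h; apply: contra => /h. Qed.

Ltac vframe := repeat match goal with
  | |- context [vec (run ?p ?s) ?A ?N] => rewrite (@vec_run p s A N isT)
  | |- context [mat (run ?p ?s) ?A ?N] => rewrite (@mat_run p s A N isT)
  end.

(** ** Elimination *)

Definition elim_prg : prg :=
  PSeq (vec_sum 13 13 13 (QMul (at2 10) (QGet 12 vj)))
  (PSeq (sum_to 14 (QMul (QGet 12 vj) (QGet 13 vj)))
  (PSeq (matQ 11 13 13 (QSub (at2 10) (QDiv (QMul (QGet 13 vi) (QGet 13 vj)) (qvar 14))))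
        (matQ 10 13 13 (at2 11)))).

Lemma elim_prgP st N : nmem st 13 0 = N -> nmem st 15 0 = 1%N ->
  mat (run elim_prg st) 10 N = elim (mat st 10 N) (vec st 12 N).
Proof.
move=> hN h1; rewrite /elim_prg !runS.
set s1 := run (vec_sum 13 _ _ _) st; set s2 := run (sum_to _ _) s1.
set s3 := run (matQ 11 _ _ _) s2.
have n1 : nmem s1 13 0 = N by rewrite /s1; frame.
have n2 : nmem s2 13 0 = N by rewrite /s2; frame.
have n3 : nmem s3 13 0 = N by rewrite /s3; frame.
have E1 i : (i < N)%N -> qmem s1 13 i = \sum_(j < N) qmem st 10 (i * N + j)%N * qmem st 12 j.
  by move=> lt; rewrite /s1 vec_sumP ?hN //; apply: eq_bigr => j _; rewrite /= /update /= hN.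
have W : vec s1 13 N = mat st 10 N *m vec st 12 N.
  apply/colP => i; rewrite !mxE E1 //; apply: eq_bigr => j _; rewrite !mxE //.
have E2 : qmem s2 14 0 = dot (vec st 12 N) (mat st 10 N *m vec st 12 N).
  rewrite /s2 (sum_toP n1) //; last by rewrite /s1; frame.
  apply: eq_bigr => j _; rewrite -W !mxE /= /update /=; congr (_ * _).
  by rewrite /s1; frame.
apply/matrixP => i j; rewrite [LHS]mxE (matQE n3) //.
rewrite /= /update /= n3 /s3 (matQE n2) // /= /update /= n2.
have Q2 p : qmem s2 10 p = qmem st 10 p by rewrite /s2 /s1; frame.
have W2 (l : 'I_N) : qmem s2 13 l = (mat st 10 N *m vec st 12 N) l 0.
  by rewrite -W mxE /s2; frame.
by rewrite Q2 !W2 E2 !mxE big_ord1 !mxE [in RHS]mulrC.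
Qed.

Definition elim_loop (L : nat) (e : qexp) : prg :=
  PFor 22 L (PSeq (vec_map 12 e) elim_prg).

(** What the vector to be eliminated may depend upon: the scratch cells of the
    elimination are excluded. *)
Definition elim_similar (st s : state) : Prop :=
  (forall a i, a \notin [:: 20; 21; 22]%N -> nmem s a i = nmem st a i) /\
  (forall a i, a \notin [:: 10; 11; 12; 13; 14; 19]%N -> qmem s a i = qmem st a i).

Lemma elim_loopP L e st N (a : nat -> 'cV[rat]_N) :
  is_size L -> nmem st 13 0 = N -> nmem st 15 0 = 1%N ->
  12%N \notin qreads e -> 19%N \notin qreads e ->
  (forall s r (i : 'I_N), (r < nmem st L 0)%N -> elim_similar st s -> nmem s 22 0 = r ->
     qeval (at_index s i 0) e = a r i 0) ->
  mat (run (elim_loop L e) st) 10 N = elimn a (nmem st L 0) (mat st 10 N).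
Proof.
move=> sL hN h1 r12 r19 he.
pose P r s := elim_similar st s /\ mat s 10 N = elimn a r (mat st 10 N).
have [|r s lt [[S1 S2] E]|s [_ <-] -> //] :=
  @for_run P 22 L (PSeq (vec_map 12 e) elim_prg) st; first by split; last by [].
rewrite runS; set s0 := set_counter s 22 r; set s1 := run (vec_map 12 e) s0.
have S0 : elim_similar st s0.
  split=> b i h; last exact: S2.
  by rewrite /= update_neq ?S1 //; apply: contraNneq h => ->.
have n0 : nmem s0 13 0 = N by rewrite S0.1.
have o0 : nmem s0 15 0 = 1%N by rewrite S0.1.
have n1 : nmem s1 13 0 = N by rewrite /s1; frame.
have o1 : nmem s1 15 0 = 1%N by rewrite /s1; frame.
split; last first.
  have Em : mat s1 10 N = mat s 10 N by rewrite /s1 mat_run.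
  have Ev : vec s1 12 N = a r.
    by apply/colP => i; rewrite mxE (vec_mapP n0) //; apply: he => //; rewrite /= update_eq.
  by rewrite (elim_prgP n1 o1) Em Ev E.
split=> b i h.
  rewrite nmem_run ?(notin_sub _ h) // nmem_run ?(notin_sub _ h) //.
  exact: S0.1.
rewrite qmem_run ?(notin_sub _ h) // qmem_run ?(notin_sub _ h) //.
exact: S0.2.
Qed.

(** ** Index tables and the constraint matrix *)

(** The machine neither divides nor takes remainders of naturals, so both are
    tabulated for the base [n]. *)
Record tables (n d K : nat) (st : state) : Prop := Tables {
  tab_n : nmem st 10 0 = n;  tab_d : nmem st 11 0 = d;
  tab_K : nmem st 12 0 = K;  tab_N : nmem st 13 0 = ncell n K;
  tab_M : nmem st 14 0 = nrow n K;  tab_1 : nmem st 15 0 = 1%N;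
  tab_Kn : nmem st 17 0 = (K * n)%N;  tab_nn : nmem st 18 0 = (n * n)%N;
  tab_div : forall i, (i < ncell n K)%N -> nmem st 30 i = (i %/ n)%N;
  tab_mod : forall i, (i < ncell n K)%N -> nmem st 31 i = (i %% n)%N }.

Lemma tables_ext n d K st s :
  (forall a, is_size a -> nmem s a 0 = nmem st a 0) ->
  (forall i, nmem s 30 i = nmem st 30 i) -> (forall i, nmem s 31 i = nmem st 31 i) ->
  tables n d K st -> tables n d K s.
Proof.
move=> hs h30 h31 [*]; split; rewrite ?hs // => i hi; rewrite ?h30 ?h31; auto.
Qed.

Lemma tables_run n d K p st : wf p -> 30 \notin modN p -> 31 \notin modN p ->
  tables n d K st -> tables n d K (run p st).
Proof.
move=> w h1 h2; apply: tables_ext => [a ha|i|i]; first exact: size_run.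
  by rewrite nmem_run.
by rewrite nmem_run.
Qed.

Lemma tables_counter n d K st v i : ~~ is_size v -> v != 30%N -> v != 31%N ->
  tables n d K st -> tables n d K (set_counter st v i).
Proof.
move=> hv h1 h2; apply: tables_ext => [a ha|j|j] /=; rewrite update_neq 1?eq_sym //.
by apply: contraNneq hv => ->.
Qed.

Definition div_e (e : nexp) : nexp := NGet 30 e.
Definition mod_e (e : nexp) : nexp := NGet 31 e.

Definition coef_e : qexp :=
  let q := div_e vi in let n := var 10 in
  QAdd (QSub (eqe (NAdd (NMul (NAdd (div_e q) n) n) (mod_e vi)) (var 22))
             (eqe q (var 22)))
    (eqe (NAdd (NMul (NMul (NAdd (var 12) (NConst 1)) n) n)
            (NAdd (NMul (div_e (div_e q)) n) (mod_e q))) (var 22)).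

Lemma coef_eP n d K s r i : tables n d K s -> (i < ncell n K)%N -> nmem s 22 0 = r ->
  qeval (at_index s i 0) coef_e = coef n K rat r i.
Proof.
move=> T hi hr; rewrite /coef_e /= !eqe_sub /update /= hr (tab_n T) (tab_K T) addn1.
have h1 : (i %/ n < ncell n K)%N := leq_ltn_trans (leq_div _ _) hi.
have h2 : (i %/ n %/ n < ncell n K)%N := leq_ltn_trans (leq_div _ _) h1.
by rewrite !(tab_div T, tab_mod T).
Qed.

Definition arow (n K r : nat) : 'cV[rat]_(ncell n K) := \col_i coef n K rat r i.

Definition mk_proj : prg :=
  PSeq (matQ 10 13 13 (QMul (QDiv (QGet 5 vi) (QGet 6 vi)) (eqe vi vj)))
       (elim_loop 14 coef_e).

Lemma mk_projP n d K st : tables n d K st ->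
  mat (run mk_proj st) 10 (ncell n K)
  = proj (nrow n K) (arow n K) (vec st 5 _) (vec st 6 _).
Proof.
move=> T; rewrite /mk_proj runS; set s1 := run (matQ _ _ _ _) st.
have T1 : tables n d K s1 by apply: tables_run T.
rewrite (elim_loopP (N := ncell n K) (a := arow n K)) ?(tab_N T1) ?(tab_1 T1) //.
  rewrite (tab_M T1) /proj; congr elimn; apply/matrixP => i j; rewrite !mxE.
  rewrite /s1 (matQE (tab_N T)) // /= eqe_sub /update /=.
  by rewrite -val_eqE /=; case: eqP => _; rewrite ?mulr1 ?mulr0.
move=> s r i _ [S1 S2] hr; rewrite (@coef_eP n d K _ r) ?mxE //.
by apply: (tables_ext _ _ _ T1) => [a ha|j|j]; rewrite S1 //; apply: contraTN ha; rewrite !inE => /or3P[]/eqP->.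
Qed.

(** ** The Newton step *)

Definition copy (A B : nat) : prg := vec_map A (QGet B vi).

Definition add_to (A : nat) (e : qexp) : prg :=
  PSeq (vec_map 18 (QAdd (QGet A vi) e)) (copy A 18).

Definition newton_prg : prg :=
  PSeq mk_proj
  (PSeq (vec_map 15 (QDiv (QSub (qvar 40) (QMul (QGet 5 vi) (QGet 6 vi))) (QGet 5 vi)))
  (PSeq (vec_sum 16 13 13 (QMul (at2 10) (QGet 15 vj)))
  (PSeq (vec_map 17 (QSub (QGet 15 vi) (QMul (QDiv (QGet 6 vi) (QGet 5 vi)) (QGet 16 vi))))
  (PSeq (add_to 5 (QGet 16 vi))
  (PSeq (add_to 6 (QGet 17 vi))
        (PQ 9 c0 (qvar 40))))))).

Lemma copyP A B st N : nmem st 13 0 = N -> nmem st 15 0 = 1%N ->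
  A != 19%N -> A != B -> B != 19%N -> vec (run (copy A B) st) A N = vec st B N.
Proof.
move=> hN h1 h2 h3 h4; apply/colP => i; rewrite !mxE (vec_mapP hN) //=.
- by rewrite inE.
- by rewrite inE eq_sym.
Qed.

Lemma add_toP A e st n d K : tables n d K st ->
  A != 19%N -> A != 18%N -> 18%N \notin qreads e -> 19%N \notin qreads e ->
  vec (run (add_to A e) st) A (ncell n K)
  = vec st A _ + \col_i qeval (at_index st i 0) e.
Proof.
move=> T h1 h2 h3 h4; rewrite /add_to runS; set s1 := run _ st.
have T1 : tables n d K s1 by apply: tables_run T.
rewrite copyP ?(tab_N T1) ?(tab_1 T1) //.
apply/colP => i; rewrite !mxE (vec_mapP (tab_N T)) ?(tab_1 T) //=.
  by rewrite inE negb_or eq_sym h2.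
by rewrite inE negb_or eq_sym h1.
Qed.

Lemma newton_prgP n d K st : tables n d K st ->
  let x := vec st 5 (ncell n K) in let s := vec st 6 (ncell n K) in
  let dx := proj (nrow n K) (arow n K) x s *m newton_rhs x s (qmem st 40 0) in
  let ds := newton_rhs x s (qmem st 40 0) - hprod (quot s x) dx in
  [/\ vec (run newton_prg st) 5 (ncell n K) = x + dx,
      vec (run newton_prg st) 6 (ncell n K) = s + ds &
      qmem (run newton_prg st) 9 0 = qmem st 40 0].
Proof.
move=> T x s dx ds; rewrite /newton_prg (runS mk_proj) (runS (vec_map 15 _)).
rewrite (runS (vec_sum _ _ _ _)) (runS (vec_map 17 _)) (runS (add_to 5 _)) (runS (add_to 6 _)).
set s1 := run mk_proj st; set s2 := run (vec_map 15 _) s1.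
set s3 := run (vec_sum _ _ _ _) s2; set s4 := run (vec_map 17 _) s3.
set s5 := run (add_to 5 _) s4; set s6 := run (add_to 6 _) s5.
have T1 : tables n d K s1 by apply: tables_run T.
have T2 : tables n d K s2 by apply: tables_run T1.
have T3 : tables n d K s3 by apply: tables_run T2.
have T4 : tables n d K s4 by apply: tables_run T3.
have T5 : tables n d K s5 by apply: tables_run T4.
have U : vec s2 15 (ncell n K) = newton_rhs x s (qmem st 40 0).
  apply/colP => i; rewrite !mxE (vec_mapP (tab_N T1)) ?(tab_1 T1) //=.
  by rewrite /update /= /s1; frame.
have DX : vec s3 16 (ncell n K) = dx.
  rewrite /dx -(mk_projP T) -U; apply/colP => i.
  rewrite !mxE /s3 vec_sumP ?(tab_N T2) //; apply: eq_bigr => j _.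
  by rewrite !mxE /= /update /= (tab_N T2) -/s2 /s2; congr (_ * _); frame.
have DS : vec s4 17 (ncell n K) = ds.
  apply/colP => i; rewrite newton_dsE -DX mxE (vec_mapP (tab_N T3)) ?(tab_1 T3) //=.
  have U15 : qmem s3 15 i = (qmem st 40 0 - x i 0 * s i 0) / x i 0.
    have /colP/(_ i) := U; rewrite [vec _ _ _ _ _]mxE [newton_rhs _ _ _ _ _]mxE => <-.
    by rewrite /s3; frame.
  rewrite /update /= U15 !vecE; congr (_ - _ / _ * _).
    by rewrite /s3 /s2 /s1; frame.
  by rewrite /s3 /s2 /s1; frame.
have X4 : vec s4 5 (ncell n K) = x by rewrite /s4 /s3 /s2 /s1 !vec_run.
have S5 : vec s5 6 (ncell n K) = s by rewrite /s5 /s4 /s3 /s2 /s1 !vec_run.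
have Z40 : qmem s6 40 0 = qmem st 40 0 by rewrite /s6 /s5 /s4 /s3 /s2 /s1; frame.
split; last by rewrite runQ /= update_eq Z40.
- rewrite vec_run // /s6 vec_run // /s5 (add_toP T4) // X4; congr (_ + _).
  by rewrite -DX; apply/colP => i; rewrite !mxE /= /update /= /s4; frame.
- rewrite vec_run // /s6 (add_toP T5) // S5; congr (_ + _).
  by rewrite -DS; apply/colP => i; rewrite !mxE /= /update /= /s5; frame.
Qed.

(** * Searching and purifying *)

Definition q0 : qexp := QOfNat c0.
Definition q1 : qexp := QOfNat (NConst 1).

(** If [e] is never positive, the result is 0, which is a valid index all the same. *)
Definition search (v L tgt : nat) (e : qexp) : prg :=
  PSeq (PN tgt c0 c0)
    (PFor v L (PIf (QLe e q0) (PN tgt c0 (var tgt)) (PN tgt c0 (var v)))).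

Lemma searchP v L tgt e st (f : nat -> rat) :
  is_size L -> ~~ is_size v -> ~~ is_size tgt -> tgt != v ->
  (0 < nmem st L 0)%N ->
  (forall s i, (i < nmem st L 0)%N ->
    (forall a l, a \notin [:: v; tgt] -> nmem s a l = nmem st a l) ->
    (forall a l, qmem s a l = qmem st a l) -> nmem s v 0 = i -> qeval s e = f i) ->
  let r := nmem (run (search v L tgt e) st) tgt 0 in
  (r < nmem st L 0)%N /\ ((exists2 i, (i < nmem st L 0)%N & 0 < f i) -> 0 < f r).
Proof.
move=> sL sv stgt tv m0 he; rewrite /search runS.
set s0 := run (PN _ _ _) st; set m := nmem st L 0 in m0 he *.
have mE : nmem s0 L 0 = m by rewrite /s0 runN /= update_neq // is_size_neq.
pose P (i : nat) s := [/\ forall a l, a \notin [:: v; tgt] -> nmem s a l = nmem st a l,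
  forall a l, qmem s a l = qmem st a l, (nmem s tgt 0 < m)%N &
  (exists2 j, (j < i)%N & 0 < f j) -> 0 < f (nmem s tgt 0)].
have [||s [_ _ h1 h2] ->] := @for_run P v L
   (PIf (QLe e q0) (PN tgt c0 (var tgt)) (PN tgt c0 (var v))) s0.
- rewrite /s0 runN; split=> //=; last by case.
    by move=> a l; rewrite !inE negb_or => /andP[_ h]; rewrite update_neq.
  by rewrite update_eq.
- rewrite mE => i s lti [h1 h2 h3 h4]; rewrite runIf.
  set s' := set_counter s v i.
  have N1 a l : a \notin [:: v; tgt] -> nmem s' a l = nmem st a l.
    by move=> h; rewrite -h1 //= update_neq //; move: h; rewrite !inE negb_or => /andP[].
  have E : qeval s' e = f i by apply: he => //; rewrite /= update_eq.
  have -> : beval s' (QLe e q0) = (f i <= 0) by rewrite /= E.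
  case: lerP => hf; rewrite runN /=; split=> //=.
  + by move=> a l h; rewrite update_neq; [exact: N1|move: h; rewrite !inE negb_or => /andP[]].
  + by rewrite update_eq update_neq.
  + rewrite update_eq update_neq // => -[j]; rewrite ltnS leq_eqVlt => /orP[/eqP->|lt] fj.
      by move: hf; rewrite leNgt fj.
    by apply: h4; exists j.
  + by move=> a l h; rewrite update_neq; [exact: N1|move: h; rewrite !inE negb_or => /andP[]].
  + by rewrite !update_eq.
  + by rewrite !update_eq.
- by rewrite mE in h2 *; rewrite /= update_neq.
Qed.

Definition max_loop (v L A : nat) (e : qexp) : prg :=
  PSeq (PQ A c0 q0) (PFor v L (PIf (QLe e (qvar A)) (PQ A c0 (qvar A)) (PQ A c0 e))).

Lemma max_loopP v L A e st (f : nat -> rat) :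
  is_size L -> ~~ is_size v ->
  (forall s i, (i < nmem st L 0)%N ->
    (forall a l, a != v -> nmem s a l = nmem st a l) ->
    (forall a l, a != A -> qmem s a l = qmem st a l) -> nmem s v 0 = i -> qeval s e = f i) ->
  let r := qmem (run (max_loop v L A e) st) A 0 in
  [/\ 0 <= r, forall i, (i < nmem st L 0)%N -> f i <= r &
      r = 0 \/ exists2 i, (i < nmem st L 0)%N & r = f i].
Proof.
move=> sL sv he; rewrite /max_loop runS.
set s0 := run (PQ _ _ _) st; set m := nmem st L 0 in he *.
pose P (i : nat) s := [/\ forall a l, a != v -> nmem s a l = nmem st a l,
  forall a l, a != A -> qmem s a l = qmem st a l & let r := qmem s A 0 in
  [/\ 0 <= r, forall j, (j < i)%N -> f j <= r & r = 0 \/ exists2 j, (j < i)%N & r = f j]].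
have mE : nmem s0 L 0 = m by rewrite /s0 runQ.
have [||s [_ _ h] ->] := @for_run P v L
   (PIf (QLe e (qvar A)) (PQ A c0 (qvar A)) (PQ A c0 e)) s0.
- rewrite /s0 runQ; split=> //=; first by move=> a l h; rewrite update_neq.
  by rewrite update_eq; split=> //; left.
- rewrite mE => i s lti [h1 h2 [h3 h4 h5]]; rewrite runIf.
  set s' := set_counter s v i.
  have N1 a l : a != v -> nmem s' a l = nmem st a l by move=> h; rewrite /= update_neq // h1.
  have E : qeval s' e = f i by apply: he => //; rewrite /= update_eq.
  have -> : beval s' (QLe e (qvar A)) = (f i <= qmem s A 0) by rewrite /= E.
  case: lerP => hf; rewrite runQ /=; split=> //=.
  + by move=> a l h; rewrite update_neq ?h2.
  + rewrite update_eq; split=> //.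
      by move=> j; rewrite ltnS leq_eqVlt => /orP[/eqP->//|]; apply: h4.
    by case: h5 => [->|[j lt rE]]; [left|right; exists j => //; rewrite ltnS ltnW].
  + by move=> a l h; rewrite update_neq ?h2.
  + rewrite update_eq E; split; first exact: le_trans h3 (ltW hf).
      move=> j; rewrite ltnS leq_eqVlt => /orP[/eqP->//|lt].
      by apply: le_trans (h4 _ lt) (ltW hf).
    by right; exists i.
- by rewrite mE in h *.
Qed.

(** ** Purification *)

Definition clear_prg : prg :=
  elim_loop 13 (QMul (eqe (var 22) vi) (QSub q1 (QDiv (QGet 20 vi) (QGet 20 vi)))).

Lemma clear_prgP st N : nmem st 13 0 = N -> nmem st 15 0 = 1%N ->
  mat (run clear_prg st) 10 N = clear (vec st 20 N) (mat st 10 N).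
Proof.
move=> hN h1; rewrite /clear_prg (elim_loopP (N := N) (a := zero_row (vec st 20 N))) //.
  by rewrite hN.
move=> s r i _ [S1 S2] hr; rewrite /= eqe_sub /update /= hr !mxE.
by rewrite !S2.
Qed.

(** One step of [purified_step]: a diagonal entry that is positive names a
    nonzero column of the projection, the sign of the cost of this column
    orients it, and the ratio test gives the inverse of the length of
    the move. *)
Definition purify_round : prg :=
  PSeq clear_prg
  (PSeq (search 24 13 32 (QGet 10 (NAdd (NMul (var 24) (var 13)) (var 24))))
  (PSeq (vec_map 22 (QGet 10 (NAdd (NMul vi (var 13)) (var 32))))
  (PSeq (sum_to 29 (QMul (QGet 21 vj) (QGet 22 vj)))
  (PSeq (PIf (QLe (qvar 29) q0) (PQ 29 c0 q1) (PQ 29 c0 (QSub q0 q1)))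
  (PSeq (max_loop 24 13 23 (QDiv (QSub q0 (QMul (qvar 29) (QGet 22 (var 24)))) (QGet 20 (var 24))))
        (add_to 20 (QDiv (QMul (qvar 29) (QGet 22 vi)) (qvar 23)))))))).

Definition purify_prg : prg := PFor 23 13 purify_round.

(** The form is positive semidefinite, so if the search finds no positive
    diagonal entry, then all of them vanish. *)
Lemma purify_roundP n d K st (Q0 : 'M[rat]_(ncell n K)) (z0 g : 'cV_(ncell n K)) it :
  tables n d K st -> (0 < ncell n K)%N -> g = vec st 21 (ncell n K) ->
  (forall i, z0 i 0 != 0 -> 0 < g i 0) ->
  psd Q0 -> purified Q0 z0 g (mat st 10 _) (vec st 20 _) it ->
  purified Q0 z0 g (mat (run purify_round st) 10 _) (vec (run purify_round st) 20 _) it.+1.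
Proof.
move=> T N0 gE g0 hQ0 hp; rewrite /purify_round (runS clear_prg) (runS (search _ _ _ _)).
rewrite (runS (vec_map 22 _)) (runS (sum_to _ _)) (runS (PIf _ _ _)) (runS (max_loop _ _ _ _)).
set N := ncell n K in hp N0 gE *.
set s1 := run clear_prg st; set s2 := run (search _ _ _ _) s1.
set s3 := run (vec_map 22 _) s2; set s4 := run (sum_to _ _) s3.
set s5 := run (PIf _ _ _) s4; set s6 := run (max_loop _ _ _ _) s5.
have T1 : tables n d K s1 by apply: tables_run T.
have T2 : tables n d K s2 by apply: tables_run T1.
have T3 : tables n d K s3 by apply: tables_run T2.
have T4 : tables n d K s4 by apply: tables_run T3.
have T5 : tables n d K s5 by apply: tables_run T4.
have T6 : tables n d K s6 by apply: tables_run T5.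
have hQ : psd (mat st 10 N) by case: hp.
pose Q1 := clear (vec st 20 N) (mat st 10 N).
have E1 : mat s1 10 N = Q1 by apply: clear_prgP; rewrite ?(tab_N T) ?(tab_1 T).
have hQ1 : psd Q1 by apply: psd_elimn.
pose f i := qmem s1 10 (i * N + i)%N.
have fE (i : 'I_N) : f i = Q1 i i by rewrite -E1 mxE.
have [||||||rlt rpos] := @searchP 24 13 32 (QGet 10 (NAdd (NMul (var 24) (var 13)) (var 24))) s1 f => //.
- by rewrite (tab_N T1).
- by move=> s i lt h1 h2 h3; rewrite /= h3 h1 // (tab_N T1) h2.
rewrite (tab_N T1) -/s2 in rlt rpos.
pose jj := Ordinal rlt.
have E3 : vec s3 22 N = col jj Q1.
  apply/colP => i; rewrite vecE [RHS]mxE -E1 [RHS]mxE.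
  rewrite /s3 (vec_mapP (tab_N T2)) ?(tab_1 T2) //= /update /= (tab_N T2).
  by rewrite {1}/s2; frame.
have G3 : vec s3 21 N = g by rewrite gE /s3 vec_run // /s2 vec_run // /s1 vec_run.
have E4 : qmem s4 29 0 = dot g (col jj Q1).
  rewrite /s4 (sum_toP (tab_N T3)) ?(tab_1 T3) //; apply: eq_bigr => j _.
  by rewrite -E3 -G3 /= /update /= [vec s3 21 N _ _]mxE [vec s3 22 N _ _]mxE.
pose sg : rat := if dot g (col jj Q1) <= 0 then 1 else -1.
have E5 : qmem s5 29 0 = sg.
  rewrite /s5 runIf /= E4 /sg; case: ifP => _; rewrite runQ /= update_eq //; exact: sub0r.
have V5 i : qmem s5 22 i = qmem s3 22 i by rewrite /s5 /s4; frame.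
have Z5 i : qmem s5 20 i = qmem st 20 i by rewrite /s5 /s4 /s3 /s2 /s1; frame.
pose v := sg *: col jj Q1; pose z := vec st 20 N.
pose h i := - (sg * qmem s3 22 i) / qmem st 20 i.
have hE (i : 'I_N) : h i = - v i 0 / z i 0.
  by rewrite /h /v /z -E3 [X in _ = - X / _]mxE !vecE.
have [|||r0 rmax rE] := @max_loopP 24 13 23 (QDiv (QSub q0 (QMul (qvar 29) (QGet 22 (var 24)))) (QGet 20 (var 24))) s5 h => //.
  by move=> s i lt h1 h2 h3; rewrite /= h3 !h2 // E5 V5 Z5 /h; congr (_ / _); exact: sub0r.
rewrite -/s6 in r0 rmax rE; set rho := qmem s6 23 0 in r0 rmax rE.
have -> : mat (run (add_to 20 (QDiv (QMul (qvar 29) (QGet 22 vi)) (qvar 23))) s6) 10 N = Q1.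
  by rewrite mat_run // /s6 mat_run // /s5 mat_run // /s4 mat_run // /s3 mat_run // /s2 mat_run.
have -> : vec (run (add_to 20 (QDiv (QMul (qvar 29) (QGet 22 vi)) (qvar 23))) s6) 20 N
   = z + rho^-1 *: v.
  rewrite (add_toP T6) //; congr (_ + _).
    by rewrite /s6 vec_run // /s5 vec_run // /s4 vec_run // /s3 vec_run // /s2 vec_run // /s1 vec_run.
  apply/colP => i; rewrite [LHS]mxE /= /update /= -/rho.
  have -> : qmem s6 29 0 = sg by rewrite /s6; frame.
  have -> : qmem s6 22 i = col jj Q1 i 0 by rewrite -E3 [vec _ _ _ _ _]mxE -V5 /s6; frame.
  by rewrite [RHS]mxE [v _ _]mxE mulrC.
apply: (purified_step hp g0) => //.
- move=> Qjj j; apply/le_anti; rewrite -/Q1; have [_ /(_ (delta_mx j 0))] := hQ1.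
  rewrite dot_delta -colE mxE => ->; rewrite andbT leNgt; apply/negP => pos.
  have fj : 0 < f j by rewrite fE.
  have := rpos (ex_intro2 _ _ (val j) (ltn_ord j) fj).
  by rewrite (fE jj) -/Q1 in Qjj *; rewrite Qjj ltxx.
- by move=> i; rewrite -/z -/v -hE; apply: rmax; rewrite (tab_N T5).
- case: rE => [|[i lt rE]]; [by left|right].
  by rewrite (tab_N T5) in lt; exists (Ordinal lt); rewrite -/z -/v -hE.
Qed.

Lemma purify_prgP n d K N st : N = ncell n K ->
  tables n d K st -> (0 < N)%N ->
  psd (mat st 10 N) -> (forall i, 0 <= vec st 20 N i 0) ->
  (forall i, vec st 20 N i 0 != 0 -> 0 < vec st 21 N i 0) ->
  let z := vec st 20 N in let z' := vec (run purify_prg st) 20 N in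
  [/\ forall i, 0 <= z' i 0, forall i, z i 0 = 0 -> z' i 0 = 0,
      exists y, z' = z + mat st 10 N *m y,
      dot (vec st 21 N) z' <= dot (vec st 21 N) z & vertex (mat st 10 N) z'].
Proof.
move=> NE; subst N; set N := ncell n K => T N0 hQ z0 g0 z z'.
pose P it s := [/\ tables n d K s, vec s 21 N = vec st 21 N &
  purified (mat st 10 N) (vec st 20 N) (vec st 21 N) (mat s 10 N) (vec s 20 N) it].
have [||s [T' _ hp] E] := @for_run P 23 13 purify_round st.
- by split=> //; apply: purified0.
- move=> it s lt [Ts Gs ps]; set s' := set_counter s 23 it.
  have Ts' : tables n d K s' by apply: tables_counter Ts.
  split; first by apply: tables_run Ts'.
    by rewrite vec_run.
  by apply: (purify_roundP Ts').
have -> : z' = vec s 20 N by rewrite /z' /purify_prg E.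
rewrite (tab_N T) -/N in hp.
by case: (hp) => *; split=> //; apply: purified_end hp.
Qed.

(** * The two phases of the path-following method *)

(** The invariant counts the rounds; [J] is a number of rounds after which it
    refutes the test. *)
Lemma while_rule (b : bexp) (p : prg) (P : nat -> state -> Prop) (J tb : nat) st :
  wf p -> P 0%N st ->
  (forall j s, P j s -> beval s b -> P j.+1 (run p s)) ->
  (forall j s, P j s -> (J <= j)%N -> ~~ beval s b) ->
  (forall j s, P j s -> (time_bound p (fun a => nmem s a 0) <= tb)%N) ->
  exists t s j, [/\ exec (While b (compile p)) st t s,
    (t <= J.+1 * (tb + bcost b))%N, (j <= J)%N, P j s & ~~ beval s b].
Proof.
move=> w P0 step stop bound.
have H m : forall j s, P j s -> (J <= m + j)%N -> (j <= J)%N ->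
  exists t s' j', [/\ exec (While b (compile p)) s t s',
    (t <= m.+1 * (tb + bcost b))%N, (j' <= J)%N, P j' s' & ~~ beval s' b].
  elim: m => [|m IH] j s Pj hj hJ.
    have nb := stop _ _ Pj hj.
    by exists (bcost b), s, j; split=> //; [exact: ExecWhileFalse|lia].
  have [hb|nb] := boolP (beval s b); last first.
    by exists (bcost b), s, j; split=> //; [exact: ExecWhileFalse|nia].
  have Pj1 := step _ _ Pj hb.
  have ltj : (j < J)%N by rewrite ltnNge; apply/negP => /(stop _ _ Pj); rewrite hb.
  have [|//|t2 [s2 [j2 [e2 t2b hj2 P2 nb2]]]] := IH _ _ Pj1; first by rewrite addnS -addSn.
  have [t1 t1b e1] := exec_run s w.
  exists (bcost b + t1 + t2)%N, s2, j2; split=> //; first exact: ExecWhileTrue e1 e2.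
  by have := bound _ _ Pj; nia.
have [||t [s [j h]]] := H J 0%N st P0; rewrite ?addn0 //.
by exists t, s, j.
Qed.

Definition step_size : qexp := QDiv (qvar 9) (QMul (QOfNat (NConst 8)) (QOfNat (var 13))).

Definition phase1_body : prg :=
  PSeq (PQ 40 c0 (QAdd (qvar 9) step_size))
  (PSeq newton_prg
    (sum_to 26 (QMul (QMul (QSub (QGet 7 vj) (QGet 8 vj)) (QGet 5 vj))
                     (QMul (QSub (QGet 7 vj) (QGet 8 vj)) (QGet 5 vj))))).

(** The array 26 holds the sum of the squares of [(c - s0) * x], the change of
    the products [x * s] when [c - s0] is added to the slack. *)
Definition phase1_cond : bexp :=
  BNot (QLe (QMul (QOfNat (NConst 64)) (qvar 26)) (QMul (qvar 9) (qvar 9))).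

(** Slacks for the objective [s0] become slacks for [c] by adding [c - s0]. *)
Definition switch_prg : prg :=
  PSeq (add_to 6 (QSub (QGet 7 vi) (QGet 8 vi))) (PQ 26 c0 q1).

(** Both walks start from the projections at the iterate, the second time to
    build [dual_proj] from it. *)
Definition purify_both : prg :=
  PSeq mk_proj (PSeq (copy 20 5) (PSeq (copy 21 6) (PSeq purify_prg (PSeq (copy 24 20)
  (PSeq mk_proj
  (PSeq (matQ 11 13 13
     (QSub (QMul (QDiv (QGet 6 vi) (QGet 5 vi)) (eqe vi vj))
       (QMul (QMul (QDiv (QGet 6 vi) (QGet 5 vi)) (at2 10)) (QDiv (QGet 6 vj) (QGet 5 vj)))))
  (PSeq (matQ 10 13 13 (at2 11))
  (PSeq (copy 20 6) (PSeq (copy 21 5) (PSeq purify_prg (PSeq (copy 25 20)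
    (sum_to 26 (QMul (QGet 24 vj) (QGet 25 vj)))))))))))))).

Definition phase2_body : prg :=
  PSeq (PQ 40 c0 (QSub (qvar 9) step_size)) (PSeq newton_prg purify_both).

Definition phase2_cond : bexp := BNot (QLe (qvar 26) q0).

Lemma col_addE (F : realFieldType) N (u v : 'cV[F]_N) i : (u + v) i 0 = u i 0 + v i 0.
Proof. by rewrite mxE. Qed.

Lemma col_subE (F : realFieldType) N (u v : 'cV[F]_N) i : (u - v) i 0 = u i 0 - v i 0.
Proof. by rewrite !mxE. Qed.

Lemma phase1_condE st : beval st phase1_cond =
  ~~ (64 * qmem st 26 0 <= qmem st 9 0 * qmem st 9 0).
Proof. exact: erefl. Qed.

Lemma off_center_shift (F : realFieldType) N (S : {set 'I_N}) (x s u : 'cV[F]_N) mu :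
  64 * off_center S x s mu <= mu ^+ 2 ->
  64 * dot (hprod u x) (hprod u x) <= mu * mu ->
  16 * off_center S x (s + u) mu <= mu ^+ 2.
Proof.
rewrite -expr2 => h1 h2.
have h3 : \sum_(i in S) (u i 0 * x i 0) ^+ 2 <= dot (hprod u x) (hprod u x).
  rewrite /dot [X in _ <= X](bigID (fun i => i \in S)) /=.
  rewrite -[X in X <= _]addr0 lerD //; last first.
    by apply: sumr_ge0 => i _; rewrite -expr2 sqr_ge0.
  by apply: ler_sum => i _; rewrite -expr2 mxE.
have : off_center S x (s + u) mu <= 2 * off_center S x s mu
    + 2 * \sum_(i in S) (u i 0 * x i 0) ^+ 2.
  rewrite !mulr_sumr -big_split /=; apply: ler_sum => i _.
  rewrite col_addE; move: (u i 0) (x i 0) (s i 0) => v y z.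
  have := sqr_ge0 (y * z - mu - v * y); rewrite !expr2; nra.
lra.
Qed.

Lemma off_center_weaken (F : realFieldType) N (S : {set 'I_N}) (x s : 'cV[F]_N) mu :
  64 * off_center S x s mu <= mu ^+ 2 -> 16 * off_center S x s mu <= mu ^+ 2.
Proof.
have : 0 <= off_center S x s mu by apply: sumr_ge0 => i _; apply: sqr_ge0.
lra.
Qed.

Lemma off_center_gt0 (F : realFieldType) N (S : {set 'I_N}) (x s : 'cV[F]_N) mu i :
  0 < mu -> 16 * off_center S x s mu <= mu ^+ 2 -> i \in S -> 0 < x i 0 ->
  0 < s i 0.
Proof.
move=> mu0 hc iS x0.
have : 0 < x i 0 * s i 0 by have := near_center hc iS; rewrite !expr2; nra.
by rewrite pmulr_rgt0.
Qed.

Section Phases.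
Variables (n d K : nat).
Local Notation N := (ncell n K).
Hypothesis N0 : (0 < N)%N.
Variable S : {set 'I_N}.
Local Notation a := (arow n K).
Local Notation M := (nrow n K).
Notation dir := (direction M a S).

Definition primal_pure (x x' s : 'cV[rat]_N) : Prop :=
  [/\ forall i, 0 <= x' i 0, forall i, i \notin S -> x' i 0 = 0, dir (x' - x),
      dot s x' <= dot s x &
      forall v, (forall r, (r < M)%N -> dot (a r) v = 0) ->
        (forall i, x' i 0 = 0 -> v i 0 = 0) -> v = 0].

Definition dual_pure (s s' x : 'cV[rat]_N) : Prop :=
  [/\ forall i, 0 <= s' i 0, forall i, i \notin S -> s' i 0 = 0,
      forall v, dir v -> dot v (s' - s) = 0, dot x s' <= dot x s &
      forall t, (forall v, dir v -> dot v t = 0) ->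
        (forall i, i \notin S -> t i 0 = 0) ->
        (forall i, s' i 0 = 0 -> t i 0 = 0) -> t = 0].

Lemma purify_bothP st : tables n d K st -> interior S (vec st 5 N) (vec st 6 N) ->
  let x := vec st 5 N in let s := vec st 6 N in let st' := run purify_both st in
  [/\ primal_pure x (vec st' 24 N) s, dual_pure s (vec st' 25 N) x &
      qmem st' 26 0 = dot (vec st' 24 N) (vec st' 25 N)].
Proof.
move=> T hxs x s st'.
pose s1 := run mk_proj st; pose s2 := run (copy 20 5) s1; pose s3 := run (copy 21 6) s2.
pose s4 := run purify_prg s3; pose s5 := run (copy 24 20) s4; pose s6 := run mk_proj s5.
pose s7 := run (matQ 11 13 13
     (QSub (QMul (QDiv (QGet 6 vi) (QGet 5 vi)) (eqe vi vj))
       (QMul (QMul (QDiv (QGet 6 vi) (QGet 5 vi)) (at2 10)) (QDiv (QGet 6 vj) (QGet 5 vj))))) s6.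
pose s8 := run (matQ 10 13 13 (at2 11)) s7.
pose s9 := run (copy 20 6) s8; pose s10 := run (copy 21 5) s9.
pose s11 := run purify_prg s10; pose s12 := run (copy 25 20) s11.
have E' : st' = run (sum_to 26 (QMul (QGet 24 vj) (QGet 25 vj))) s12.
  rewrite /st' /purify_both (runS mk_proj) (runS (copy 20 5)) (runS (copy 21 6)).
  rewrite (runS purify_prg) (runS (copy 24 20)) (runS mk_proj) (runS (matQ _ _ _ _)).
  rewrite (runS (matQ _ _ _ _)) (runS (copy 20 6)) (runS (copy 21 5)) (runS purify_prg).
  by rewrite (runS (copy 25 20)).
have T1 : tables n d K s1 by apply: tables_run T.
have T2 : tables n d K s2 by apply: tables_run T1.
have T3 : tables n d K s3 by apply: tables_run T2.
have T4 : tables n d K s4 by apply: tables_run T3.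
have T5 : tables n d K s5 by apply: tables_run T4.
have T6 : tables n d K s6 by apply: tables_run T5.
have T7 : tables n d K s7 by apply: tables_run T6.
have T8 : tables n d K s8 by apply: tables_run T7.
have T9 : tables n d K s9 by apply: tables_run T8.
have T10 : tables n d K s10 by apply: tables_run T9.
have T11 : tables n d K s11 by apply: tables_run T10.
have T12 : tables n d K s12 by apply: tables_run T11.
have P1 : mat s1 10 N = proj M a x s by apply: mk_projP T.
have x1 : vec s1 5 N = x by rewrite vec_run.
have z2 : vec s2 20 N = x by rewrite /s2 copyP ?(tab_N T1) ?(tab_1 T1).
have g3 : vec s3 21 N = s.
  by rewrite /s3 copyP ?(tab_N T2) ?(tab_1 T2) // /s2 vec_run // /s1 vec_run.
have z3 : vec s3 20 N = x by rewrite /s3 vec_run.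
have m3 : mat s3 10 N = proj M a x s by rewrite /s3 mat_run // /s2 mat_run.
have hP : psd (proj M a x s) := psd_proj M a hxs.
have supp i : (x i 0 != 0) = (i \in S) /\ (s i 0 != 0) = (i \in S).
  by have [-> ->] := int_supp hxs i; rewrite negbK.
have [] := purify_prgP (erefl N) T3 N0; rewrite ?m3 ?z3 ?g3 //.
- by move=> i; case: (int_ge0 hxs i).
- by move=> i; rewrite (supp i).1 => /(int_in hxs)[].
rewrite -/s4 => X0 Xs [y Xy] Xc Xv.
have x4 : vec s5 24 N = vec s4 20 N by rewrite /s5 copyP ?(tab_N T4) ?(tab_1 T4).
have x6 : vec s6 5 N = x.
  rewrite /s6 vec_run // /s5 vec_run // /s4 vec_run // /s3 vec_run // /s2 vec_run //.
have y6 : vec s6 6 N = s.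
  rewrite /s6 vec_run // /s5 vec_run // /s4 vec_run // /s3 vec_run // /s2 vec_run // /s1 vec_run //.
have P6 : mat s6 10 N = proj M a x s.
  by rewrite /s6 (mk_projP T5) /s5 /s4 /s3 /s2 /s1 !vec_run.
have P8 : mat s8 10 N = dual_proj M a x s.
  apply/matrixP => i j; rewrite mxE /s8 (matQE (tab_N T7)) //= /update /= (tab_N T7).
  rewrite /s7 (matQE (tab_N T6)) //= eqe_sub /update /= (tab_N T6).
  have -> : qmem s6 10 (i * N + j)%N = proj M a x s i j by rewrite -P6 mxE.
  rewrite -!(vecE s6 _ i) -!(vecE s6 _ j) x6 y6 [RHS]mxE -val_eqE /=.
  by case: eqP => _; rewrite ?mulr1 ?mulr0.
have x8 : vec s8 5 N = x by rewrite /s8 vec_run // /s7 vec_run.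
have y8 : vec s8 6 N = s by rewrite /s8 vec_run // /s7 vec_run.
have z10 : vec s10 20 N = s.
  by rewrite /s10 vec_run // /s9 copyP ?(tab_N T8) ?(tab_1 T8).
have g10 : vec s10 21 N = x.
  by rewrite /s10 copyP ?(tab_N T9) ?(tab_1 T9) // /s9 vec_run.
have m10 : mat s10 10 N = dual_proj M a x s by rewrite /s10 mat_run // /s9 mat_run.
have hD : psd (dual_proj M a x s) := psd_dual_proj M a hxs.
have [] := purify_prgP (erefl N) T10 N0; rewrite ?m10 ?z10 ?g10 //.
- by move=> i; case: (int_ge0 hxs i).
- by move=> i; rewrite (supp i).2 => /(int_in hxs)[].
rewrite -/s11 => S0 Ss [w Sw] Sc Sv.
have s12E : vec s12 25 N = vec s11 20 N by rewrite /s12 copyP ?(tab_N T11) ?(tab_1 T11).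
have x12 : vec s12 24 N = vec s4 20 N.
  rewrite /s12 vec_run // /s11 vec_run // /s10 vec_run // /s9 vec_run // /s8 vec_run //.
  by rewrite /s7 vec_run // /s6 vec_run.
have fx : vec st' 24 N = vec s4 20 N by rewrite E' vec_run.
have fs : vec st' 25 N = vec s11 20 N by rewrite E' vec_run.
split; last first.
- rewrite fx fs E' (sum_toP (tab_N T12)) ?(tab_1 T12) //; apply: eq_bigr => j _.
  by rewrite -x12 -s12E !vecE /= /update.
- rewrite fs; split=> //.
  + by move=> i /(int_notin hxs)[_ /Ss].
  + by move=> v hv; rewrite Sw addrC addKr; apply: dual_proj_dir hxs _ _ hv.
  + by move=> t h1 h2 h3; rewrite -(dual_proj_fix hxs h1 h2); apply: Sv; rewrite (dual_proj_fix hxs h1 h2).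
- rewrite fx; split=> //.
  + by move=> i /(int_notin hxs)[/Xs].
  + by rewrite Xy addrC addKr; apply: proj_direction.
  + move=> v h1 h2; have hv : dir v.
      by split=> // i /(int_notin hxs)[/Xs/h2].
    by rewrite -(proj_fix hxs hv); apply: Xv; rewrite (proj_fix hxs hv).
Qed.

Variables (c s0 x0 : 'cV[rat]_N).

(** An interior point for the objective [obj] whose distance to the central
    path at [mu] is controlled by [lvl]. *)
Record central (lvl : rat) (obj : 'cV[rat]_N) (mu : rat) (st : state) : Prop := Central {
  cen_tab : tables n d K st;
  cen_c : vec st 7 N = c;  cen_s0 : vec st 8 N = s0;
  cen_int : interior S (vec st 5 N) (vec st 6 N);
  cen_x : forall r, (r < M)%N -> dot (a r) (vec st 5 N) = dot (a r) x0;
  cen_s : forall v, dir v -> dot v (vec st 6 N - obj) = 0;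
  cen_mu : qmem st 9 0 = mu;  cen_pos : 0 < mu;
  cen_ctr : lvl * off_center S (vec st 5 N) (vec st 6 N) mu <= mu ^+ 2 }.

(** Only the relative change of [mu] matters; it is stated without divisions. *)
Lemma central_step lvl obj mu st e :
  16 <= lvl -> central lvl obj mu st -> qmem (run e st) 40 0 * (8 * N)%:R = mu * (8 * N)%:R + mu \/
    qmem (run e st) 40 0 * (8 * N)%:R = mu * (8 * N)%:R - mu ->
  wf e -> modQ e = [:: 40%N] -> modN e = [::] ->
  central 64 obj (qmem (run e st) 40 0) (run newton_prg (run e st)).
Proof.
move=> hl [T Hc Hs0 Hint Hx Hs Hmu mu0 Hctr] He w mQ mN.
set s := run e st in He *; set mu' := qmem s 40 0 in He *.
have Ts : tables n d K s by apply: tables_run T; rewrite ?mN.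
have v5 A : A != 40%N -> vec s A N = vec st A N.
  by move=> h; rewrite vec_run // mQ inE.
have N8 : 8 <= (8 * N)%:R :> rat by rewrite (ler_nat _ 8) leq_pmulr.
have [hmu' mup] : `|mu' - mu| * (8 * N)%:R <= mu /\ 0 < mu'.
  move: ((8 * N)%:R) N8 He => k k8 He; have k0 : 0 < k by lra.
  rewrite -[X in _ * X <= _](gtr0_norm k0) -normrM mulrBl; split.
    have [->|->] := He.
      by rewrite addrC addKr gtr0_norm.
    by rewrite addrC addKr normrN gtr0_norm.
  by rewrite -(pmulr_lgt0 _ k0); case: He => ->; nra.
have c16 : 16 * off_center S (vec st 5 N) (vec st 6 N) mu <= mu ^+ 2.
  apply: le_trans Hctr; rewrite ler_wpM2r //.
  by apply: sumr_ge0 => i _; apply: sqr_ge0.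
have [E5 E6 E9] := newton_prgP Ts;
have X5 : vec s 5 N = vec st 5 N by apply: v5.
have X6 : vec s 6 N = vec st 6 N by apply: v5.
rewrite X5 X6 in E5 E6.
have [D1 D2 D3 D4] := newton_step M a Hint mu0 hmu' N0 c16.
split.
- exact: tables_run Ts.
- by vframe; rewrite -Hc; apply: v5.
- by vframe; rewrite -Hs0; apply: v5.
- by rewrite E5 E6; apply: D3.
- by move=> r lt; rewrite E5 dotDr (Hx r lt) (D1.1 r lt) addr0.
- by move=> v hv; rewrite E6 addrAC dotDr (Hs v hv) add0r (D2 v hv).
- exact: E9.
- exact: mup.
- by rewrite E5 E6; apply: D4.
Qed.

(** The test quantity starts at 1 so that at least one round is made;
    afterwards it belongs to the current iterate. *)
Definition phase1_inv (j : nat) (st : state) : Prop :=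
  central 64 s0 ((1 + (8 * N)%:R^-1) ^+ j) st /\
  (qmem st 26 0 = (if j is 0%N then 1 else dot (hprod (c - s0) (vec st 5 N)) (hprod (c - s0) (vec st 5 N)))).

Lemma phase1_step j st : phase1_inv j st -> phase1_inv j.+1 (run phase1_body st).
Proof.
move=> [C _]; rewrite /phase1_body runS (runS newton_prg).
set e := PQ 40 _ _; set s1 := run newton_prg _.
have N8 : (8 * N)%:R != 0 :> rat by rewrite pnatr_eq0; lia.
have E : qmem (run e st) 40 0 = (1 + (8 * N)%:R^-1) ^+ j.+1.
  rewrite /e runQ /= update_eq (cen_mu C) (tab_N (cen_tab C)) -natrM.
  by rewrite exprSr mulrDr mulr1.
have C1 : central 64 s0 ((1 + (8 * N)%:R^-1) ^+ j.+1) s1.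
  rewrite -E; apply: (central_step (lvl := 64) (obj := s0) _ C);
    [by lra| |exact: isT|exact: erefl|exact: erefl].
  by left; rewrite E exprSr mulrDr mulr1 mulrDl (divfK N8).
have T1 := cen_tab C1; split.
  case: C1 => ? ? ? ? ? ? ? ? ?; split; frame; vframe; try assumption.
  exact: tables_run T1.
vframe; rewrite (sum_toP (tab_N T1) (tab_1 T1)); [|exact: isT..].
apply: eq_bigr => i _.
rewrite -(cen_c C1) -(cen_s0 C1) /= /update /= ![hprod _ _ _ _]mxE.
by rewrite col_subE !vecE.
Qed.

(** The entries of [(c - s0) * x] are at most [B], whereas [mu] doubles in [8 *
    N] rounds. *)
Lemma phase1_stop (B L : nat) j st : phase1_inv j st ->
  (forall i, `|c i 0 - s0 i 0| <= B%:R) -> (forall i, vec st 5 N i 0 <= 1) ->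
  (8 * N * B <= 2 ^ L)%N -> (8 * N * L + 1 <= j)%N -> ~~ beval st phase1_cond.
Proof.
move=> [C Et] hB x1 hL hj; rewrite phase1_condE negbK (cen_mu C) Et.
case: j hj C Et => [|j] hj C Et; first by rewrite addn1 in hj.
set mu := (_ ^+ j.+1); have mu2 : (2 ^ L)%:R <= mu.
  have e0 : 0 <= (8 * N)%:R^-1 :> rat by rewrite invr_ge0.
  have h1 : 2 <= (1 + (8 * N)%:R^-1) ^+ (8 * N) :> rat.
    apply: le_trans (bernoulli _ e0); rewrite -[X in 1 + X]mulr_natr mulVf //.
    by rewrite pnatr_eq0; lia.
  apply: (@le_trans _ _ ((1 + (8 * N)%:R^-1) ^+ (8 * N * L))).
    by rewrite exprM natrX lerXn2r // nnegrE //; lra.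
  by rewrite ler_weXn2l //; [lra|lia].
have muB : (8 * N * B)%:R <= mu by apply: le_trans mu2; rewrite ler_nat.
have dotB : dot (hprod (c - s0) (vec st 5 N)) (hprod (c - s0) (vec st 5 N)) <= N%:R * B%:R ^+ 2.
  rewrite /dot -[N in N%:R]card_ord -sum1_card natr_sum mulr_suml.
  apply: ler_sum => i _; rewrite mul1r -expr2 [hprod _ _ _ _]mxE exprMn.
  have [x0' _] := int_ge0 (cen_int C) i.
  have hx2 : vec st 5 N i 0 ^+ 2 <= 1 by rewrite exprn_ile1.
  have hb2 : (c - s0) i 0 ^+ 2 <= B%:R ^+ 2.
    rewrite -[X in X <= _]ger0_norm ?sqr_ge0 // normrX lerXn2r ?nnegrE //.
    by have := hB i; rewrite col_subE.
  by rewrite -[X in _ <= X]mulr1 ler_pM ?sqr_ge0.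
apply: (@le_trans _ _ ((8 * N * B)%:R ^+ 2)); last first.
  by rewrite -expr2 lerXn2r ?nnegrE // ltW // (cen_pos C).
apply: (@le_trans _ _ (64 * (N%:R * B%:R ^+ 2))); first by rewrite ler_wpM2l.
rewrite (natrM _ (8 * N) B) (natrM _ 8 N); have NN : N%:R <= N%:R ^+ 2 :> rat.
  by rewrite expr2 ler_peMl // ler1n.
have := ler_wpM2r (sqr_ge0 (B%:R : rat)) NN; rewrite !expr2; lra.
Qed.

Lemma phase1_switch j st : phase1_inv j.+1 st -> ~~ beval st phase1_cond ->
  (forall i, i \notin S -> c i 0 = 0 /\ s0 i 0 = 0) ->
  central 16 c (qmem st 9 0) (run switch_prg st) /\ qmem (run switch_prg st) 26 0 = 1.
Proof.
move=> [C Et] hc hcs; rewrite /switch_prg (runS (add_to _ _)).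
set s1 := run (add_to _ _) st; split; last by rewrite runQ /= update_eq.
have T := cen_tab C; have [_ Hc Hs0 Hint Hx Hs Hmu mu0 Hctr] := C.
set mu := (_ ^+ j.+1) in Hmu mu0 Hctr.
move: hc; rewrite phase1_condE negbK Et Hmu; set q := dot _ _ => hq.
clearbody mu.
set x := vec st 5 N in Hint Hx Hctr q hq; set s := vec st 6 N in Hint Hs Hctr.
have E6 : vec s1 6 N = s + (c - s0).
  rewrite /s1 (add_toP T); [|exact: isT..]; congr (_ + _); apply/colP => i.
  by rewrite -Hc -Hs0 col_subE mxE !vecE /= /update.
have E5 : vec s1 5 N = x by rewrite /s1; vframe.
have ctr := off_center_shift Hctr hq.
split; vframe.
- by apply: tables_run; [exact: isT..|apply: tables_run T].
- by rewrite -Hc /s1; vframe.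
- by rewrite -Hs0 /s1; vframe.
- rewrite E5 E6 => i; have := Hint i; case: ifP => iS [x0' s0'].
    split; first exact: x0'.
    exact: (off_center_gt0 mu0 ctr iS x0').
  have [c0' s00] := hcs i (negbT iS).
  split; first exact: x0'.
  by rewrite col_addE col_subE s0' c0' s00 oppr0 !addr0.
- by rewrite E5.
- move=> v hv; rewrite E6.
  have -> : s + (c - s0) - c = s - s0 by rewrite addrA addrAC addrK.
  exact: Hs.
- by frame; rewrite /s1; frame.
- exact: mu0.
- by rewrite E5 E6; apply: ctr.
Qed.

(** Feasible solutions of the problem restricted to [S] and of its dual. *)
Record certificate (x' s' : 'cV[rat]_N) : Prop := Certificate {
  cert_x0 : forall i, 0 <= x' i 0;
  cert_xS : forall i, i \notin S -> x' i 0 = 0;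
  cert_Ax : forall r, (r < M)%N -> dot (a r) x' = dot (a r) x0;
  cert_s0 : forall i, 0 <= s' i 0;
  cert_sS : forall i, i \notin S -> s' i 0 = 0;
  cert_dual : forall v, dir v -> dot v (s' - c) = 0 }.

(** After a round, the arrays 24 and 25 hold the vertices found from the
    iterate and the array 26 their duality gap. *)
Definition phase2_inv (mu1 : rat) (j : nat) (st : state) : Prop :=
  central 16 c (mu1 * (1 - (8 * N)%:R^-1) ^+ j) st /\
  (if j is 0%N then qmem st 26 0 = 1 else
   [/\ certificate (vec st 24 N) (vec st 25 N),
     qmem st 26 0 = dot (vec st 24 N) (vec st 25 N),
     qmem st 26 0 <= (2 * N)%:R * (mu1 * (1 - (8 * N)%:R^-1) ^+ j),
     forall v, (forall r, (r < M)%N -> dot (a r) v = 0) ->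
        (forall i, vec st 24 N i 0 = 0 -> v i 0 = 0) -> v = 0 &
     forall t, (forall v, dir v -> dot v t = 0) ->
        (forall i, i \notin S -> t i 0 = 0) ->
        (forall i, vec st 25 N i 0 = 0 -> t i 0 = 0) -> t = 0]).

(** Purifying [x] with the cost [s] and [s] with the cost [x] does not increase
    the gap: as [x' - x] is a direction and [s' - s] is orthogonal to it, [dot
    x' s'] is [dot x' s + dot x s' - dot x s]. *)
Lemma phase2_step mu1 j st :
  phase2_inv mu1 j st -> phase2_inv mu1 j.+1 (run phase2_body st).
Proof.
move=> [C _]; rewrite /phase2_body runS (runS newton_prg).
set e := PQ 40 _ _; set s1 := run newton_prg _.
have N8 : (8 * N)%:R != 0 :> rat by rewrite pnatr_eq0; lia.
rewrite /phase2_inv; set mu' := mu1 * _; set mu := mu1 * _ in C.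
have mE : mu' = mu - mu / (8 * N)%:R by rewrite /mu' /mu exprSr; ring.
have E : qmem (run e st) 40 0 = mu'.
  rewrite /e runQ /= update_eq (cen_mu C) (tab_N (cen_tab C)) -natrM.
  by rewrite mE.
have C1 : central 64 c mu' s1.
  rewrite -E; apply: (central_step (lvl := 16) (obj := c) _ C);
    [by lra| |exact: isT|exact: erefl|exact: erefl].
  by right; rewrite E mE mulrBl (divfK N8).
clearbody mu mu' s1; clear E mE.
have T1 := cen_tab C1; have [] := purify_bothP T1 (cen_int C1).
set x := vec s1 5 N; set s := vec s1 6 N.
move=> [X0 XS XA Xc Xv] [S0 SS SA Sc Sv] G; split; last split.
- case: C1 => ? ? ? ? ? ? ? ? h; split; frame; vframe; try assumption.
    by apply: tables_run T1.
  exact: off_center_weaken h.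
- split; [exact: X0|exact: XS| |exact: S0|exact: SS|].
  + move=> r lt; rewrite -(cen_x C1 lt) -/x; apply/eqP.
    by rewrite -subr_eq0 -dotBr XA.1.
  + move=> v hv; set s' := vec _ 25 N.
    have -> : s' - c = (s' - s) + (s - c) by rewrite addrA subrK.
    by rewrite dotDr SA // (cen_s C1 hv) addr0.
- exact: G.
- rewrite G; set x' := vec _ 24 N in X0 XS XA Xc Xv G *.
  set s' := vec _ 25 N in S0 SS SA Sc Sv G *.
  have hd := dot_center (cen_int C1) (cen_pos C1).
  have E : dot x' s' = dot s x' + dot x s' - dot x s.
    have := SA _ XA; rewrite dotBl !dotBr (dotC s x').
    by move=> h; apply/eqP; rewrite -subr_eq0 -h; apply/eqP; ring.
  have := hd (off_center_weaken (cen_ctr C1)); rewrite E -/x -/s; move: Xc Sc; rewrite (dotC s x).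
  lra.
- exact: Xv.
- exact: Sv.
Qed.
End Phases.

(** * Exact termination *)

Lemma cellP n K i : (i < ncell n K)%N -> exists t a b b',
  [/\ i = cell n t a b b', (t < K)%N, (a < n)%N, (b < n)%N & (b' < n)%N].
Proof.
move=> hi; have n0 : (0 < n)%N.
  by rewrite lt0n; apply: contraTneq hi => n0; rewrite /ncell n0 muln0.
exists (i %/ n %/ n %/ n)%N, ((i %/ n %/ n) %% n)%N, ((i %/ n) %% n)%N, (i %% n)%N.
rewrite !ltn_mod n0; split=> //.
  by rewrite /cell -!divn_eq.
by rewrite -!divnMA ltn_divLR ?muln_gt0 ?n0 // !mulnA.
Qed.

(** The rows of the nodes and of the marginals are different, and so are the
    two ends of a cell, being in different layers. *)
Lemma coef_small n K r i : (i < ncell n K)%N -> small_int (coef n K rat r i).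
Proof.
move=> /cellP[t [a [b [b' [-> ht ha hb hb']]]]].
rewrite /coef cell_tgtE // cell_srcE // cell_margE //.
case: (row_marg n K t b =P r) => [<-|_].
  rewrite (row_node_marg t b ht ha hb') (row_node_marg t b (ltnW ht) ha hb).
  by rewrite subrr add0r; apply: small_int1.
rewrite addr0; case: eqP => _; case: eqP => _; rewrite ?subrr ?subr0 ?sub0r.
- exact: small_int0.
- exact: small_int1.
- by split; rewrite ?rpredN ?rpred1 ?normrN1.
- exact: small_int0.
Qed.

Lemma applyA_marg n K (F : realFieldType) (X : nat -> F) t b : (t < K)%N -> (b < n)%N ->
  applyA n K X (row_marg n K t b) = \sum_(a < n) \sum_(b' < n) X (cell n t a b b').
Proof.
move=> ht hb; rewrite applyA_cells.
transitivity (\sum_(t' < K) (\sum_(a < n) \sum_(b' < n) X (cell n t' a b b')) * (t == t')%:R).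
  apply: eq_bigr => t' _; rewrite mulr_suml; apply: eq_bigr => a _.
  transitivity (\sum_(b1 < n) (\sum_(b' < n) X (cell n t' a b1 b')) * (t == t')%:R * (b == b1)%:R).
    apply: eq_bigr => b1 _; rewrite !mulr_suml; apply: eq_bigr => b' _.
    rewrite (row_node_marg t b (ltn_ord t') (ltn_ord a) (ltn_ord b')).
    rewrite (row_node_marg t b (ltnW (ltn_ord t')) (ltn_ord a) (ltn_ord b1)).
    rewrite subrr add0r row_marg_inj // -mulnb natrM.
    by rewrite ![_ == t]eq_sym ![_ == b]eq_sym; ring.
  by rewrite (sum_pick n (fun b1 => (\sum_(b' < n) X (cell n t' a b1 b')) * (t == t')%:R) b) hb.
by rewrite (sum_pick K (fun t' => \sum_(a < n) \sum_(b' < n) X (cell n t' a b b')) t) ht.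
Qed.

Lemma dot_arow n K st A r :
  dot (arow n K r) (vec st A (ncell n K)) = applyA n K (qmem st A) r.
Proof. by apply: eq_bigr => i _; rewrite !mxE. Qed.

(** The marginals, which are at most 1, bound the entries of a flow. *)
Lemma cell_le_marg n K (F : realFieldType) (X : nat -> F) t a b b' :
  (forall i, (i < ncell n K)%N -> 0 <= X i) ->
  (t < K)%N -> (a < n)%N -> (b < n)%N -> (b' < n)%N ->
  X (cell n t a b b') <= applyA n K X (row_marg n K t b).
Proof.
move=> X0 ht ha hb hb'; rewrite applyA_marg // (bigD1 (Ordinal ha)) //= (bigD1 (Ordinal hb')) //=.
rewrite -addrA lerDl addr_ge0 //.
  by apply: sumr_ge0 => j _; apply/X0/cell_lt.
by apply: sumr_ge0 => i _; apply: sumr_ge0 => j _; apply/X0/cell_lt.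
Qed.

Lemma phase2_condE st : beval st phase2_cond = ~~ (qmem st 26 0 <= 0).
Proof. exact: erefl. Qed.

(** By Bernoulli [(1 + 1 / m) ^ m] is at least 2, and its product with [(1 - 1
    / m) ^ m] is at most 1. *)
Lemma contract_pow (m L : nat) : (0 < m)%N ->
  (1 - m%:R^-1) ^+ (m * L) * 2 ^+ L <= 1 :> rat.
Proof.
move=> m0; set q : rat := m%:R^-1.
have q0 : 0 <= q by rewrite invr_ge0.
have q1 : q <= 1 by rewrite invf_le1 ?ler1n // ltr0n.
rewrite exprM -exprMn exprn_ile1 //.
  by rewrite mulr_ge0 // exprn_ge0 // subr_ge0.
have h2 : 2 <= (1 + q) ^+ m.
  apply: le_trans (bernoulli _ q0); rewrite -[X in 1 + X]mulr_natr mulVf //.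
  by rewrite pnatr_eq0; lia.
apply: (@le_trans _ _ ((1 - q) ^+ m * (1 + q) ^+ m)).
  by rewrite ler_wpM2l // exprn_ge0 // subr_ge0.
rewrite -exprMn exprn_ile1 //.
  by rewrite mulr_ge0 //; lra.
have := sqr_ge0 q; rewrite expr2; nra.
Qed.

Lemma small_gap (N L1 L2 j Q : nat) (mu1 g : rat) : (0 < N)%N ->
  0 <= mu1 -> mu1 <= (2 ^ L1)%:R ->
  g <= (2 * N)%:R * (mu1 * (1 - (8 * N)%:R^-1) ^+ j) ->
  (Q * (2 * N) < 2 ^ L2)%N -> (8 * N * (L1 + L2) <= j)%N -> g * Q%:R < 1.
Proof.
move=> N0 m0 m1 hg hQ hj.
have m8 : (0 < 8 * N)%N by rewrite muln_gt0.
have q0 : 0 <= ((8 * N)%:R^-1 : rat) by rewrite invr_ge0.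
have q1 : ((8 * N)%:R^-1 : rat) <= 1 by rewrite invf_le1 ?ler1n // ltr0n.
set w := 1 - _ in hg.
have w0 : 0 <= w by rewrite subr_ge0.
have wj : w ^+ j <= w ^+ (8 * N * (L1 + L2)).
  by apply: ler_wiXn2l hj => //; rewrite gerBl.
have h := contract_pow (L1 + L2) m8; rewrite -/w in h.
set W := w ^+ (8 * N * (L1 + L2)) in wj h.
have W0 : 0 <= W by rewrite exprn_ge0.
have gle : g <= (2 * N)%:R * ((2 ^ L1)%:R * W).
  apply: le_trans hg _; rewrite ler_wpM2l //.
  by apply: ler_pM => //; rewrite exprn_ge0.
apply: le_lt_trans (ler_wpM2r (ler0n _ Q) gle) _.
have hQ' : (Q * (2 * N))%:R < (2 ^ L2)%:R :> rat by rewrite ltr_nat.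
move: h; rewrite exprD -!natrX => h.
have -> : (2 * N)%:R * ((2 ^ L1)%:R * W) * Q%:R = (Q * (2 * N))%:R * ((2 ^ L1)%:R * W).
  by rewrite (natrM _ Q); ring.
have P1 : 0 < (2 ^ L1)%:R :> rat by rewrite ltr0n expn_gt0.
have [->|Wn] := eqVneq W 0; first by rewrite !mulr0.
have Wp : 0 < W by rewrite lt_def Wn.
apply: lt_le_trans (_ : (2 ^ L2)%:R * ((2 ^ L1)%:R * W) <= 1).
  by rewrite ltr_pM2r // mulr_gt0.
by apply: le_trans h; rewrite le_eqVlt; apply/orP; left; apply/eqP; ring.
Qed.

(** The gap of the two vertices is a rational with denominator at most [N`! ^ 2
    * E1 * E2], and after that many rounds it is smaller than the inverse of
    this number. *)
Lemma phase2_stop n d K (S : {set 'I_(ncell n K)}) (c x0 s0 : 'cV[rat]_(ncell n K))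
    (mu1 : rat) (E1 E2 L1 L2 j : nat) st :
  (0 < ncell n K)%N -> (0 < E1)%N -> (0 < E2)%N ->
  (forall r, (r < nrow n K)%N -> E1%:R * dot (arow n K r) x0 \is a Num.int) ->
  (forall i, E2%:R * c i 0 \is a Num.int) ->
  (forall i, i \notin S -> c i 0 = 0) ->
  0 <= mu1 -> mu1 <= (2 ^ L1)%:R ->
  ((ncell n K)`! * (ncell n K)`! * (E1 * E2) * (2 * ncell n K) < 2 ^ L2)%N ->
  phase2_inv d S c s0 x0 mu1 j st -> (8 * ncell n K * (L1 + L2) + 1 <= j)%N ->
  ~~ beval st phase2_cond.
Proof.
move=> N0 e1 e2 hA hc cS m0 m1 hQ [_ I] hj.
case: j hj I => [|j] hj; first by rewrite addn1 in hj.
move=> [[X0 XS XA S0 SS SA] G Gle Xv Sv].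
have small r i : (r < nrow n K)%N -> small_int (arow n K r i 0).
  by move=> _; rewrite mxE; apply: coef_small.
have [D1 [D1K hD1]] : exists D : nat, (0 < D <= (ncell n K)`!)%N /\
    forall i, D%:R * E1%:R * vec st 24 (ncell n K) i 0 \is a Num.int.
  apply: (primal_vertex_int small Xv) => r lt; rewrite (XA r lt); exact: hA.
have [D2 [D2K hD2]] : exists D : nat, (0 < D <= (ncell n K)`!)%N /\
    forall i, D%:R * E2%:R * vec st 25 (ncell n K) i 0 \is a Num.int.
  apply: (dual_vertex_int small SA _ Sv hc) => i iS; split; [exact: SS|exact: cS].
rewrite phase2_condE negbK G; have G0 : 0 <= dot (vec st 24 (ncell n K)) (vec st 25 _).
  by apply: sumr_ge0 => i _; apply: mulr_ge0; [exact: X0|exact: S0].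
rewrite (int_dot_eq0 hD1 hD2 D1K D2K e1 e2 G0); first exact: lexx.
rewrite G in Gle; apply: (small_gap N0 m0 m1 Gle hQ).
by apply: leq_trans hj; rewrite addn1.
Qed.

(** * Peeling a closed path off a flow *)

Definition cell_e (t a b b' : nexp) : nexp :=
  NAdd (NMul (NAdd (NMul (NAdd (NMul t (var 10)) a) (var 10)) b) (var 10)) b'.

(** The array 34 holds the current node of the path and 33 the copy it runs in;
    the step moves along some cell with positive flow, recorded in 36. *)
Definition path_step : prg :=
  PSeq (PN 37 (NAdd (NMul (var 23) (var 12)) (var 25)) (var 34))
  (PSeq (search 24 10 35 (QGet 41 (cell_e (var 25) (var 33) (var 34) (var 24))))
  (PSeq (PN 36 (var 25) (cell_e (var 25) (var 33) (var 34) (var 35)))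
        (PN 34 c0 (var 35)))).

Definition path_prg : prg :=
  PSeq (search 24 18 33 (QGet 41 (cell_e c0 (div_e (var 24)) (div_e (var 24)) (mod_e (var 24)))))
  (PSeq (PN 33 c0 (div_e (var 33)))
  (PSeq (PN 34 c0 (var 33))
        (PFor 25 12 path_step))).

Definition path_names : seq nat := [:: 24; 25; 33; 34; 35; 36; 37]%N.

Definition path_of (st : state) (K e t : nat) : nat := nmem st 37 (e * K + t)%N.

Section PathStep.
Variables (n d K it sel : nat) (st : state).
Hypotheses (T : tables n d K st) (n0 : (0 < n)%N) (K0 : (0 < K)%N) (seln : (sel < n)%N).
Hypothesis h23 : nmem st 23 0 = it.
Let R : nat -> rat := qmem st 41.
Hypotheses (Rbal : balanced n K R) (R0 : forall i, (i < ncell n K)%N -> 0 <= R i).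

(** The invariant of the walk. Nothing is claimed about the flow on the path
    unless there is a start with flow; the path is valid in any case. *)
Record walk (t : nat) (s : state) : Prop := Walk {
  wk_q : forall a i, qmem s a i = qmem st a i;
  wk_n : forall a i, a \notin path_names -> nmem s a i = nmem st a i;
  wk_J : forall i, (i < it * K)%N -> nmem s 37 i = nmem st 37 i;
  wk_sel : nmem s 33 0 = sel;
  wk_cur : (nmem s 34 0 < n)%N;
  wk_0 : (if t is 0%N then nmem s 34 0 else path_of s K it 0) = sel;
  wk_p : forall u, (u < t)%N -> (path_of s K it u < n)%N;
  wk_E : forall u, (u < t)%N -> nmem s 36 u =
    cell n u sel (path_of s K it u) (if u.+1 == t then nmem s 34 0 else path_of s K it u.+1);
  wk_pos : (exists2 b', (b' < n)%N & 0 < R (cell n 0 sel sel b')) ->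
    forall u, (u < t)%N -> 0 < R (nmem s 36 u) }.

Lemma walk_step t s : (t < K)%N -> walk t s -> walk t.+1 (run path_step (set_counter s 25 t)).
Proof.
move=> tK [Wq Wn WJ Wsel Wcur W0 Wp WE Wpos].
set cur := nmem s 34 0 in Wcur W0 WE.
have Tn a : a \in [:: 10; 12]%N -> nmem s a 0 = nmem st a 0.
  by rewrite !inE => /orP[]/eqP->; apply: Wn.
have h10 : nmem s 10 0 = n by rewrite Tn // (tab_n T).
have h12 : nmem s 12 0 = K by rewrite Tn // (tab_K T).
have s23 : nmem s 23 0 = it by rewrite Wn.
rewrite /path_step runS (runS (search _ _ _ _)) (runS (PN 36 _ _)) [run (PN 37 _ _) _]runN.
set s0 := set_counter s 25 t.
have -> : neval s0 (NAdd (NMul (var 23) (var 12)) (var 25)) = (it * K + t)%N.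
  by rewrite /= /update /= s23 h12.
have -> : neval s0 (var 34) = cur by rewrite /= /update.
set s1 := State _ _; set s2 := run (search _ _ _ _) s1.
have N1 a l : a != 37%N -> a != 25%N -> nmem s1 a l = nmem s a l.
  by move=> h1 h2; rewrite /= update_neq // update_neq.
have s1n : nmem s1 10 0 = n by rewrite N1.
have Q1 a l : qmem s1 a l = qmem st a l by rewrite -Wq.
have J1 i : nmem s1 37 i = update (nmem s) 37 (it * K + t) cur 37 i.
  by rewrite /= /update /=; case: ifP.
have t1 : nmem s1 25 0 = t by rewrite /= /update.
clearbody s1; clear s0.
pose f b' := R (cell n t sel cur b').
have [||||||rlt rpos] := @searchP 24 10 35 (QGet 41 (cell_e (var 25) (var 33) (var 34) (var 24))) s1 f => //.
- by rewrite s1n.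
- move=> s' i lt h1 h2 h3; rewrite /= h3 h2 Q1 !(h1 10%N) // !(h1 25%N) // !(h1 33%N) // (h1 34%N) //.
  by rewrite s1n t1 (N1 33%N) // (N1 34%N) // Wsel.
rewrite -/s2 s1n in rlt rpos; set nxt := nmem s2 35 0 in rlt rpos.
have N2 a l : a \notin [:: 24; 35]%N -> nmem s2 a l = nmem s1 a l.
  by move=> h; rewrite nmem_run // (notin_sub _ h).
have Q2 a l : qmem s2 a l = qmem st a l by rewrite -Q1 qmem_run.
clearbody s2; have e25 : neval s2 (var 25) = t by rewrite /= N2.
have eE : neval s2 (cell_e (var 25) (var 33) (var 34) (var 35)) = cell n t sel cur nxt.
  by rewrite /= !(N2 10%N) // (N2 25%N) // (N2 33%N) // (N2 34%N) // s1n t1 (N1 33%N) // (N1 34%N) // Wsel.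
rewrite !runN; rewrite [neval s2 (var 25)]e25 eE.
set s3 := State _ _.
have N3 a l : a \notin [:: 34; 36; 24; 35; 37; 25]%N -> nmem s3 a l = nmem s a l.
  rewrite !inE !negb_or => /and5P[h1 h2 h3 h4 /andP[h5 h6]].
  by rewrite /= update_neq // update_neq // N2 ?inE ?negb_or ?h3 // N1.
have c34 : nmem s3 34 0 = nxt by rewrite /= update_eq.
have J3 i : nmem s3 37 i = update (nmem s) 37 (it * K + t) cur 37 i.
  by rewrite /= update_neq // update_neq // N2.
have Q3 a l : qmem s3 a l = qmem st a l by rewrite -Q2.
have P3 u : (u < t)%N -> path_of s3 K it u = path_of s K it u.
  by move=> lt; rewrite /path_of J3 update_off //; lia.
have P3t : path_of s3 K it t = cur by rewrite /path_of J3 update_eq.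
have E3 u : nmem s3 36 u = if u == t then cell n t sel cur nxt else nmem s 36 u.
  rewrite /= update_neq // /update eqxx /=; case: ifP => // _.
  by rewrite N2 // N1.
clearbody s3; split.
- exact: Q3.
- move=> a i h; rewrite N3 ?Wn //; move: h; apply: contra; rewrite !inE.
  by do ?[case/orP=> [->|]; rewrite ?orbT //] => ->; rewrite ?orbT.
- by move=> i lt; rewrite J3 update_off ?WJ //; lia.
- by rewrite N3.
- by rewrite c34.
- by move: W0 P3 P3t; case: (t) => [|t'] W0 P3 P3t; [rewrite P3t|rewrite P3].
- move=> u; rewrite ltnS leq_eqVlt => /orP[/eqP->|lt]; first by rewrite P3t.
  by rewrite P3 // Wp.
- move=> u; rewrite ltnS leq_eqVlt E3 => /orP[/eqP->|lt].
    by rewrite !eqxx P3t c34.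
  rewrite (ltn_eqF lt) WE // P3 // eqSS (ltn_eqF lt).
  by case: eqP => [->|/eqP ne]; [rewrite P3t|rewrite P3 // ltn_neqAle ne].
- move=> hpos u; rewrite ltnS leq_eqVlt E3 => /orP[/eqP->|lt]; last first.
    by rewrite (ltn_eqF lt); apply: Wpos.
  rewrite eqxx; apply: rpos; rewrite /f.
  move: tK W0 WE (Wpos hpos) Wp; case: (t) => [|t'] tK' W0' WE' Wpos' Wp'.
    by rewrite W0'.
  have := Wpos' t' (ltnSn t'); rewrite WE' // eqxx => h.
  by apply: (flow_next Rbal R0 tK' seln _ Wcur h); apply: Wp'.
Qed.

Lemma nn_le_ncell : (n * n <= ncell n K)%N.
Proof.
rewrite /ncell -mulnA -[X in (X <= _)%N]mul1n leq_mul2r; apply/orP; right.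
by rewrite muln_gt0 K0.
Qed.

End PathStep.

Definition any_start n (R : nat -> rat) : Prop :=
  exists a b', [/\ (a < n)%N, (b' < n)%N & 0 < R (cell n 0 a a b')].

Lemma path_prgP n d K it st : tables n d K st -> (0 < n)%N -> (0 < K)%N ->
  nmem st 23 0 = it -> balanced n K (qmem st 41) ->
  (forall i, (i < ncell n K)%N -> 0 <= qmem st 41 i) ->
  exists sel, [/\ (sel < n)%N, walk n K it sel st K (run path_prg st) &
    any_start n (qmem st 41) -> exists2 b', (b' < n)%N & 0 < qmem st 41 (cell n 0 sel sel b')].
Proof.
move=> T n0 K0 h23 Rbal R0; rewrite /path_prg runS (runS (PN 33 _ _)) (runS (PN 34 _ _)).
set s1 := run (search _ _ _ _) st.
have nn := nn_le_ncell n0 K0.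
pose f p := qmem st 41 (cell n 0 (p %/ n) (p %/ n) (p %% n)).
have [||||||rlt rpos] := @searchP 24 18 33 (QGet 41 (cell_e c0 (div_e (var 24)) (div_e (var 24)) (mod_e (var 24)))) st f => //.
- by rewrite (tab_nn T) muln_gt0 n0.
- rewrite (tab_nn T) => s i lt h1 h2 h3.
  have T' : tables n d K s.
    apply: (tables_ext _ _ _ T) => [a ha|j|j]; apply: h1 => //.
    by apply: contraTN ha; rewrite !inE => /orP[]/eqP->.
  have li := leq_trans lt nn.
  by rewrite /= h3 h2 (tab_n T') (tab_div T') // (tab_mod T').
rewrite (tab_nn T) -/s1 in rlt rpos; set p := nmem s1 33 0 in rlt rpos.
have N1 a l : a \notin [:: 24; 33]%N -> nmem s1 a l = nmem st a l.
  by move=> h; rewrite nmem_run // (notin_sub _ h).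
have Q1 a l : qmem s1 a l = qmem st a l by rewrite qmem_run.
have T1 : tables n d K s1 by apply: tables_run T.
pose sel := (p %/ n)%N.
have e33 : neval s1 (div_e (var 33)) = sel by rewrite /= (tab_div T1) // (leq_trans rlt).
rewrite !runN /= [nmem s1 30 _]e33; rewrite update_eq.
set s3 := State _ _.
have seln : (sel < n)%N by rewrite ltn_divLR.
exists sel; split => //; last first.
  move=> [a [b' [ha hb hp]]]; exists (p %% n)%N; first by rewrite ltn_mod.
  apply: rpos; exists (a * n + b')%N; first exact: pos_lt.
  by rewrite /f divnMDl // divn_small // addn0 modnMDl modn_small.
have N3 a l : a \notin [:: 24; 33; 34]%N -> nmem s3 a l = nmem st a l.
  rewrite !inE !negb_or => /and3P[h1 h2 h3].
  by rewrite /= update_neq // update_neq // N1 ?inE ?negb_or ?h1.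
have W0 : walk n K it sel st 0 s3.
  split=> //.
  - by move=> a l h; rewrite N3 //; apply: (notin_sub _ h).
  - by move=> i _; rewrite N3.
have h12 : nmem s3 12 0 = K by rewrite N3 // (tab_K T).
have [|t s|s W ->] := @for_run (walk n K it sel st) 25 12 path_step s3; first exact: W0.
  by rewrite h12; apply: (walk_step (d := d)).
rewrite h12 in W *; case: W => *; split=> //.
- by move=> a i h; rewrite /= update_neq; auto; apply: contraNneq h => ->.
Qed.

(** The bottleneck is found as the inverse of the maximum of the inverses. The
    cost of a path is increased by 1 to make it positive. *)
Definition decomp_round : prg :=
  PSeq path_prg
  (PSeq (max_loop 25 12 23 (QDiv q1 (QGet 41 (NGet 36 (var 25)))))
  (PSeq (PQ 28 (var 23) (QDiv q1 (qvar 23)))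
  (PSeq (vec_sum 18 15 12 (QGet 7 (NGet 36 vj)))
  (PSeq (PQ 21 (var 23) (QAdd q1 (qvar 18)))
    (PFor 25 12 (PQ 41 (NGet 36 (var 25))
        (QSub (QGet 41 (NGet 36 (var 25))) (QGet 28 (var 23))))))))).

(** Removing the bottleneck of a path empties one of its cells. When no start
    is left the flow is zero, the bottleneck is [1 / 0 = 0], and the round adds
    a path of weight zero. *)
Lemma decomp_roundP n d K it st : tables n d K st -> (0 < n)%N -> (0 < K)%N ->
  nmem st 23 0 = it -> balanced n K (qmem st 41) ->
  (forall i, (i < ncell n K)%N -> 0 <= qmem st 41 i) ->
  (forall i, (i < ncell n K)%N -> 0 <= qmem st 7 i) ->
  let st' := run decomp_round st in let p := path_of st' K it in let wt := qmem st' 28 it in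
  [/\ [/\ forall i, (i < it * K)%N -> nmem st' 37 i = nmem st 37 i,
          forall e, e != it -> qmem st' 28 e = qmem st 28 e &
          forall e, e != it -> qmem st' 21 e = qmem st 21 e],
      valid_path n K p /\ 0 <= wt,
      forall i, (i < ncell n K)%N -> qmem st' 41 i = qmem st 41 i - wt * chi n K rat p i,
      (forall i, (i < ncell n K)%N -> 0 <= qmem st' 41 i) /\
      ((forall i, (i < ncell n K)%N -> qmem st' 41 i = 0) \/
       exists i, [/\ (i < ncell n K)%N, qmem st 41 i != 0 & qmem st' 41 i = 0]) &
      0 < qmem st' 21 it /\ (wt != 0 ->
        qmem st' 21 it = 1 + \sum_(t < K) qmem st 7 (path_cell n K p t))].
Proof.
move=> T n0 K0 h23 Rbal R0 C0.
have [sel [seln W hpos]] := path_prgP T n0 K0 h23 Rbal R0.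
rewrite /decomp_round (runS path_prg) (runS (max_loop _ _ _ _)) (runS (PQ _ _ _)).
rewrite (runS (vec_sum _ _ _ _)) (runS (PQ _ _ _)).
set s1 := run path_prg st in W *.
set s2 := run (max_loop _ _ _ _) s1; set s3 := run (PQ 28 _ _) s2.
set s4 := run (vec_sum _ _ _ _) s3; set s5 := run (PQ 21 _ _) s4.
set R := qmem st 41 in Rbal R0 hpos *.
have T1 : tables n d K s1 by apply: tables_run T.
have T2 : tables n d K s2 by apply: tables_run T1.
have T3 : tables n d K s3 by apply: tables_run T2.
have T4 : tables n d K s4 by apply: tables_run T3.
have T5 : tables n d K s5 by apply: tables_run T4.
case: W => Wq Wn WJ Wsel Wcur W0 Wp WE Wpos.
pose E u := nmem s1 36 u; set p1 := path_of s1 K it in Wp W0 WE.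
have {}W0 : p1 0%N = sel by move: W0; rewrite -(prednK K0).
have Elt u : (u < K)%N -> (E u < ncell n K)%N.
  move=> lt; rewrite /E WE //; apply: cell_lt => //; first exact: Wp.
  by case: eqP => // /eqP ne; apply: Wp; rewrite ltn_neqAle ne.
have N2 a l : a != 25%N -> nmem s2 a l = nmem s1 a l.
  by move=> h; rewrite nmem_run //= !inE.
pose h u := 1 / R (E u).
have [|||r0 rmax rE] := @max_loopP 25 12 23 (QDiv q1 (QGet 41 (NGet 36 (var 25)))) s1 h => //.
  by move=> s i lt h1 h2 h3; rewrite /= h3 h2 // h1 // Wq.
rewrite (tab_K T1) -/s2 in r0 rmax rE; set rho := qmem s2 23 0 in r0 rmax rE.
pose lam := 1 / rho.
have i2 : nmem s2 23 0 = it by rewrite N2 // Wn.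
have s3E : s3 = State (nmem s2) (update (qmem s2) 28 it lam).
  by rewrite /s3 runQ /= i2.
have Q2 a l : a != 23%N -> qmem s2 a l = qmem st a l.
  by move=> ha; rewrite qmem_run ?Wq // (@notin_sub [:: 23%N]) // inE.
have wt3 : qmem s3 28 it = lam by rewrite s3E /= update_eq.
have E3 u : nmem s3 36 u = E u by rewrite s3E /= N2.
have c4 : qmem s4 18 0 = \sum_(u < K) qmem st 7 (E u).
  rewrite /s4 vec_sumP ?(tab_1 T3) // (tab_K T3); apply: eq_bigr => u _.
  by rewrite /= /update /= E3 s3E /= update_neq // Q2.
have s5E : s5 = State (nmem s4) (update (qmem s4) 21 it (1 + qmem s4 18 0)).
  have i4 : nmem s4 23 0 = it by rewrite nmem_run // s3E /= i2.
  by rewrite /s5 runQ /= i4.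
have E5 u : nmem s5 36 u = E u by rewrite s5E /= nmem_run // E3.
have i5 : nmem s5 23 0 = it by rewrite s5E /= nmem_run // s3E /= i2.
have Q5 a l : a \notin [:: 19; 18; 23; 21; 28]%N -> qmem s5 a l = qmem st a l.
  rewrite !inE !negb_or => /and5P[h1 h2 h3 h4 h5].
  rewrite s5E /= update_neq // qmem_run; last first.
    by rewrite (@notin_sub [:: 19; 18]%N) // !inE negb_or h1.
  by rewrite s3E /= update_neq // Q2.
pose cnt t i : rat := \sum_(u < t) (E u == i)%:R.
pose P t s := [/\ forall a l, a != 25%N -> nmem s a l = nmem s5 a l,
  forall a l, a != 41%N -> qmem s a l = qmem s5 a l &
  forall i, qmem s 41 i = R i - lam * cnt t i].
have lam5 : qmem s5 28 it = lam.
  by rewrite s5E /= update_neq // qmem_run // wt3.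
have [|t s lt [P1 P2 P3]|s [P1 P2 P3] ->] := @for_run P 25 12 (PQ 41 (NGet 36 (var 25))
        (QSub (QGet 41 (NGet 36 (var 25))) (QGet 28 (var 23)))) s5.
- by split=> // i; rewrite /cnt big_ord0 mulr0 subr0 Q5.
- rewrite runQ /=; have e25 : update (nmem s) 25 0 t 36 (update (nmem s) 25 0 t 25 0) = E t.
    by rewrite update_eq update_neq // P1 // E5.
  rewrite e25 [update _ _ _ _ 23 _]update_neq // P1 // i5 (P2 28%N) // lam5.
  split=> [a l ha|a l ha|i] /=; [by rewrite update_neq ?P1|by rewrite update_neq ?P2|].
  rewrite /cnt big_ord_recr /= -/(cnt t i); case: (eqVneq (E t) i) => [<-|ne].
    by rewrite update_eq P3 /=; ring.
  by rewrite update_off ?P3 1?eq_sym ?ne ?orbT //=; ring.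
rewrite (tab_K T5) in P3 *; set st' := set_counter s 25 K.
set p := path_of st' K it; set wt := qmem st' 28 it.
have pE u : p u = p1 u.
  by rewrite /p /path_of /= update_neq // P1 // s5E /= nmem_run // s3E /= N2.
have wtE : wt = lam by rewrite /wt /= P2.
have vp : valid_path n K p by move=> u lt; rewrite pE; apply: Wp.
have wt0 : 0 <= wt by rewrite wtE /lam divr_ge0.
have good u : (u < K)%N -> any_start n R -> 0 < R (E u) /\ path_cell n K p u = E u.
  move=> lt hs; split; first exact: Wpos (hpos hs) u lt.
  have hK : (K.-1 < K)%N by rewrite prednK.
  have := Wpos (hpos hs) K.-1 hK; rewrite WE // prednK // eqxx => hlast.
  have curE := flow_end K0 Rbal R0 seln (Wp _ hK) Wcur hlast.
  rewrite /E WE // /path_cell !pE W0 /node pE W0; by case: eqP => _; rewrite ?curE ?pE.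
have start : wt != 0 -> any_start n R.
  have [/existsP[a /existsP[b' hp]] _|ns] :=
    boolP [exists a : 'I_n, exists b' : 'I_n, 0 < R (cell n 0 a a b')].
    by exists a, b'.
  move=> wn; case/eqP: wn; rewrite wtE /lam.
  have Rz : forall i, (i < ncell n K)%N -> R i = 0.
    apply: (flow_zero K0 Rbal R0) => a b' ha hb'; apply/eqP; apply: contraT => ne.
    case/existsP: ns; exists (Ordinal ha); apply/existsP; exists (Ordinal hb') => /=.
    by rewrite lt_def ne R0 // cell_lt.
  case: rE => [->|[u lt ->]]; first by rewrite invr0 mulr0.
  by rewrite /h Rz ?Elt // !(invr0, mulr0).
have Rp l : (l < ncell n K)%N -> qmem st' 41 l = R l - wt * chi n K rat p l.
  move=> hl; rewrite /= P3 -wtE; congr (_ - _).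
  have [->|wn] := eqVneq wt 0; first by rewrite !mul0r.
  congr (_ * _); apply: eq_bigr => u _; congr (_ == _)%:R.
  by have [_ ->] := good u (ltn_ord u) (start wn).
split.
- split=> [l lt|e ne|e ne] /=.
  + rewrite update_neq // P1 // s5E /= nmem_run // s3E /= N2 //; exact: WJ.
  + rewrite P2 // s5E /= update_neq // qmem_run // s3E /= update_off ?ne ?orbT //.
    by rewrite Q2.
  + rewrite P2 // s5E /= update_off ?ne ?orbT // qmem_run // s3E /= update_neq //.
    by rewrite Q2.
- by [].
- by move=> l hl; rewrite Rp.
- have [wz|wn] := eqVneq wt 0.
    have R' l : (l < ncell n K)%N -> qmem st' 41 l = R l.
      by move=> hl; rewrite Rp // wz mul0r subr0.
    split; first by move=> l hl; rewrite R' // R0.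
    left=> l hl; rewrite R' //; move: l hl.
    apply: (flow_zero K0 Rbal R0) => a b' ha hb'; apply/eqP; apply: contraT => ne.
    have hs : any_start n R by exists a, b'; split=> //; rewrite lt_def ne R0 // cell_lt.
    have [pos _] := good 0%N K0 hs.
    have : 0 < rho by apply: lt_le_trans (rmax _ K0); rewrite divr_gt0.
    by move=> rp; move/eqP: wz; rewrite wtE /lam gt_eqF // divr_gt0.
  have hs := start wn.
  have rp : 0 < rho.
    by have [pos _] := good 0%N K0 hs; apply: lt_le_trans (rmax _ K0); rewrite divr_gt0.
  have wle u : (u < K)%N -> wt <= R (E u).
    move=> lt; have [pos _] := good u lt hs; have := rmax u lt.
    rewrite wtE /lam /h ler_pdivrMr // ler_pdivrMr // => hh.
    by rewrite mulrC.
  split.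
    move=> l hl; rewrite Rp //.
    have [/hasP[u]|/hasPn hn] := boolP (has (fun u => path_cell n K p u == l) (iota 0 K)).
      rewrite mem_iota => /andP[_ lt] /eqP <-; rewrite add0n in lt.
      rewrite chi_path_cell // mulr1 subr_ge0; have [_ ->] := good u lt hs; exact: wle.
    have -> : chi n K rat p l = 0.
      apply: big1 => u _; have := hn u; rewrite mem_iota add0n ltn_ord => /(_ isT).
      by move=> /negbTE ->.
    by rewrite mulr0 subr0 R0.
  right; case: rE => [E0|[u lt rE]]; first by rewrite E0 ltxx in rp.
  have [pos pc] := good u lt hs.
  exists (E u); split; [exact: Elt|by rewrite gt_eqF|].
  rewrite Rp ?Elt // -pc chi_path_cell // mulr1 pc wtE /lam rE /h !div1r invrK subrr //.
- have g21 : qmem st' 21 it = 1 + \sum_(u < K) qmem st 7 (E u).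
    by rewrite /= P2 // s5E /= update_eq c4.
  rewrite g21; split.
    rewrite ltr_wpDr // sumr_ge0 // => u _; apply: C0; exact: Elt.
  move=> wn; congr (_ + _); apply: eq_bigr => u _.
  by have [_ ->] := good u (ltn_ord u) (start wn).
Qed.

(** * Decomposition, sparsification and output *)

Lemma eq_applyA n K (F : realFieldType) (X Y : nat -> F) r :
  (forall i, (i < ncell n K)%N -> X i = Y i) -> applyA n K X r = applyA n K Y r.
Proof. by move=> h; apply: eq_bigr => i _; rewrite h. Qed.

Lemma eq_balanced n K (F : realFieldType) (X Y : nat -> F) :
  (forall i, (i < ncell n K)%N -> X i = Y i) -> balanced n K X -> balanced n K Y.
Proof. by move=> h hX t a b h1 h2 h3 h4; rewrite -(eq_applyA _ h) hX. Qed.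

Definition nonzeros (N : nat) (R : nat -> rat) : nat := #|[set i : 'I_N | R i != 0]|.

Definition decomp_prg : prg := PSeq (copy 41 24) (PFor 23 13 decomp_round).

Record decomposed (n K : nat) (s : state) (C : nat -> rat) (e : nat) : Prop := Decomposed {
  dec_path : valid_path n K (path_of s K e);
  dec_w : 0 <= qmem s 28 e;
  dec_g : 0 < qmem s 21 e;
  dec_c : qmem s 28 e != 0 ->
    qmem s 21 e = 1 + \sum_(t < K) C (path_cell n K (path_of s K e) t) }.

Lemma decomposed_ext n K s s' C e :
  (forall t, (t < K)%N -> path_of s' K e t = path_of s K e t) -> (0 < K)%N ->
  qmem s' 28 e = qmem s 28 e -> qmem s' 21 e = qmem s 21 e ->
  decomposed n K s C e -> decomposed n K s' C e.
Proof.
move=> hp K0 h1 h2 [d1 d2 d3 d4]; split; rewrite ?h1 ?h2 //.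
  by move=> t lt; rewrite hp // d1.
move=> h; rewrite (d4 h); congr (_ + _); apply: eq_bigr => t _.
rewrite /path_cell !hp // /node; case: (t.+1 =P K) => [_|/eqP ne]; rewrite hp //.
by rewrite ltn_neqAle ne ltn_ord.
Qed.

Lemma eq_chi n K (F : realFieldType) p p' i :
  (0 < K)%N -> (forall t, (t < K)%N -> p t = p' t) -> chi n K F p i = chi n K F p' i.
Proof.
move=> K0 h; apply: eq_bigr => t _; rewrite /path_cell !h // /node.
by case: (t.+1 =P K) => [_|/eqP ne]; rewrite h // ltn_neqAle ne ltn_ord.
Qed.

(** Each round empties a cell for good, hence after as many rounds as there are
    cells nothing is left. *)
Lemma decomp_prgP n d K st : tables n d K st -> (0 < n)%N -> (0 < K)%N ->
  balanced n K (qmem st 24) ->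
  (forall i, (i < ncell n K)%N -> 0 <= qmem st 24 i) ->
  (forall i, (i < ncell n K)%N -> 0 <= qmem st 7 i) ->
  let s := run decomp_prg st in
  (forall e, (e < ncell n K)%N -> decomposed n K s (qmem st 7) e) /\
  (forall i, (i < ncell n K)%N ->
     qmem st 24 i = \sum_(e < ncell n K) qmem s 28 e * chi n K rat (path_of s K e) i).
Proof.
move=> T n0 K0 Xbal X0 C0; rewrite /decomp_prg (runS (copy _ _)); set s0 := run (copy _ _) st.
have T0 : tables n d K s0 by apply: tables_run T.
have R0 i : (i < ncell n K)%N -> qmem s0 41 i = qmem st 24 i.
  by move=> hi; rewrite /s0 (vec_mapP (tab_N T)) ?(tab_1 T).
have C00 i : qmem s0 7 i = qmem st 7 i by rewrite qmem_run.
clearbody s0; set N := ncell n K in X0 C0 R0 *.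
pose P it s := [/\ tables n d K s, forall i, qmem s 7 i = qmem st 7 i,
  balanced n K (qmem s 41) /\ (forall i, (i < N)%N -> 0 <= qmem s 41 i),
  forall e, (e < it)%N -> decomposed n K s (qmem st 7) e &
  (forall i, (i < N)%N -> qmem st 24 i =
     qmem s 41 i + \sum_(e < it) qmem s 28 e * chi n K rat (path_of s K e) i) /\
  ((forall i, (i < N)%N -> qmem s 41 i = 0) \/ (nonzeros N (qmem s 41) + it <= N)%N)].
have [||s [Ts _ _ Hd [Hx Hn]] ->] := @for_run P 23 13 decomp_round s0.
- split=> //.
  + split; first by apply: eq_balanced Xbal => i hi; rewrite R0.
    by move=> i hi; rewrite R0 // X0.
  + split; first by move=> i hi; rewrite big_ord0 addr0 R0.
    by right; rewrite addn0 -[X in (_ <= X)%N]card_ord max_card.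
- move=> it s lt [Ts Cs [Rb Rp] Hd [Hx Hn]].
  set s1 := set_counter s 23 it.
  have T1 : tables n d K s1 by apply: tables_counter Ts.
  have i1 : nmem s1 23 0 = it by rewrite /= update_eq.
  have C1 i : (i < N)%N -> 0 <= qmem s1 7 i by move=> hi; rewrite /= Cs C0.
  have [[J1 W1 G1] [vp w0] RE [R1 Rn] [g0 gE]] := decomp_roundP T1 n0 K0 i1 Rb Rp C1.
  set s2 := run decomp_round s1 in J1 W1 G1 vp w0 RE R1 Rn g0 gE *.
  have p2 e t : (e < it)%N -> (t < K)%N -> path_of s2 K e t = path_of s K e t.
    by move=> he ht; rewrite /path_of J1 ?pos_lt //= update_neq.
  have C2 i : qmem s2 7 i = qmem st 7 i by rewrite /s2 qmem_run ?Cs.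
  have T2 : tables n d K s2 by apply: tables_run T1.
  clearbody s2; split=> //.
  + split=> //; apply: (@eq_balanced n K _ (fun i => qmem s 41 i
      - qmem s2 28 it * chi n K rat (path_of s2 K it) i)).
      by move=> i hi; rewrite RE.
    by apply: balancedB => //; apply: balanced_chi.
  + move=> e; rewrite ltnS leq_eqVlt => /orP[/eqP->|he].
      split=> // h; rewrite gE //; congr (_ + _); apply: eq_bigr => t _; exact: Cs.
    apply: (decomposed_ext _ _ _ _ (Hd e he)) => //.
    * by move=> t ht; apply: p2.
    * by rewrite W1 // (ltn_eqF he).
    * by rewrite G1 // (ltn_eqF he).
  + split.
      move=> i hi; rewrite Hx // RE // big_ord_recr /=.
      have -> : \sum_(e < it) qmem s2 28 e * chi n K rat (path_of s2 K e) i =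
                \sum_(e < it) qmem s 28 e * chi n K rat (path_of s K e) i.
        apply: eq_bigr => e _; rewrite W1 ?(ltn_eqF (ltn_ord e)) //; congr (_ * _).
        by apply: eq_chi => // t ht; apply: p2.
      ring.
    case: Rn => [Z|[i [hi ni zi]]]; [by left|right].
    case: Hn => [Z|Hn]; first by rewrite Z ?eqxx in ni.
    suff : (nonzeros N (qmem s2 41) < nonzeros N (qmem s 41))%N by lia.
    apply: proper_card; apply/properP; split.
      apply/subsetP => j; rewrite !inE; apply: contraNneq => zj.
      have := R1 j (ltn_ord j); rewrite RE //= zj sub0r oppr_ge0 => h.
      rewrite oppr_eq0; apply/eqP/le_anti.
      by rewrite h mulr_ge0 // chi_ge0.
    by exists (Ordinal hi); rewrite inE /= ?zi ?eqxx.
rewrite (tab_N T0) -/N in Hd Hx Hn *; split.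
  by move=> e he; apply: (decomposed_ext _ _ _ _ (Hd e he)).
have Z i : (i < N)%N -> qmem s 41 i = 0.
  case: Hn => [h|h] hi; first exact: h.
  have /eqP : nonzeros N (qmem s 41) = 0%N by lia.
  rewrite cards_eq0 => /eqP E; apply/eqP; apply: contraT => nz.
  by have := in_set0 (Ordinal hi); rewrite -E inE nz.
move=> i hi; rewrite Hx // Z // add0r; apply: eq_bigr => e _; congr (_ * _).
Qed.

(** ** Sparsification *)

(** Purification of the weights of the paths along the directions that keep all
    marginals. *)
Definition carat_prg : prg :=
  PSeq (copy 20 28)
  (PSeq (matQ 10 13 13 (eqe vi vj))
  (PSeq (elim_loop 17 (eqe (NGet 37 (NAdd (NMul vi (var 12)) (div_e (var 22)))) (mod_e (var 22))))
        purify_prg)).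

(** The row [r = t * n + b] counts the paths that visit [b] at time [t]. *)
Definition marg_row (N n : nat) (p : nat -> nat -> nat) (r : nat) : 'cV[rat]_N :=
  \col_e (p e (r %/ n)%N == (r %% n)%N)%:R.

Lemma Kn_le_ncell n K : (0 < n)%N -> (K * n <= ncell n K)%N.
Proof.
by move=> n0; rewrite /ncell -mulnA leq_pmulr // muln_gt0 n0.
Qed.

Lemma carat_prgP n d K st (N := ncell n K) (p := path_of st K) :
  tables n d K st -> (0 < n)%N -> (0 < N)%N ->
  (forall e, (e < N)%N -> 0 <= qmem st 28 e /\ 0 < qmem st 21 e) ->
  let w := vec st 28 N in let z := vec (run carat_prg st) 20 N in
  [/\ forall e, 0 <= z e 0, forall e, w e 0 = 0 -> z e 0 = 0,
      forall r, (r < K * n)%N -> dot (marg_row N n p r) z = dot (marg_row N n p r) w,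
      dot (vec st 21 N) z <= dot (vec st 21 N) w &
      forall v, (forall r, (r < K * n)%N -> dot (marg_row N n p r) v = 0) ->
        (forall e, z e 0 = 0 -> v e 0 = 0) -> v = 0].
Proof.
move=> T n0 N0 hw w z.
have {z} -> : z = vec (run purify_prg (run (elim_loop 17 (eqe (NGet 37 (NAdd (NMul vi (var 12))
     (div_e (var 22)))) (mod_e (var 22)))) (run (matQ 10 13 13 (eqe vi vj)) (run (copy 20 28) st)))) 20 N.
  by rewrite /z /carat_prg (runS (copy _ _)) (runS (matQ _ _ _ _)) (runS (elim_loop _ _)).
set s1 := run (copy _ _) st; set s2 := run (matQ _ _ _ _) s1; set s3 := run (elim_loop _ _) s2.
have T1 : tables n d K s1 by apply: tables_run T.
have T2 : tables n d K s2 by apply: tables_run T1.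
have T3 : tables n d K s3 by apply: tables_run T2.
have z1 : vec s1 20 N = w by rewrite /s1 copyP ?(tab_N T) ?(tab_1 T).
have z3 : vec s3 20 N = w by rewrite /s3 vec_run // /s2 vec_run.
have g3 : vec s3 21 N = vec st 21 N by rewrite /s3 vec_run // /s2 vec_run // /s1 vec_run.
pose one : 'cV[rat]_N := const_mx 1.
have M2 : mat s2 10 N = diag one.
  apply/matrixP => i j; rewrite /s2 mxE (matQE (tab_N T1)) //= eqe_sub /update /= !mxE.
  by rewrite -val_eqE; case: eqP.
have h1 : psd (diag one) by apply: psd_diag => i; rewrite mxE.
have d1 (v : 'cV_N) : diag one *m v = v by apply/colP => i; rewrite diag_mul mxE mul1r.
pose Q := elimn (marg_row N n p) (K * n) (diag one).
have M3 : mat s3 10 N = Q.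
  rewrite /s3 (elim_loopP (N := N) (a := marg_row N n p)) ?(tab_N T2) ?(tab_1 T2) //.
    by rewrite (tab_Kn T2) M2.
  rewrite (tab_Kn T2) => s r i lt [S1 S2] hr.
  have Ts : tables n d K s.
    by apply: (tables_ext _ _ _ T2) => [a ha|j|j]; rewrite S1 //; apply: contraTN ha; rewrite !inE => /or3P[]/eqP->.
  have lr : (r < ncell n K)%N := leq_trans lt (Kn_le_ncell K n0).
  rewrite /= eqe_sub /update /= hr (tab_K Ts) (tab_div Ts) // (tab_mod Ts) // mxE.
  by rewrite /p /path_of S1 // /s2 nmem_run // /s1 nmem_run.
have hQ : psd Q := psd_elimn _ h1 _.
have [|||Z0 Zs [y Zy] Zc Zv] := purify_prgP (erefl N) T3 N0; rewrite ?M3 ?z3 ?g3 //.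
- by move=> e; rewrite mxE; case: (hw e).
- by move=> e _; rewrite mxE; case: (hw e).
rewrite M3 z3 g3 in Zs Zy Zc Zv; split=> //.
- by move=> r lt; rewrite Zy dotDr (elimn_orth _ h1) // addr0.
- move=> v hv hz; have E : Q *m v = v by rewrite (elimn_fix h1) d1 // => i lt; rewrite hv.
  by rewrite -E; apply: Zv => e he; rewrite E hz.
Qed.

(** ** Writing the output *)

Definition output_prg : prg :=
  PSeq (PN 2 c0 c0)
    (PFor 23 13 (PIf (QLe (QGet 20 (var 23)) q0) (PN 2 c0 (var 2))
      (PSeq (PFor 25 12 (PN 3 (NAdd (NMul (var 2) (var 12)) (var 25))
                              (NGet 37 (NAdd (NMul (var 23) (var 12)) (var 25)))))
      (PSeq (PQ 2 (var 2) (QGet 20 (var 23)))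
            (PN 2 c0 (NAdd (var 2) (NConst 1))))))).

Definition support_list (z : nat -> rat) (N : nat) : seq nat :=
  [seq e <- iota 0 N | 0 < z e].

Lemma output_prgP n d K st : tables n d K st ->
  let L := support_list (qmem st 20) (ncell n K) in let s := run output_prg st in
  nmem s 2 0 = size L /\ forall r, (r < size L)%N ->
    (forall t, (t < K)%N -> nmem s 3 (r * K + t)%N = path_of st K (nth 0%N L r) t) /\
    qmem s 2 r = qmem st 20 (nth 0%N L r).
Proof.
move=> T L; rewrite /output_prg runS; set s0 := run (PN 2 c0 c0) st.
have T0 : tables n d K s0 by apply: tables_run T.
pose sl e := support_list (qmem st 20) e.
pose P e s := [/\ forall a i, a \notin [:: 2; 3; 23; 25]%N -> nmem s a i = nmem st a i,
   forall a i, a != 2%N -> qmem s a i = qmem st a i, nmem s 2 0 = size (sl e) &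
   forall r, (r < size (sl e))%N ->
    (forall t, (t < K)%N -> nmem s 3 (r * K + t)%N = path_of st K (nth 0%N (sl e) r) t) /\
    qmem s 2 r = qmem st 20 (nth 0%N (sl e) r)].
set body := PIf _ _ _.
have slS e : sl e.+1 = if 0 < qmem st 20 e then rcons (sl e) e else sl e.
  by rewrite /sl /support_list -[e.+1]addn1 iotaD filter_cat /= add0n; case: ifP; rewrite ?cats0 // cats1.
have [|e s lt [P1 P2 P3 P4]|s [P1 P2 P3 P4] ->] := @for_run P 23 13 body s0; last first.
- rewrite (tab_N T0) in P3 P4 *; split; first by rewrite /= update_neq.
  move=> r lr; have [h1 h2] := P4 r lr; split=> [t ht|]; last by [].
  by rewrite /= update_neq // h1.
- set s1 := set_counter s 23 e.
  have N1 a i : a \notin [:: 2; 3; 23; 25]%N -> nmem s1 a i = nmem st a i.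
    by move=> h; rewrite /= update_neq ?P1 //; apply: contraNneq h => ->.
  have e1 : nmem s1 23 0 = e by rewrite /= update_eq.
  have c1 : nmem s1 2 0 = size (sl e) by rewrite /= update_neq.
  have J1 i : nmem s1 3 i = nmem s 3 i by rewrite /= update_neq.
  have Q1 a i : qmem s1 a i = qmem s a i by [].
  have K1 : nmem s1 12 0 = K by rewrite N1 // (tab_K T).
  rewrite /body runIf; have -> : beval s1 (QLe (QGet 20 (var 23)) q0) = (qmem st 20 e <= 0).
    by rewrite /= update_eq P2.
  clearbody s1; case: lerP => he.
    have slE : sl e.+1 = sl e by rewrite slS ltNge he.
    rewrite runN /= c1; split=> /=; rewrite ?slE ?update_eq //.
    + by move=> a i h; rewrite update_neq ?N1 //; apply: contraNneq h => ->.
    + by move=> a i h; rewrite Q1 P2.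
    + move=> r lr; have [h1 h2] := P4 r lr; split=> [t ht|]; last by rewrite Q1.
      by rewrite update_neq // J1 h1.
  have slE : sl e.+1 = rcons (sl e) e by rewrite slS he.
  rewrite runS (runS (PQ _ _ _)).
  pose W t s' := [/\ forall a i, a \notin [:: 3; 25]%N -> nmem s' a i = nmem s1 a i,
    forall a i, qmem s' a i = qmem s a i,
    forall i, (i < size (sl e) * K)%N -> nmem s' 3 i = nmem s 3 i &
    forall u, (u < t)%N -> nmem s' 3 (size (sl e) * K + u)%N = path_of st K e u].
  set inner := PN 3 _ _.
  have [|t s' ltt [W1 W2 W3 W4]|s2 [W1 W2 W3 W4] ->] := @for_run W 25 12 inner s1.
  + by split.
  + rewrite K1 in ltt; rewrite /inner runN /=.
    have -> : update (nmem s') 25 0 t 2 0 = size (sl e) by rewrite update_neq // W1.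
    have -> : update (nmem s') 25 0 t 12 0 = K by rewrite update_neq // W1.
    have -> : update (nmem s') 25 0 t 23 0 = e by rewrite update_neq // W1.
    rewrite update_eq [update _ 25 _ _ 37 _]update_neq // W1 // N1 //.
    split=> /=.
    * move=> a i; rewrite !inE negb_or => /andP[h1 h2].
      by rewrite update_neq // update_neq // W1 // !inE negb_or h1.
    * exact: W2.
    * move=> i li; rewrite update_off; first by rewrite update_neq // W3.
      by apply/orP; right; lia.
    * move=> u; rewrite ltnS leq_eqVlt => /orP[/eqP->|lu]; first by rewrite update_eq.
      rewrite update_off; first by rewrite update_neq // W4.
      by apply/orP; right; lia.
  + rewrite K1 in W4 *; rewrite runQ runN /=.
    have c2 : update (nmem s2) 25 0 K 2 0 = size (sl e) by rewrite update_neq // W1.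
    have e2 : update (nmem s2) 25 0 K 23 0 = e by rewrite update_neq // W1.
    rewrite c2 e2 W2 P2 //; split=> /=.
    * move=> a i h; rewrite update_neq; last by apply: contraNneq h => ->.
      rewrite update_neq; last by apply: contraNneq h => ->.
      rewrite W1 ?N1 //; move: h; rewrite !inE !negb_or => /and4P[_ -> _ ->]; done.
    * by move=> a i h; rewrite update_neq // W2 P2.
    * by rewrite update_eq slE size_rcons addn1.
    * move=> r; rewrite slE size_rcons ltnS leq_eqVlt => /orP[/eqP rE|lr].
        by rewrite rE nth_rcons ltnn eqxx update_eq; split.
      rewrite nth_rcons lr; have [h1 h2] := P4 r lr; split=> [t ht|].
        rewrite update_neq // update_neq // W3 ?h1 //; exact: pos_lt.
      by rewrite update_off ?W2 ?(ltn_eqF lr) ?orbT.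
- split=> //; rewrite /s0 ?runN //=.
  by move=> a i h; rewrite update_neq //; apply: contraNneq h => ->.
Qed.

(** * Loading the instance *)

(** Programs without branching; those may write sizes, which [wf] forbids. *)
Fixpoint straight (p : prg) : bool :=
  match p with
  | PN _ _ _ | PQ _ _ _ => true
  | PSeq p1 p2 => straight p1 && straight p2
  | _ => false
  end.

Lemma exec_straight p st sz : straight p ->
  exec (compile p) st (time_bound p sz) (run p st).
Proof.
elim: p st => //= [a i e|a i e|p1 IH1 p2 IH2] st.
- by move=> _; rewrite runN; apply: ExecNSet.
- by move=> _; rewrite runQ; apply: ExecQSet.
- by move=> /andP[h1 h2]; rewrite runS; apply: ExecSeq (IH1 _ h1) (IH2 _ h2).
Qed.

Definition sizes_prg : prg :=
  PSeq (PN 10 c0 (NGet 0 (NConst 0))) (PSeq (PN 11 c0 (NGet 0 (NConst 1)))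
  (PSeq (PN 12 c0 (NGet 0 (NConst 2)))
  (PSeq (PN 13 c0 (NMul (NMul (NMul (var 12) (var 10)) (var 10)) (var 10)))
  (PSeq (PN 14 c0 (NAdd (NMul (NMul (NAdd (var 12) (NConst 1)) (var 10)) (var 10))
                     (NMul (var 12) (var 10))))
  (PSeq (PN 15 c0 (NConst 1))
  (PSeq (PN 16 c0 (NMul (NMul (var 12) (var 10)) (var 10)))
  (PSeq (PN 17 c0 (NMul (var 12) (var 10)))
        (PN 18 c0 (NMul (var 10) (var 10)))))))))).

Definition tables_prg : prg := PSeq (matN 30 16 10 vi) (matN 31 16 10 vj).

Definition dist_prg : prg :=
  let dif := QSub (QGet 0 (NAdd (NMul (div_e vi) (var 11)) vj))
                  (QGet 0 (NAdd (NMul (mod_e vi) (var 11)) vj)) in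
  vec_sum 27 18 11 (QMul dif dif).

(** The array 5 receives the product coupling, 8 and 6 its inverse, 7 the costs
    of the cells that carry product mass. The tests for the first and the last
    layer are replaced by multiplication with indicators. *)
Definition load_prg : prg :=
  let t := div_e (div_e (div_e vi)) in let a := mod_e (div_e (div_e vi)) in
  let b := mod_e (div_e vi) in let b' := mod_e vi in
  let t1 := NAdd t (NConst 1) in
  let first := eqe t c0 in let final := eqe t1 (var 12) in
  let mu t b := QGet 1 (NAdd (NMul t (var 10)) b) in
  PSeq (vec_map 5 (QMul (QMul (QGet 1 a)
      (QAdd (QMul first (eqe a b)) (QMul (QSub q1 first) (mu t b))))
      (QAdd (QMul final (eqe a b')) (QMul (QSub q1 final) (mu t1 b')))))
  (PSeq (vec_map 8 (QDiv q1 (QGet 5 vi)))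
  (PSeq (vec_map 7 (QMul (QAdd (QMul final (QGet 27 (NAdd (NMul (NGet 1 b') (var 10)) b)))
        (QMul (QSub q1 final) (QGet 27 (NAdd (NMul b' (var 10)) b))))
      (QDiv (QGet 5 vi) (QGet 5 vi))))
  (PSeq (copy 6 8) (PSeq (PQ 9 c0 q1) (PQ 26 c0 q1))))).

Section Load.
Variables (n d K : nat) (mu pt : nat -> nat -> rat) (sg : nat -> nat) (st0 : state).
Hypotheses (n0 : (0 < n)%N) (K0 : (0 < K)%N).
Hypotheses (in_n : nmem st0 0 0 = n) (in_d : nmem st0 0 1 = d) (in_K : nmem st0 0 2 = K).
Hypothesis in_sg : forall j, (j < n)%N -> nmem st0 1 j = sg j /\ (sg j < n)%N.
Hypothesis in_pt : forall j l, (j < n)%N -> (l < d)%N -> qmem st0 0 (j * d + l)%N = pt j l.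
Hypothesis in_mu : forall t b, (t < K)%N -> (b < n)%N -> qmem st0 1 (t * n + b)%N = mu t b.

Definition sqdist (i j : nat) : rat := \sum_(l < d) (pt i l - pt j l) ^+ 2.

(** The cost is charged to the cell in which the second of the two indices is
    reached; the last cell of a path closes it and carries the [sigma] term. *)
Definition cell_cost (i : nat) : rat :=
  let t := (i %/ n %/ n %/ n)%N in let b := ((i %/ n) %% n)%N in let b' := (i %% n)%N in
  if t.+1 == K then sqdist (sg b') b else sqdist b' b.

Lemma sizes_prgP (s := run sizes_prg st0) :
  [/\ nmem s 10 0 = n, nmem s 11 0 = d, nmem s 12 0 = K, nmem s 13 0 = ncell n K &
   nmem s 14 0 = nrow n K] /\ [/\ nmem s 15 0 = 1%N, nmem s 16 0 = (K * n * n)%N,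
   nmem s 17 0 = (K * n)%N & nmem s 18 0 = (n * n)%N].
Proof.
rewrite /s /sizes_prg !runS.
set s1 := run (PN 10 _ _) _; set s2 := run (PN 11 _ _) _; set s3 := run (PN 12 _ _) _.
set s4 := run (PN 13 _ _) _; set s5 := run (PN 14 _ _) _; set s6 := run (PN 15 _ _) _.
set s7 := run (PN 16 _ _) _; set s8 := run (PN 17 _ _) _; set s9 := run (PN 18 _ _) _.
have a1 : nmem s1 10 0 = n by rewrite /s1 runN /= update_eq.
have a2 : nmem s2 11 0 = d by rewrite /s2 runN /= update_eq /s1; frame.
have a3 : nmem s3 12 0 = K by rewrite /s3 runN /= update_eq /s2 /s1; frame.
have b3 : nmem s3 10 0 = n by rewrite /s3 /s2; frame.
have a4 : nmem s4 13 0 = ncell n K by rewrite /s4 runN /= update_eq a3 b3.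
have c4 : nmem s4 10 0 = n /\ nmem s4 12 0 = K by rewrite /s4; frame.
have a5 : nmem s5 14 0 = nrow n K by rewrite /s5 runN /= update_eq c4.1 c4.2 addn1.
have a6 : nmem s6 15 0 = 1%N by rewrite /s6 runN /= update_eq.
have c6 : nmem s6 10 0 = n /\ nmem s6 12 0 = K by rewrite /s6 /s5; frame.
have a7 : nmem s7 16 0 = (K * n * n)%N by rewrite /s7 runN /= update_eq c6.1 c6.2.
have c7 : nmem s7 10 0 = n /\ nmem s7 12 0 = K by rewrite /s7; frame.
have a8 : nmem s8 17 0 = (K * n)%N by rewrite /s8 runN /= update_eq c7.1 c7.2.
have c8 : nmem s8 10 0 = n /\ nmem s8 12 0 = K by rewrite /s8; frame.
have a9 : nmem s9 18 0 = (n * n)%N by rewrite /s9 runN /= update_eq c8.1.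
split; split; last exact: a9.
- by rewrite /s9; frame; exact: c8.1.
- by rewrite -a2 /s9 /s8 /s7 /s6 /s5 /s4 /s3; frame.
- by rewrite /s9; frame; exact: c8.2.
- by rewrite -a4 /s9 /s8 /s7 /s6 /s5; frame.
- by rewrite -a5 /s9 /s8 /s7 /s6; frame.
- by rewrite /s9 /s8 /s7; frame; exact: a6.
- by rewrite -a7 /s9 /s8; frame.
- by rewrite -a8 /s9; frame.
Qed.

Lemma tables_prgP : tables n d K (run tables_prg (run sizes_prg st0)).
Proof.
have := sizes_prgP; set s := run sizes_prg st0 => E.
clearbody s; move: E => [[h10 h11 h12 h13 h14] [h15 h16 h17 h18]].
rewrite /tables_prg runS; set s1 := run (matN 30 _ _ _) s.
have D30 i : (i < ncell n K)%N -> nmem s1 30 i = (i %/ n)%N.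
  move=> hi; have h1 : (i %/ n < nmem s 16 0)%N by rewrite h16 ltn_divLR.
  have h2 : (i %% n < nmem s 10 0)%N by rewrite h10 ltn_mod.
  have := @matNP 30 16 10 vi s (i %/ n) (i %% n) isT isT isT isT _ h1 h2.
  rewrite -/s1 h10 -divn_eq => -> //.
  by move=> u u' h /=; rewrite h.
have N1 a l : a \in [:: 10; 11; 12; 13; 14; 15; 16; 17; 18]%N -> nmem s1 a l = nmem s a l.
  by rewrite !inE; do 8![case/orP=> [/eqP->|]; [by rewrite /s1; frame|]]; move/eqP->; rewrite /s1; frame.
have D31 i : (i < ncell n K)%N -> nmem (run (matN 31 16 10 vj) s1) 31 i = (i %% n)%N.
  move=> hi; have h1 : (i %/ n < nmem s1 16 0)%N by rewrite N1 // h16 ltn_divLR.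
  have h2 : (i %% n < nmem s1 10 0)%N by rewrite N1 // h10 ltn_mod.
  have := @matNP 31 16 10 vj s1 (i %/ n) (i %% n) isT isT isT isT _ h1 h2.
  rewrite (N1 10%N) // h10 -divn_eq => -> //.
  by move=> u u' h /=; rewrite h.
split=> //; frame; rewrite ?N1 //.
by move=> i hi; frame; rewrite D30.
Qed.

Let st1 := run tables_prg (run sizes_prg st0).

Lemma dist_prgP i j : (i < n)%N -> (j < n)%N ->
  qmem (run dist_prg st1) 27 (i * n + j)%N = sqdist i j.
Proof.
move=> hi hj; have T : tables n d K st1 := tables_prgP.
have lt : (i * n + j < n * n)%N := pos_lt hi hj.
rewrite /dist_prg vec_sumP ?(tab_nn T) // (tab_d T); apply: eq_bigr => l _.
have lt' : (i * n + j < ncell n K)%N := leq_trans lt (nn_le_ncell n0 K0).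
rewrite /= /update /= (tab_d T) (tab_div T) // (tab_mod T) //.
rewrite divnMDl // divn_small // addn0 modnMDl modn_small // expr2.
by rewrite /st1; frame; rewrite !in_pt.
Qed.

Lemma load_prgP (st := run load_prg (run dist_prg st1)) :
  [/\ tables n d K st,
      forall i, (i < ncell n K)%N -> qmem st 5 i = product_flow n K mu i,
      forall i, (i < ncell n K)%N -> qmem st 8 i = 1 / product_flow n K mu i,
      forall i, (i < ncell n K)%N -> qmem st 7 i =
        cell_cost i * (product_flow n K mu i / product_flow n K mu i) &
      [/\ forall i, (i < ncell n K)%N -> qmem st 6 i = 1 / product_flow n K mu i,
          qmem st 9 0 = 1 & qmem st 26 0 = 1]].
Proof.
have T1 : tables n d K st1 := tables_prgP.
have dE := dist_prgP.
have T2 : tables n d K (run dist_prg st1) by apply: tables_run T1.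
have M2 i : qmem (run dist_prg st1) 1 i = qmem st0 1 i by rewrite /st1; frame.
have S2 i : nmem (run dist_prg st1) 1 i = nmem st0 1 i by rewrite /st1; frame.
rewrite /st /load_prg (runS (vec_map 5 _)) (runS (vec_map 8 _)) (runS (vec_map 7 _)).
rewrite (runS (copy 6 8)) (runS (PQ 9 _ _)).
move: (run dist_prg st1) T2 M2 S2 dE => s2 T2 M2 S2 dE.
set s3 := run (vec_map 5 _) s2; set s4 := run (vec_map 8 _) s3.
set s5 := run (vec_map 7 _) s4; set s6 := run (copy 6 8) s5.
set s7 := run (PQ 9 c0 q1) s6; set s8 := run (PQ 26 c0 q1) s7.
have T3 : tables n d K s3 by apply: tables_run T2.
have T4 : tables n d K s4 by apply: tables_run T3.
have T5 : tables n d K s5 by apply: tables_run T4.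
have T6 : tables n d K s6 by apply: tables_run T5.
have T7 : tables n d K s7 by apply: tables_run T6.
have T8 : tables n d K s8 by apply: tables_run T7.
have dm i : (i < ncell n K)%N -> [/\ (i %/ n < ncell n K)%N, (i %/ n %/ n < ncell n K)%N,
    (i %/ n %/ n %/ n < K)%N & [/\ (i %/ n %/ n %% n < n)%N, (i %/ n %% n < n)%N & (i %% n < n)%N]].
  move=> hi; have h1 : (i %/ n < ncell n K)%N := leq_ltn_trans (leq_div _ _) hi.
  have h2 : (i %/ n %/ n < ncell n K)%N := leq_ltn_trans (leq_div _ _) h1.
  by rewrite h1 h2 !ltn_mod n0; split=> //; rewrite -!divnMA ltn_divLR ?muln_gt0 ?n0 // !mulnA.
have X3 i : (i < ncell n K)%N -> qmem s3 5 i = product_flow n K mu i.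
  move=> hi; have [h1 h2 h3 [ha hb hb']] := dm i hi.
  rewrite /s3 (vec_mapP (tab_N T2)) ?(tab_1 T2) //= /update /= !eqe_sub.
  rewrite !(tab_div T2) // !(tab_mod T2) // (tab_n T2) (tab_K T2) !M2 addn1.
  rewrite /product_flow /cond_marg (ltn_eqF h3) orbF /=.
  set t := (i %/ n %/ n %/ n)%N in h3 *; set a := (i %/ n %/ n %% n)%N in ha *.
  have -> : qmem st0 1 a = mu 0%N a by rewrite -in_mu // mul0n.
  rewrite in_mu //; congr (_ * _ * _).
    by case: eqP => _; rewrite ?mul1r ?mul0r ?subrr ?subr0 ?mul0r ?mul1r ?addr0 ?add0r.
  case: eqP => [_|/eqP ne].
    by rewrite mul1r subrr mul0r addr0.
  by rewrite mul0r subr0 mul1r add0r in_mu // ltn_neqAle ne.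
have X4 i : qmem s4 5 i = qmem s3 5 i by rewrite /s4; frame.
have I4 i : (i < ncell n K)%N -> qmem s4 8 i = 1 / product_flow n K mu i.
  by move=> hi; rewrite /s4 (vec_mapP (tab_N T3)) ?(tab_1 T3) //= /update /= X3.
have C5 i : (i < ncell n K)%N -> qmem s5 7 i =
    cell_cost i * (product_flow n K mu i / product_flow n K mu i).
  move=> hi; have [h1 h2 h3 [ha hb hb']] := dm i hi.
  rewrite /s5 (vec_mapP (tab_N T4)) ?(tab_1 T4) //= /update /= !eqe_sub X4 X3 //.
  rewrite !(tab_div T4) // !(tab_mod T4) // (tab_n T4) (tab_K T4) addn1.
  have D4 p : qmem s4 27 p = qmem s2 27 p by rewrite /s4 /s3; frame.
  have S4 p : nmem s4 1 p = nmem st0 1 p by rewrite -S2 /s4 /s3; frame.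
  have [sE slt] := in_sg hb'.
  rewrite !D4 S4 sE !dE // /cell_cost; congr (_ * _).
  by case: eqP => _; rewrite ?mul1r ?mul0r ?subrr ?subr0 ?mul0r ?mul1r ?addr0 ?add0r.
split=> //.
- by move=> i hi; rewrite -X3 // -X4 /s8 /s7 /s6 /s5; frame.
- by move=> i hi; rewrite -I4 // /s8 /s7 /s6 /s5; frame.
- by move=> i hi; rewrite -C5 // /s8 /s7 /s6; frame.
- split.
  + move=> i hi; rewrite -I4 // /s8 /s7; frame.
    by rewrite /s6 (vec_mapP (tab_N T5)) ?(tab_1 T5) //= /update /= /s5; frame.
  + by rewrite /s8; frame; rewrite /s7 runQ /= update_eq.
  + by rewrite /s8 runQ /= update_eq.
Qed.

End Load.

(** * Duality, paths and tensors *)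

(** ** Weak duality on the polynomial-size program *)

Section Duality.
Variables (n K : nat) (S : {set 'I_(ncell n K)}).
Local Notation N := (ncell n K).
Variables (x0 c x s : 'cV[rat]_N).
Hypothesis cert : certificate S c x0 x s.
Hypothesis cS : forall i, i \notin S -> c i 0 = 0.

Lemma dual_multipliers : exists y : 'I_(nrow n K) -> rat, forall i : 'I_N, i \in S ->
  c i 0 = s i 0 - \sum_r y r * coef n K rat r i.
Proof.
have h2 i : i \notin S -> (s - c) i 0 = 0.
  by move=> iS; rewrite col_subE (cert_sS cert iS) (cS iS) subr0.
have /submxP[y Ey] := orth_rowspace (cert_dual cert) h2.
exists (y 0) => i iS.
have := congr1 (fun M : 'rV_N => M 0 i) Ey; rewrite [LHS]mxE col_subE [RHS]mxE => E.
rewrite -[LHS]opprK -[s i 0](addrNK (c i 0)) E addrAC.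
have -> : \sum_j y 0 j * (\matrix_(r, i') (arow n K r i' 0 *+ (i' \in S))) j i =
   \sum_r y 0 r * coef n K rat r i.
  by apply: eq_bigr => r _; rewrite !mxE iS.
by rewrite subrr add0r opprK.
Qed.

(** The field of [X] may be larger than that of the data, so as to compare with
    real tensors. *)
Lemma dual_value (F : realFieldType) (f : {rmorphism rat -> F}) (y : 'I_(nrow n K) -> rat)
    (X : nat -> F) :
  (forall i : 'I_N, i \in S -> c i 0 = s i 0 - \sum_r y r * coef n K rat r i) ->
  (forall i : 'I_N, i \notin S -> X i = 0) ->
  \sum_(i < N) f (c i 0) * X i =
  \sum_(i < N) f (s i 0) * X i - \sum_r f (y r) * applyA n K X r.
Proof.
move=> hy hX.
have -> : \sum_r f (y r) * applyA n K X r =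
   \sum_(i < N) (\sum_(r < nrow n K) f (y r) * coef n K F r i) * X i.
  under [RHS]eq_bigr do rewrite mulr_suml.
  rewrite [RHS]exchange_big /=; apply: eq_bigr => r _; rewrite mulr_sumr.
  by apply: eq_bigr => i _; rewrite mulrA.
rewrite -sumrB; apply: eq_bigr => i _.
have [iS|/hX ->] := boolP (i \in S); last by rewrite !mulr0 subrr.
rewrite (hy i iS) -mulrBl rmorphB rmorph_sum; congr ((_ - _) * _).
apply: eq_bigr => r _; rewrite rmorphM; congr (_ * _).
by rewrite /coef rmorphD rmorphB !rmorph_nat.
Qed.

End Duality.

(** ** From paths to tensors *)

Section Paths.
Variables (n k : nat).
Local Notation K := k.+1.

Definition path_fun (j : multi_index n K) (t : nat) : nat := j (inord t).

Lemma path_fun_valid j : valid_path n K (path_fun j).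
Proof. by move=> t _; apply: ltn_ord. Qed.

Definition index_of (n0 : (0 < n)%N) (p : nat -> nat) : multi_index n K :=
  [ffun t : 'I_K => insubd (Ordinal n0) (p t)].

Lemma index_ofE (n0 : (0 < n)%N) p t : valid_path n K p -> (t < K)%N ->
  path_fun (index_of n0 p) t = p t.
Proof. by move=> hp ht; rewrite /path_fun ffunE val_insubd inordK // hp. Qed.

Lemma index_of_coord (n0 : (0 < n)%N) p (t : 'I_K) : valid_path n K p ->
  index_of n0 p t = p t :> nat.
Proof. by move=> hp; rewrite ffunE val_insubd hp. Qed.

Section Real.
Variables (R : realType) (d : nat) (x : 'I_n -> 'rV[rat]_d) (s : 'I_n -> 'I_n).
Variable sigma : {perm point_set (real_vectors R x)}.
Hypothesis hs : encodes sigma s.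

Definition coords (j l : nat) : rat :=
  if insub j is Some j' then if insub l is Some l' then x j' 0 l' else 0 else 0.

Definition sigma_index (j : nat) : nat := if insub j is Some j' then s j' else 0%N.

Lemma coordsE (j : 'I_n) (l : 'I_d) : coords j l = x j 0 l.
Proof. by rewrite /coords !valK. Qed.

Lemma enorm_sqdist (i j : 'I_n) :
  enorm (real_vectors R x i - real_vectors R x j) ^+ 2 = ratr (sqdist d coords i j).
Proof.
rewrite /enorm sqr_sqrtr; last by apply: sumr_ge0 => l _; apply: sqr_ge0.
rewrite rmorph_sum; apply: eq_bigr => l _.
by rewrite !mxE !coordsE rmorphXn rmorphB.
Qed.

(** The last cell of the path leads back to its start; this is the cell that
    carries the [sigma] term. *)
Lemma euler_cost_cells (j : multi_index n K) :
  euler_cost sigma j = ratr (\sum_(t < K)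
    cell_cost n d K coords sigma_index (path_cell n K (path_fun j) t)).
Proof.
have p0 t : (path_fun j t < n)%N by apply: ltn_ord.
have hn t : (node K (path_fun j) t < n)%N by rewrite /node; case: eqP.
rewrite /euler_cost big_ord_recr /= rmorphD addrC rmorph_sum; congr (_ + _).
  apply: eq_bigr => t _; rewrite enorm_sqdist /cell_cost /path_cell.
  have [_ -> _ -> [-> _]] := cell_divmod t (p0 0%N) (p0 t) (hn t.+1).
  have tk : (t.+1 == K) = false by rewrite eqSS ltn_eqF.
  rewrite tk /node tk /path_fun; congr (ratr (sqdist _ _ _ _)); congr (nat_of_ord (j _)); apply/val_inj.
    by rewrite /= /bump /= inordK // ltnS.
  by rewrite /= inordK // ltnW // ltnS.
rewrite hs enorm_sqdist /cell_cost /path_cell.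
have [_ -> _ -> [-> _]] := cell_divmod k (p0 0%N) (p0 k) (hn k.+1).
rewrite eqxx /node eqxx /path_fun; congr (ratr (sqdist _ _ _ _)).
  have -> : inord 0 = ord0 :> 'I_K by apply/val_inj; rewrite /= inordK.
  by rewrite /sigma_index valK.
by congr (nat_of_ord (j _)); apply/val_inj; rewrite /= inordK.
Qed.

End Real.
End Paths.

(** * The sparse tensor is optimal *)

Section Final.
Variables (R : realType) (n d k : nat) (x : 'I_n -> 'rV[rat]_d).
Variables (sigma : {perm point_set (real_vectors R x)}) (s : 'I_n -> 'I_n).
Variable mu : 'I_k.+1 -> 'rV[rat]_n.
Hypotheses (n0 : (0 < n)%N) (hs : encodes sigma s).
Hypothesis hmu : forall i, in_simplex (real_vectors R mu i).
Local Notation K := k.+1.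
Local Notation N := (ncell n K).

Definition marg_fun (t b : nat) : rat :=
  if insub b is Some b' then mu (inord t) 0 b' else 0.

Lemma marg_funE (i : 'I_K) (b : 'I_n) : marg_fun i b = mu i 0 b.
Proof. by rewrite /marg_fun valK inord_val. Qed.

Lemma marg_fun_ge0 t b : 0 <= marg_fun t b.
Proof.
rewrite /marg_fun; case: insubP => // b' _ _.
by have [/(_ b') h _] := hmu (inord t); move: h; rewrite mxE ler0q.
Qed.

Lemma marg_fun_sum t : (t < K)%N -> \sum_(b < n) marg_fun t b = 1.
Proof.
move=> ht; have [_ h] := hmu (Ordinal ht); apply: (fmorph_inj (ratr : rat -> R)).
rewrite rmorph1 -h rmorph_sum; apply: eq_bigr => b _.
by rewrite mxE -marg_funE.
Qed.

Lemma marg_fun_le1 t b : (t < K)%N -> (b < n)%N -> marg_fun t b <= 1.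
Proof.
move=> ht hb; rewrite -(marg_fun_sum ht) (bigD1 (Ordinal hb)) //= lerDl.
by apply: sumr_ge0 => i _; apply: marg_fun_ge0.
Qed.

Definition flow0 : 'cV[rat]_N := \col_i product_flow n K marg_fun i.
Definition live : {set 'I_N} := [set i | flow0 i 0 != 0].
Definition raw_cost (i : nat) : rat := cell_cost n d K (coords x) (sigma_index s) i.
(** The quotient is 1 on the live cells and 0 elsewhere. *)
Definition live_cost : 'cV[rat]_N := \col_i (raw_cost i * (flow0 i 0 / flow0 i 0)).

Lemma raw_cost_ge0 i : 0 <= raw_cost i.
Proof.
by rewrite /raw_cost /cell_cost; case: ifP => _; apply: sumr_ge0 => l _; apply: sqr_ge0.
Qed.

Lemma live_costE i : i \in live -> live_cost i 0 = raw_cost i.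
Proof. by rewrite inE => h; rewrite [live_cost _ _]mxE divff // mulr1. Qed.

Lemma live_cost_notin i : i \notin live -> live_cost i 0 = 0.
Proof. by rewrite inE negbK => /eqP h; rewrite [live_cost _ _]mxE h mul0r mulr0. Qed.

(** The mass of a cell on a path is a product of masses of nodes of this path. *)
Lemma live_path (p : nat -> nat) t (ht : (t < K)%N) (hp : valid_path n K p) :
  (forall u, (u < K)%N -> marg_fun u (p u) != 0) ->
  Ordinal (path_cell_lt (ltn0Sn k) hp ht) \in live.
Proof.
move=> h; rewrite inE mxE /= /path_cell /product_flow.
have hn : (node K p t.+1 < n)%N := node_lt (ltn0Sn k) hp ht.
have [_ -> _ -> [-> ->]] := cell_divmod t (hp 0%N (ltn0Sn k)) (hp t ht) hn.
rewrite mulf_eq0 mulf_eq0 !negb_or h //=; apply/andP; split.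
  rewrite /cond_marg (ltn_eqF ht) orbF.
  by case: (t =P 0%N) => [->|_]; rewrite ?eqxx ?oner_eq0 // h.
rewrite /cond_marg /node /=; case: (t.+1 =P K) => [_|/eqP ne].
  by rewrite eqxx oner_eq0.
by rewrite h // ltn_neqAle ne.
Qed.

Lemma chi_off (F : realFieldType) (p : nat -> nat) (hp : valid_path n K p) (i : 'I_N) :
  (forall t (ht : (t < K)%N), Ordinal (path_cell_lt (ltn0Sn k) hp ht) \in live) ->
  i \notin live -> chi n K F p i = 0.
Proof.
move=> h iL; apply: big1 => t _; case: eqP => // E; have := h t (ltn_ord t).
by rewrite (_ : Ordinal _ = i) ?(negbTE iL) //; apply/val_inj.
Qed.

Variables (xv sv : 'cV[rat]_N) (wt z G : nat -> rat) (p : nat -> nat -> nat).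
Hypothesis cert : certificate live live_cost flow0 xv sv.
Hypothesis gap0 : dot xv sv = 0.
Hypothesis hp : forall e, (e < N)%N -> valid_path n K (p e).
Hypothesis wt0 : forall e, (e < N)%N -> 0 <= wt e.
Hypothesis hx : forall i : 'I_N, xv i 0 = \sum_(e < N) wt e * chi n K rat (p e) i.
Hypothesis z0 : forall e, (e < N)%N -> 0 <= z e.
Hypothesis zw : forall e, (e < N)%N -> wt e = 0 -> z e = 0.
Hypothesis zmarg : forall t b, (t < K)%N -> (b < n)%N ->
  \sum_(e < N) z e * (p e t == b)%:R = \sum_(e < N) wt e * (p e t == b)%:R.
Hypothesis hG : forall (e : 'I_N), wt e != 0 ->
  G e = 1 + \sum_(t < K) live_cost (insubd e (path_cell n K (p e) t)) 0.
Hypothesis zcost : \sum_(e < N) z e * G e <= \sum_(e < N) wt e * G e.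
Hypothesis zvert : forall v : 'cV[rat]_N,
  (forall t b, (t < K)%N -> (b < n)%N -> \sum_(e < N) v e 0 * (p e t == b)%:R = 0) ->
  (forall e : 'I_N, z e = 0 -> v e 0 = 0) -> v = 0.

Definition answer : sparse_tensor n K :=
  [seq (index_of k n0 (p e), z e) | e <- support_list z N].

Lemma sum_answer (H : multi_index n K -> R) :
  \sum_(j : multi_index n K) tensor_of R answer j * H j =
  \sum_(e < N) ratr (z e) * H (index_of k n0 (p e)).
Proof.
transitivity (\sum_(e <- answer) ratr e.2 * H e.1).
  rewrite /tensor_of; under eq_bigr do rewrite mulr_suml.
  rewrite (exchange_big_dep xpredT) //=; apply: eq_bigr => e _.
  by rewrite (big_pred1 e.1) // => j; rewrite /= eq_sym.
rewrite /answer big_map big_filter /=.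
have -> : iota 0 N = index_iota 0 N by rewrite /index_iota subn0.
rewrite big_mkcond big_mkord; apply: eq_bigr => e _; case: ltrP => //.
move=> h; have -> : z e = 0 by apply/le_anti; rewrite h z0.
by rewrite rmorph0 mul0r.
Qed.

Lemma applyA_x (r : nat) : (r < nrow n K)%N ->
  \sum_(e < N) wt e * applyA n K (chi n K rat (p e)) r = rhs n K marg_fun r.
Proof.
move=> hr; rewrite -(applyA_product (mu := marg_fun) r (ltn0Sn k)); last exact: marg_fun_sum.
have := cert_Ax cert hr.
have -> : dot (arow n K r) flow0 = applyA n K (product_flow n K marg_fun) r.
  by apply: eq_bigr => i _; rewrite !mxE.
move=> <-; rewrite /dot /applyA; under eq_bigr do rewrite mulr_sumr.
rewrite exchange_big /=; apply: eq_bigr => i _; rewrite hx !mxE mulr_sumr.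
by apply: eq_bigr => e _; rewrite mulrCA.
Qed.

Lemma wt_marg t b : (t < K)%N -> (b < n)%N ->
  \sum_(e < N) wt e * (p e t == b)%:R = marg_fun t b.
Proof.
move=> ht hb; have hr : (row_marg n K t b < nrow n K)%N by rewrite ltn_add2l pos_lt.
rewrite -(rhs_marg marg_fun ht hb) -applyA_x //; apply: eq_bigr => e _.
by rewrite applyA_chi_marg //; apply: hp.
Qed.

Lemma z_marg t b : (t < K)%N -> (b < n)%N ->
  \sum_(e < N) z e * (p e t == b)%:R = marg_fun t b.
Proof. by move=> ht hb; rewrite zmarg // wt_marg. Qed.

Lemma mass1 (f : nat -> rat) :
  (forall b, (b < n)%N -> \sum_(e < N) f e * (p e 0%N == b)%:R = marg_fun 0 b) ->
  \sum_(e < N) f e = 1.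
Proof.
move=> h; rewrite -(marg_fun_sum (ltn0Sn k)).
transitivity (\sum_(b < n) \sum_(e < N) f e * (p e 0%N == b :> nat)%:R); last first.
  by apply: eq_bigr => b _; rewrite h.
rewrite exchange_big /=; apply: eq_bigr => e _.
by rewrite (sum_pick n (fun=> f e) (p e 0%N)) hp.
Qed.

Lemma answer_feasible : feasible (real_vectors R mu) (tensor_of R answer).
Proof.
split=> [j|i].
  rewrite /tensor_of big_seq_cond; apply: sumr_ge0 => e /andP[he _].
  move: he => /mapP[e0]; rewrite mem_filter mem_iota => /andP[h _] -> /=.
  by rewrite ler0q ltW.
apply/rowP => a; rewrite !mxE big_mkcond /=.
transitivity (\sum_(j : multi_index n K) tensor_of R answer j * (j i == a)%:R).
  by apply: eq_bigr => j _; case: eqP => _; rewrite ?mulr1 ?mulr0.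
rewrite sum_answer -marg_funE -(z_marg (ltn_ord i) (ltn_ord a)) rmorph_sum.
apply: eq_bigr => e _; rewrite rmorphM rmorph_nat -val_eqE /=.
by rewrite index_of_coord //; apply: hp.
Qed.

(** A path of positive weight puts flow on all its cells, and the solution has
    none outside the live ones. *)
Lemma path_live (e : 'I_N) t (ht : (t < K)%N) : wt e != 0 ->
  Ordinal (path_cell_lt (ltn0Sn k) (hp (ltn_ord e)) ht) \in live.
Proof.
move=> we; set i := Ordinal _; apply: contraT => /(cert_xS cert) /eqP.
rewrite hx psumr_eq0 => [/allP/(_ e (mem_index_enum _))|e' _]; last first.
  by rewrite mulr_ge0 ?wt0 // chi_ge0.
by rewrite /= (chi_path_cell _ (hp (ltn_ord e)) ht) mulr1 (negbTE we).
Qed.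

Lemma cost_path (e : 'I_N) : wt e != 0 ->
  G e = 1 + \sum_(t < K) raw_cost (path_cell n K (p e) t).
Proof.
move=> we; rewrite hG //; congr (_ + _); apply: eq_bigr => t _.
have lt := path_cell_lt (ltn0Sn k) (hp (ltn_ord e)) (ltn_ord t).
have -> : insubd e (path_cell n K (p e) t) = Ordinal lt.
  by apply/val_inj; rewrite val_insubd lt.
rewrite live_costE //; have := path_live (ltn_ord t) we.
by rewrite (_ : Ordinal _ = Ordinal lt) //; apply/val_inj.
Qed.

(** The weights before and after sparsification have total mass 1, so that
    adding 1 to the cost of every path does not affect the comparison. *)
Lemma answer_cost :
  inner (tensor_of R answer) (euler_cost sigma) <=
  ratr (\sum_(i < N) live_cost i 0 * xv i 0).
Proof.
rewrite /inner sum_answer.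
have -> : \sum_(e < N) ratr (z e) * euler_cost sigma (index_of k n0 (p e)) =
   ratr (\sum_(e < N) z e * \sum_(t < K) raw_cost (path_cell n K (p e) t)) :> R.
  rewrite rmorph_sum; apply: eq_bigr => e _; rewrite (euler_cost_cells hs) rmorphM.
  congr (_ * ratr _); apply: eq_bigr => t _; congr (cell_cost _ _ _ _ _ _).
  have hpe := hp (ltn_ord e).
  rewrite /path_cell !index_ofE // /node; case: (t.+1 =P K) => [_|/eqP ne].
    by rewrite index_ofE.
  by rewrite index_ofE // ltn_neqAle ne ltn_ord.
rewrite ler_rat.
have E f : (forall e, (e < N)%N -> wt e = 0 -> f e = 0) -> \sum_(e < N) f e = 1 ->
    \sum_(e < N) f e * G e =
    1 + \sum_(e < N) f e * \sum_(t < K) raw_cost (path_cell n K (p e) t).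
  move=> hf f1; rewrite -{1}f1 -big_split /=; apply: eq_bigr => e _.
  have [w0|we] := eqVneq (wt e) 0; first by rewrite hf // !mul0r addr0.
  by rewrite cost_path // mulrDr mulr1.
have Ez := E z zw (mass1 (fun b hb => z_marg (ltn0Sn k) hb)).
have Ew := E wt (fun e _ h => h) (mass1 (fun b hb => wt_marg (ltn0Sn k) hb)).
have : \sum_(e < N) z e * \sum_(t < K) raw_cost (path_cell n K (p e) t) <=
   \sum_(e < N) wt e * \sum_(t < K) raw_cost (path_cell n K (p e) t).
  by rewrite -(lerD2l 1) -Ez -Ew.
move=> /le_trans; apply; rewrite le_eqVlt; apply/orP; left; apply/eqP.
under [RHS]eq_bigr do rewrite hx mulr_sumr.
rewrite [RHS]exchange_big /=; apply: eq_bigr => e _.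
have [->|we] := eqVneq (wt e) 0.
  by rewrite mul0r big1 // => i _; rewrite mul0r mulr0.
under [RHS]eq_bigr do rewrite mulrCA.
rewrite -mulr_sumr; congr (_ * _); rewrite -(sum_chi (ltn0Sn k) (hp (ltn_ord e)) raw_cost).
apply: eq_bigr => i _.
have [iL|iL] := boolP (i \in live); first by rewrite live_costE.
by rewrite live_cost_notin // mul0r (chi_off _ (fun t ht => path_live ht we) iL) mulr0.
Qed.

(** Weak duality: the flow of [Q] satisfies the same equations as the flow
    [xv], so the multipliers contribute the same to both, while the slack
    contributes nothing to [xv] and a non-negative amount to [Q]. *)
Lemma lower_bound (Q : tensor R n K) : feasible (real_vectors R mu) Q ->
  ratr (\sum_(i < N) live_cost i 0 * xv i 0) <= inner Q (euler_cost sigma).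
Proof.
move=> [Q0 Qm].
pose X (i : nat) : R := \sum_(j : multi_index n K) Q j * chi n K R (path_fun j) i.
have Qmarg t b : (t < K)%N -> (b < n)%N ->
    \sum_(j : multi_index n K | path_fun j t == b) Q j = ratr (marg_fun t b).
  move=> ht hb; have /rowP/(_ (Ordinal hb)) := Qm (Ordinal ht).
  rewrite !mxE -marg_funE /= => <-; apply: eq_bigl => j.
  rewrite -val_eqE /path_fun /=; congr (nat_of_ord (j _) == _).
  by apply/val_inj; rewrite /= inordK.
have dead j : Q j != 0 -> forall u, (u < K)%N -> marg_fun u (path_fun j u) != 0.
  move=> Qj u hu; apply: contraNneq Qj => m0.
  have := Qmarg u _ hu (path_fun_valid j hu); rewrite m0 rmorph0 => /eqP.
  rewrite psumr_eq0 => [/allP/(_ j (mem_index_enum _))|j' _]; last exact: Q0.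
  by rewrite eqxx.
have on_live j (Qj : Q j != 0) t (ht : (t < K)%N) :
  Ordinal (path_cell_lt (ltn0Sn k) (path_fun_valid j) ht) \in live.
  exact: live_path (dead j Qj).
have Xoff (i : 'I_N) : i \notin live -> X i = 0.
  move=> iL; apply: big1 => j _; have [->|Qj] := eqVneq (Q j) 0; first by rewrite mul0r.
  by rewrite (chi_off _ (on_live j Qj) iL) mulr0.
have [y hy] := dual_multipliers cert live_cost_notin.
have -> : inner Q (euler_cost sigma) = \sum_(i < N) ratr (live_cost i 0) * X i.
  rewrite /inner /X; under [RHS]eq_bigr do rewrite mulr_sumr.
  rewrite [RHS]exchange_big /=; apply: eq_bigr => j _.
  under [RHS]eq_bigr do rewrite mulrCA.
  rewrite -mulr_sumr; have [->|Qj] := eqVneq (Q j) 0; first by rewrite !mul0r.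
  congr (_ * _); rewrite (euler_cost_cells hs) rmorph_sum.
  rewrite -(sum_chi (ltn0Sn k) (path_fun_valid j) (fun i => ratr (raw_cost i) : R)).
  apply: eq_bigr => i _.
  have [iL|iL] := boolP (i \in live); first by rewrite live_costE.
  by rewrite live_cost_notin // rmorph0 mul0r (chi_off _ (on_live j Qj) iL) mulr0.
rewrite (dual_value (ratr : {rmorphism rat -> R}) hy Xoff).
pose xf i := if insub i is Some i' then xv i' 0 else 0.
have xfE (i : 'I_N) : xf i = xv i 0 by rewrite /xf valK.
have -> : \sum_(i < N) live_cost i 0 * xv i 0 = \sum_(i < N) idfun (live_cost i 0) * xf i.
  by apply: eq_bigr => i _; rewrite xfE.
rewrite (dual_value (idfun : {rmorphism rat -> rat}) hy) => [|i iL]; last by rewrite xfE (cert_xS cert).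
have -> : \sum_(i < N) idfun (sv i 0) * xf i = 0.
  by rewrite -[RHS]gap0 [RHS]dotC; apply: eq_bigr => i _; rewrite xfE.
rewrite sub0r rmorphN rmorph_sum lerBrDr.
have -> : \sum_r ratr (idfun (y r) * applyA n K xf r) = \sum_r ratr (y r) * applyA n K X r.
  apply: eq_bigr => r _; rewrite rmorphM; congr (_ * _).
  have -> : applyA n K X r = rhs n K (fun t b => ratr (marg_fun t b) : R) r.
    by apply: applyA_mix => [||t b ht hb]; [|move=> j; apply: path_fun_valid|apply: Qmarg].
  have -> : applyA n K xf r = rhs n K marg_fun r.
    rewrite -applyA_x //; rewrite /applyA; under [RHS]eq_bigr do rewrite mulr_sumr.
    rewrite [RHS]exchange_big /=; apply: eq_bigr => i _; rewrite xfE hx mulr_sumr.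
    by apply: eq_bigr => e _; rewrite mulrCA.
  rewrite /rhs rmorphD !rmorph_sum; congr (_ + _).
    by apply: eq_bigr => a _; rewrite rmorphM rmorphB !rmorph_nat.
  apply: eq_bigr => t _; rewrite rmorph_sum; apply: eq_bigr => b _.
  by rewrite rmorphM rmorph_nat.
rewrite addNr; apply: sumr_ge0 => i _; apply: mulr_ge0.
  by rewrite ler0q (cert_s0 cert).
by apply: sumr_ge0 => j _; rewrite mulr_ge0 ?Q0 ?chi_ge0.
Qed.

Lemma answer_optimal :
  MOT_solution (euler_cost sigma) (real_vectors R mu) (tensor_of R answer).
Proof.
split; first exact: answer_feasible.
by move=> Q hQ; apply: le_trans answer_cost (lower_bound hQ).
Qed.

(** ** Sparsity *)

(** Two equal paths of positive weight could exchange mass without changing a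
    marginal, which is excluded at a vertex. *)
Lemma answer_uniq : uniq [seq e.1 | e <- answer].
Proof.
rewrite -map_comp map_inj_in_uniq ?filter_uniq ?iota_uniq // => e e'.
rewrite !mem_filter !mem_iota !add0n => /andP[ze /= le] /andP[ze' /= le'] E.
apply/eqP; apply: contraT => ne.
pose v : 'cV[rat]_N := delta_mx (Ordinal le) 0 - delta_mx (Ordinal le') 0.
have sumv f : \sum_(i < N) v i 0 * f (val i) = f e - f e' :> rat.
  have D (i0 : 'I_N) : \sum_(i < N) delta_mx i0 0 i 0 * f (val i) = f (val i0) :> rat.
    rewrite (bigD1 i0) //= mxE !eqxx mul1r big1 ?addr0 // => i /negbTE ni.
    by rewrite mxE ni mul0r.
  under eq_bigr do rewrite /v col_subE mulrBl.
  by rewrite sumrB !D.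
have v0 : v = 0.
  apply: zvert => [t b ht hb|i zi].
    have E' : path_fun (index_of k n0 (p e)) t = path_fun (index_of k n0 (p e')) t.
      by move: E => /= ->.
    rewrite (sumv (fun e => (p e t == b)%:R)).
    by rewrite -(index_ofE n0 (hp le) ht) E' (index_ofE n0 (hp le') ht) subrr.
  rewrite !mxE; have [Ei|_] := eqVneq i (Ordinal le); first by rewrite Ei /= in zi; rewrite zi ltxx in ze.
  have [Ei|_] := eqVneq i (Ordinal le'); first by rewrite Ei /= in zi; rewrite zi ltxx in ze'.
  by rewrite subrr.
have := sumv (fun i => (i == e)%:R); rewrite v0 big1 => [|i _]; last by rewrite mxE mul0r.
by rewrite eqxx eq_sym (negbTE ne) subr0 => /esym/eqP; rewrite oner_eq0.
Qed.

(** Coordinates that determine a vector of weights at the vertex: the law at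
    the first time, the laws at the other times but for one node each, which
    follows from the total mass, and the entries at the paths of weight 0. *)
Definition indep_type : finType := ('I_n + 'I_k * 'I_n.-1 + {e : 'I_N | z e == 0})%type.

Definition indep_coef (e : 'I_N) (q : indep_type) : rat :=
  match q with
  | inl (inl b) => (p e 0%N == b)%:R
  | inl (inr (t, b)) => (p e t.+1 == b.+1)%:R
  | inr e' => (e == val e')%:R
  end.

(** The map to these coordinates is injective on vectors of weights, so there
    are at least as many coordinates as paths. *)
Lemma answer_size : (size answer <= n * K - K + 1)%N.
Proof.
clear zcost.
have sz : size answer = #|[set e : 'I_N | 0 < z e]|.
  rewrite size_map size_filter -sum1_count -sum1dep_card.
  have -> : iota 0 N = index_iota 0 N by rewrite /index_iota subn0.
  by rewrite big_mkord.
have card0 : (#|{: {e : 'I_N | z e == 0%R}}| + #|[set e : 'I_N | (0 < z e)%R]| = N)%N.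
  rewrite card_sig addnC -[RHS]card_ord -(cardsC [set e : 'I_N | (0 < z e)%R]); congr (_ + _)%N.
  apply: eq_card => e; rewrite !inE; have := z0 (ltn_ord e).
  by rewrite le_eqVlt eq_sym; case: eqP => [->|] /=; rewrite ?ltxx // => _ ->.
pose M : 'M[rat]_(N, #|indep_type|) := \matrix_(e, q) indep_coef e (enum_val q).
have Mv (v : 'rV[rat]_N) q : (v *m M) 0 (enum_rank q) = \sum_(e < N) v 0 e * indep_coef e q.
  by rewrite mxE; apply: eq_bigr => e _; rewrite mxE enum_rankK.
have free : row_free M.
  rewrite -kermx_eq0; apply/eqP/row_matrixP => i; rewrite row0.
  have : (row i (kermx M) <= kermx M)%MS by apply: row_sub.
  move/sub_kermxP; move: (row i _) => v vM.
  have h q : \sum_(e < N) v 0 e * indep_coef e q = 0 by rewrite -Mv vM mxE.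
  have h0 b : (b < n)%N -> \sum_(e < N) v 0 e * (p e 0%N == b)%:R = 0.
    by move=> hb; apply: (h (inl (inl (Ordinal hb)))).
  have vs : \sum_(e < N) v 0 e = 0.
    transitivity (\sum_(b < n) \sum_(e < N) v 0 e * (p e 0%N == b :> nat)%:R); last first.
      by apply: big1 => b _; apply: h0.
    rewrite exchange_big /=; apply: eq_bigr => e _.
    by rewrite (sum_pick n (fun=> v 0 e) (p e 0%N)) hp.
  have hS t b : (t.+1 < K)%N -> (b.+1 < n)%N ->
      \sum_(e < N) v 0 e * (p e t.+1 == b.+1)%:R = 0.
    move=> ht hb; have hb' : (b < n.-1)%N by lia.
    by apply: (h (inl (inr (Ordinal (ht : (t < k)%N), Ordinal hb')))).
  have hS0 t : (t.+1 < K)%N -> \sum_(e < N) v 0 e * (p e t.+1 == 0%N)%:R = 0.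
    move=> ht; rewrite -[RHS]vs.
    transitivity (\sum_(b < n) \sum_(e < N) v 0 e * (p e t.+1 == b :> nat)%:R).
      rewrite (bigD1 (Ordinal n0)) //= [X in _ = _ + X]big1 ?addr0 // => b nb.
      case: b nb => [[|b] hb] nb; last exact: hS.
      by case/eqP: nb; apply/val_inj.
    rewrite exchange_big /=; apply: eq_bigr => e _.
    by rewrite (sum_pick n (fun=> v 0 e) (p e t.+1)) hp.
  apply: trmx_inj; rewrite trmx0; apply: zvert => [t b ht hb|e ze].
    under eq_bigr do rewrite mxE.
    by case: t ht => [|t] ht; [exact: h0|case: b hb => [|b] hb; [exact: hS0|exact: hS]].
  have := h (inr (exist _ e (introT eqP ze))).
  rewrite /= (bigD1 e) //= eqxx mulr1 mxE big1 ?addr0 // => e' /negbTE ne.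
  by rewrite ne mulr0.
have := rank_leq_col M; rewrite (eqP free) sz.
rewrite /indep_type !card_sum card_prod !card_ord => h.
have {}h : (N <= n + k * n.-1 + #|{: {e : 'I_N | z e == 0%R}}|)%N := h.
have -> : (n * K - K + 1 = n + k * n.-1)%N.
  by case: (n) n0 => // m _; rewrite mulSn addKn mulnS mulnC addn1 addSn.
by rewrite -(leq_add2l #|{: {e : 'I_N | z e == 0%R}}|) card0 addnC.
Qed.

End Final.

(** * Bounds from the bit complexity *)

Lemma bits_lt q B : (bit_complexity q <= B)%N ->
  (`|numq q| < 2 ^ B)%N /\ (`|denq q| < 2 ^ B)%N.
Proof.
have h m : (m < 2 ^ nbits m)%N by apply: trunc_log_ltn.
by move=> hB; split; apply: leq_trans (h _) _; rewrite leq_exp2l // (leq_trans _ hB) ?leq_addr ?leq_addl.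
Qed.

Definition denom (q : rat) : nat := `|denq q|%N.

Lemma denom_gt0 q : (0 < denom q)%N.
Proof. by rewrite absz_gt0 denq_neq0. Qed.

Lemma denomE q : (denom q)%:R = (denq q)%:~R :> rat.
Proof. by rewrite /denom -[in RHS]absz_denq. Qed.

Lemma denom_int q D : (denom q %| D)%N -> D%:R * q \is a Num.int.
Proof.
move=> /dvdnP[u ->]; rewrite natrM -mulrA denomE -[X in _ * X]mulrC -numqE.
by rewrite rpredM ?natr_int ?intr_int.
Qed.

Lemma bits_norm q B : (bit_complexity q <= B)%N -> `|q| <= (2 ^ B)%:R.
Proof.
move=> /bits_lt[h _]; have d0 : 1 <= `|(denq q)%:~R| :> rat by rewrite -denomE normr_nat ler1n denom_gt0.
have -> : `|q| = `|numq q|%N%:R / `|(denq q)%:~R|.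
  by rewrite -[in LHS](divq_num_den q) normf_div -intr_norm natr_absz.
rewrite ler_pdivrMr ?(lt_le_trans ltr01) // (le_trans (_ : _ <= (2 ^ B)%:R)) //.
  by rewrite ler_nat ltnW.
by rewrite ler_peMr // ler0n.
Qed.

(** A positive rational is at least the inverse of its denominator. *)
Lemma bits_inv q B : (bit_complexity q <= B)%N -> 0 <= q -> q^-1 <= (2 ^ B)%:R.
Proof.
move=> hB; rewrite le_eqVlt => /orP[/eqP<-|q0]; first by rewrite invr0 ler0n.
have [_ h] := bits_lt hB; rewrite invf_ple ?posrE ?ltr0n ?expn_gt0 //.
have n1 : 1 <= (numq q)%:~R :> rat by rewrite ler1z -gtz0_ge1 numq_gt0.
have -> : q = (numq q)%:~R / (denom q)%:R by rewrite denomE divq_num_den.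
rewrite ler_pdivlMr ?ltr0n ?denom_gt0 // (le_trans _ n1) //.
rewrite mulrC ler_pdivrMr ?ltr0n ?expn_gt0 // mul1r ler_nat; exact: ltnW.
Qed.

Section Rounds.
Variables n d K B : nat.
Local Notation N := (ncell n K).

(** Bounds the differences between the cost and the initial slack on the live
    cells. *)
Definition gap1 : nat := (d * 2 ^ (2 * B + 2) + 2 ^ (3 * B))%N.
Definition log1 : nat := (N + d + 3 * B + 6)%N.
Definition rounds1 : nat := (8 * N * log1 + 1)%N.
Definition log2 : nat := (2 * (N * N) + B * n * K + 2 * (B * d * n) + N + 2)%N.
Definition rounds2 : nat := (8 * N * (rounds1 + log2) + 1)%N.

Lemma gap1_log : (8 * N * gap1 <= 2 ^ log1)%N.
Proof.
have hN : (N <= 2 ^ N)%N by apply: ltnW; apply: ltn_expl.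
have hd : (d <= 2 ^ d)%N by apply: ltnW; apply: ltn_expl.
have h8 : (8 * N <= 2 ^ (3 + N))%N by rewrite expnD leq_mul.
have hg : (gap1 <= 2 ^ (d + 3 * B + 3))%N.
  have -> : (d + 3 * B + 3 = (d + 3 * B + 2).+1)%N by lia.
  have h2 : (2 ^ (3 * B) <= 2 ^ (d + 3 * B + 2))%N by rewrite leq_exp2l; lia.
  have h3 : (d * 2 ^ (2 * B + 2) <= 2 ^ (d + 3 * B + 2))%N.
    by apply: leq_trans (leq_mul hd (leqnn _)) _; rewrite -expnD leq_exp2l //; lia.
  by rewrite expnS mul2n -addnn /gap1 leq_add.
have -> : log1 = ((3 + N) + (d + 3 * B + 3))%N by rewrite /log1; lia.
by rewrite expnD leq_mul.
Qed.

Lemma pow1_le : (1 + (8 * N)%:R^-1) ^+ rounds1 <= (2 ^ rounds1)%:R :> rat.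
Proof.
rewrite natrX lerXn2r ?nnegrE ?addr_ge0 ?invr_ge0 //.
rewrite -[X in _ <= X]/(1 + 1)%R lerD2l; have [->|h] := posnP (8 * N)%N; first by rewrite invr0 ler01.
by rewrite invf_le1 ?ltr0n ?ler1n.
Qed.

End Rounds.

Section Data.
Variables (n d K B : nat) (mu pt : nat -> nat -> rat) (sg : nat -> nat).
Hypothesis n0 : (0 < n)%N.
Hypothesis mu0 : forall t b, 0 <= mu t b.
Hypothesis mu_bits : forall t b, (t < K)%N -> (b < n)%N -> (bit_complexity (mu t b) <= B)%N.
Hypothesis pt_bits : forall j l, (j < n)%N -> (l < d)%N -> (bit_complexity (pt j l) <= B)%N.
Hypothesis sg_lt : forall j, (j < n)%N -> (sg j < n)%N.
Local Notation N := (ncell n K).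

Definition common_denom (p q : nat) (f : nat -> nat -> rat) : nat :=
  (\prod_(i < p) \prod_(j < q) denom (f i j))%N.

Lemma common_denom_gt0 p q f : (0 < common_denom p q f)%N.
Proof. by apply: prodn_gt0 => i; apply: prodn_gt0 => j; apply: denom_gt0. Qed.

Lemma common_denom_int p q f i j : (i < p)%N -> (j < q)%N ->
  (common_denom p q f)%:R * f i j \is a Num.int.
Proof.
move=> hi hj; apply: denom_int; rewrite /common_denom (bigD1 (Ordinal hi)) //=.
by rewrite (bigD1 (Ordinal hj)) //= -mulnA dvdn_mulr.
Qed.

Lemma common_denom_le p q f :
  (forall i j, (i < p)%N -> (j < q)%N -> (bit_complexity (f i j) <= B)%N) ->
  (common_denom p q f <= 2 ^ (B * q * p))%N.
Proof.
move=> h; rewrite /common_denom.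
have H (m c : nat) (g : 'I_m -> nat) : (forall i, g i <= 2 ^ c)%N ->
    (\prod_(i < m) g i <= 2 ^ (c * m))%N.
  move=> hg; rewrite expnM -[X in (_ <= _ ^ X)%N](card_ord m) -prod_nat_const.
  exact: leq_prod.
by apply: (H) => i; apply: H => j; have [_ /ltnW] := bits_lt (h i j (ltn_ord i) (ltn_ord j)).
Qed.

Lemma rhs_int r : (0 < K)%N -> (common_denom K n mu)%:R * rhs n K mu r \is a Num.int.
Proof.
move=> K0; rewrite /rhs mulrDr rpredD // mulr_sumr rpred_sum // => [a _|t _].
  by rewrite mulrA rpredM ?common_denom_int ?rpredB ?natr_int.
rewrite mulr_sumr rpred_sum // => b _.
by rewrite mulrA rpredM ?common_denom_int ?natr_int.
Qed.

Lemma cell_costE i : exists j j', [/\ (j < n)%N, (j' < n)%N &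
  cell_cost n d K pt sg i = sqdist d pt j j'].
Proof.
have h1 : (i %% n < n)%N by rewrite ltn_mod.
have h2 : ((i %/ n) %% n < n)%N by rewrite ltn_mod.
by rewrite /cell_cost; case: ifP => _; do 2!eexists; split; try exact: erefl; auto.
Qed.

Lemma cell_cost_int i :
  (common_denom n d pt * common_denom n d pt)%:R * cell_cost n d K pt sg i \is a Num.int.
Proof.
have [j [j' [hj hj' ->]]] := cell_costE i.
rewrite /sqdist mulr_sumr rpred_sum // => l _.
by rewrite natrM -expr2 -exprMn mulrBr rpredX // rpredB ?common_denom_int.
Qed.

Lemma cell_cost_le i : cell_cost n d K pt sg i <= (d * 2 ^ (2 * B + 2))%:R.
Proof.
have [j [j' [hj hj' ->]]] := cell_costE i.
have -> : (d * 2 ^ (2 * B + 2))%:R = \sum_(l < d) (2 ^ (2 * B + 2))%:R :> rat.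
  by rewrite sumr_const card_ord natrM mulr_natl.
apply: ler_sum => l _; have h (u : rat) : `|u| <= (2 ^ B.+1)%:R -> u ^+ 2 <= (2 ^ (2 * B + 2))%:R.
  move=> hu; have -> : (2 * B + 2 = B.+1 * 2)%N by lia.
  by rewrite expnM [X in _ <= X]natrX -real_normK ?num_real // lerXn2r // nnegrE.
apply: h; apply: le_trans (ler_normB _ _) _; rewrite expnS mul2n -addnn natrD.
by apply: lerD; apply: bits_norm; apply: pt_bits.
Qed.

Lemma product_flow_ge0 i : 0 <= product_flow n K mu i.
Proof.
have h t a b : 0 <= cond_marg K mu t a b by rewrite /cond_marg; case: ifP => _ //; apply: ler0n.
by rewrite !mulr_ge0.
Qed.

(** A product of three factors, each 0, 1 or an entry of a marginal. *)
Lemma product_flow_inv i : (i < N)%N -> (product_flow n K mu i)^-1 <= (2 ^ (3 * B))%:R.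
Proof.
move=> hi; have h t a b : (t <= K)%N -> (b < n)%N -> (cond_marg K mu t a b)^-1 <= (2 ^ B)%:R.
  rewrite /cond_marg => ht hb; case: ifP => ht'.
    by rewrite (@le_trans _ _ 1) ?ler1n ?expn_gt0 //; case: (a == b); rewrite ?invr1 ?invr0 ?ler01.
  by apply: bits_inv => //; apply: mu_bits => //; move: ht'; lia.
have hc t a b : 0 <= cond_marg K mu t a b by rewrite /cond_marg; case: ifP => _ //; apply: ler0n.
have ht : (i %/ n %/ n %/ n < K)%N.
  by rewrite -!divnMA ltn_divLR ?muln_gt0 ?n0 // !mulnA.
have K0 : (0 < K)%N := leq_ltn_trans (leq0n _) ht.
rewrite /product_flow !invfM (_ : 3 * B = B + B + B)%N; last by lia.
rewrite !expnD !natrM; apply: ler_pM; rewrite ?mulr_ge0 ?invr_ge0 //; last by apply: h; rewrite ?ltn_mod.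
apply: ler_pM; rewrite ?invr_ge0 //; last by apply: h; rewrite ?ltn_mod ?(ltnW ht).
by apply: bits_inv => //; apply: mu_bits; rewrite // ltn_mod.
Qed.

(** The factor [2 * N] comes from [phase2_stop]. The common denominator of the
    coordinates enters squared, costs being sums of squares. *)
Lemma vertex_log (E1 := common_denom K n mu) (E2 := common_denom n d pt) : (0 < N)%N ->
  (N`! * N`! * (E1 * (E2 * E2)) * (2 * N) < 2 ^ log2 n d K B)%N.
Proof.
move=> N0; have hf : (N`! <= 2 ^ (N * N))%N.
  rewrite expnM; apply: (@leq_trans (N ^ N)).
    by rewrite fact_prod big_add1 /= big_mkord -[X in (_ <= _ ^ X)%N](card_ord N)
      -prod_nat_const leq_prod.
  by rewrite leq_exp2r // ltnW // ltn_expl.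
have h1 : (E1 <= 2 ^ (B * n * K))%N by apply: common_denom_le.
have h2 : (E2 <= 2 ^ (B * d * n))%N by apply: common_denom_le.
have hN : (2 * N < 2 ^ (N + 2))%N.
  have := ltn_expl N (isT : (1 < 2)%N); rewrite expnD; lia.
have -> : log2 n d K B = ((N * N) + (N * N) + (B * n * K + (B * d * n + B * d * n)) + (N + 2))%N.
  by rewrite /log2; lia.
rewrite !(expnD 2 _ (N + 2)) (expnD 2 (N * N + N * N)).
apply: leq_ltn_trans (_ : _ <= 2 ^ (N * N + N * N) * 2 ^ (B * n * K + (B * d * n + B * d * n)) * (2 * N))%N _.
  by rewrite leq_mul2r leq_mul ?orbT // !expnD !leq_mul.
by rewrite ltn_mul2l hN muln_gt0 !expn_gt0.
Qed.

End Data.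

(** * Correctness of the solver *)

Lemma nth_allpairs (S T U : Type) (x0 : U) (y0 : S) (z0 : T) (f : S -> T -> U) s t a b :
  (a < size s)%N -> (b < size t)%N ->
  nth x0 [seq f u v | u <- s, v <- t] (a * size t + b)%N = f (nth y0 s a) (nth z0 t b).
Proof.
elim: s a => [//|u s IH] [|a] /= ha hb; rewrite nth_cat size_map.
  by rewrite mul0n add0n hb (nth_map z0).
by rewrite mulSn -addnA ltnNge leq_addr /= addKn IH.
Qed.

Section Solve.
Variables (R : realType) (n d k : nat) (x : 'I_n -> 'rV[rat]_d).
Variables (sigma : {perm point_set (real_vectors R x)}) (s : 'I_n -> 'I_n).
Variables (mu : 'I_k.+1 -> 'rV[rat]_n) (B : nat).
Hypotheses (n0 : (0 < n)%N) (hs : encodes sigma s).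
Hypothesis hmu : forall i, in_simplex (real_vectors R mu i).
Hypothesis x_bits : forall j l, (bit_complexity (x j 0%R l) <= B)%N.
Hypothesis mu_bits : forall i a, (bit_complexity (mu i 0%R a) <= B)%N.
Local Notation K := k.+1.
Local Notation N := (ncell n K).

Let K0 : (0 < K)%N := ltn0Sn k.

Lemma ncell_gt0 : (0 < N)%N.
Proof. by rewrite !muln_gt0 n0. Qed.

Lemma input_sigma j : (j < n)%N ->
  nmem (input_state x s mu) 1 j = sigma_index s j /\ (sigma_index s j < n)%N.
Proof.
move=> hj; rewrite /sigma_index insubT /= ltn_ord; split=> //.
rewrite (nth_map (Ordinal hj)) ?size_enum_ord //; congr (nat_of_ord (s _)).
by apply/val_inj; rewrite /= nth_enum_ord.
Qed.

Lemma input_points j l : (j < n)%N -> (l < d)%N ->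
  qmem (input_state x s mu) 0 (j * d + l)%N = coords x j l.
Proof.
move=> hj hl; have := @nth_allpairs _ _ _ 0 (Ordinal hj) (Ordinal hl) (fun i m => x i 0 m)
  (enum 'I_n) (enum 'I_d) j l; rewrite !size_enum_ord => /(_ hj hl).
rewrite /= => ->; rewrite -[in RHS](nth_enum_ord (Ordinal hj) hj).
by rewrite -[in RHS](nth_enum_ord (Ordinal hl) hl) coordsE.
Qed.

Lemma input_marginals t b : (t < K)%N -> (b < n)%N ->
  qmem (input_state x s mu) 1 (t * n + b)%N = marg_fun mu t b.
Proof.
move=> ht hb; have := @nth_allpairs _ _ _ 0 (Ordinal ht) (Ordinal hb) (fun i m => mu i 0 m)
  (enum 'I_K) (enum 'I_n) t b; rewrite !size_enum_ord => /(_ ht hb).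
rewrite /= => ->; rewrite -[in RHS](nth_enum_ord (Ordinal ht) ht).
by rewrite -[in RHS](nth_enum_ord (Ordinal hb) hb) marg_funE.
Qed.

Definition loaded : state :=
  run load_prg (run dist_prg (run tables_prg (run sizes_prg (input_state x s mu)))).

(** The slack that makes [flow0] exactly central at [mu = 1]. *)
Definition barrier : 'cV[rat]_N := \col_i (flow0 mu i 0)^-1.

Local Notation S := (live mu).
Local Notation c := (live_cost x s mu).
Local Notation x0 := (flow0 mu).

Lemma flow0_ge0 i : 0 <= x0 i 0.
Proof. by rewrite mxE; apply: product_flow_ge0 => t b; apply: marg_fun_ge0 hmu t b. Qed.

Lemma loadedP : phase1_inv d S c barrier x0 0 loaded.
Proof.
have [T H5 H8 H7 [H6 H9 H26]] := load_prgP (st0 := input_state x s mu) n0 K0 (erefl n) (erefl d) (erefl K)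
  input_sigma input_points input_marginals; rewrite -/loaded in T H5 H6 H7 H8 H9 H26.
have V5 : vec loaded 5 N = x0 by apply/colP => i; rewrite !mxE H5.
have V6 : vec loaded 6 N = barrier by apply/colP => i; rewrite !mxE H6 // mul1r.
have V8 : vec loaded 8 N = barrier by apply/colP => i; rewrite !mxE H8 // mul1r.
have V7 : vec loaded 7 N = c by apply/colP => i; rewrite !mxE H7.
have bE (i : 'I_N) : barrier i 0 = (x0 i 0)^-1 by rewrite mxE.
move: loaded T V5 V6 V7 V8 H9 H26 {H5 H6 H7 H8} => st T V5 V6 V7 V8 H9 H26.
split; last exact: H26.
split; [exact: T|exact: V7|exact: V8|..|].
- move=> i; rewrite V5 V6; have [iS|iS] := boolP (i \in S); rewrite bE.
    rewrite inE in iS; have p : 0 < x0 i 0 by rewrite lt_def iS flow0_ge0.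
    by rewrite invr_gt0.
  by move: iS; rewrite inE negbK => /eqP ->; rewrite invr0.
- by move=> r _; rewrite V5.
- by move=> v _; rewrite V6 subrr /dot big1 // => i _; rewrite mxE mulr0.
- by rewrite H9 expr0.
- exact: ltr01.
- rewrite V5 V6 /off_center big1 ?mulr0 ?expr0 ?expr1n ?ler01 // => i.
  by rewrite inE => h; rewrite bE divff // subrr expr0n.
Qed.

Lemma dot_x0 r : dot (arow n K r) x0 = rhs n K (marg_fun mu) r.
Proof.
rewrite -applyA_product //; last by move=> t; apply: marg_fun_sum hmu t.
by apply: eq_bigr => i _; rewrite !mxE.
Qed.

Lemma central_le1 lvl obj m st (i : 'I_N) :
  central d S c barrier x0 lvl obj m st -> vec st 5 N i 0 <= 1.
Proof.
move=> C; rewrite vecE.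
have [t [a [b [b' [-> ht ha hb hb']]]]] := cellP (ltn_ord i).
apply: le_trans (@cell_le_marg n K _ (qmem st 5) t a b b' _ ht ha hb hb') _.
  move=> j hj; have := cen_int C (Ordinal hj); rewrite vecE /=.
  by case: ifP => _ [h _]; [exact: ltW|rewrite h].
have hr : (row_marg n K t b < nrow n K)%N by rewrite ltn_add2l pos_lt.
rewrite -dot_arow (cen_x C) // dot_x0 rhs_marg //.
exact: marg_fun_le1 hmu _ _ ht hb.
Qed.

Let pt_bits j l : (j < n)%N -> (l < d)%N -> (bit_complexity (coords x j l) <= B)%N.
Proof. by move=> hj hl; rewrite (coordsE x (Ordinal hj) (Ordinal hl)). Qed.

Let mg_bits t b : (t < K)%N -> (b < n)%N -> (bit_complexity (marg_fun mu t b) <= B)%N.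
Proof. by move=> ht hb; rewrite (marg_funE mu (Ordinal ht) (Ordinal hb)). Qed.

Let sg_lt j : (j < n)%N -> (sigma_index s j < n)%N.
Proof. by move=> /input_sigma[]. Qed.

Lemma gap1P i : `|c i 0 - barrier i 0| <= (gap1 d B)%:R.
Proof.
have [iS|iS] := boolP (i \in S); last first.
  by rewrite live_cost_notin // mxE; move: iS; rewrite inE negbK => /eqP->; rewrite invr0 subrr normr0 ler0n.
rewrite live_costE // /gap1 natrD (le_trans (ler_normB _ _)) // lerD //.
  rewrite ger0_norm ?raw_cost_ge0 //; exact: cell_cost_le.
rewrite mxE ger0_norm ?invr_ge0 ?flow0_ge0 // mxE.
apply: product_flow_inv => // t b; exact: marg_fun_ge0 hmu t b.
Qed.

Lemma off_live i : i \notin S -> c i 0 = 0 /\ barrier i 0 = 0.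
Proof.
move=> iS; rewrite live_cost_notin //; split=> //.
by rewrite mxE; move: iS; rewrite inE negbK => /eqP->; rewrite invr0.
Qed.

Lemma rhs_x0_int r : (common_denom K n (marg_fun mu))%:R * dot (arow n K r) x0 \is a Num.int.
Proof. by rewrite dot_x0; apply: rhs_int. Qed.

Lemma live_cost_int i :
  (common_denom n d (coords x) * common_denom n d (coords x))%:R * c i 0 \is a Num.int.
Proof.
have [iS|iS] := boolP (i \in S); last by rewrite live_cost_notin // mulr0.
by rewrite live_costE //; apply: cell_cost_int.
Qed.

Lemma growth_gt1 : 1 < 1 + (8 * N)%:R^-1 :> rat.
Proof. by rewrite ltrDl invr_gt0 ltr0n muln_gt0 ncell_gt0. Qed.

Definition solved (st : state) : Prop :=
  [/\ tables n d K st, vec st 7 N = c,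
      certificate S c x0 (vec st 24 N) (vec st 25 N) &
      dot (vec st 24 N) (vec st 25 N) = 0].

Lemma phase1_run tb :
  (forall st, tables n d K st -> (time_bound phase1_body (fun a => nmem st a 0) <= tb)%N) ->
  exists t st j, [/\ exec (While phase1_cond (compile phase1_body)) loaded t st,
    (t <= (rounds1 n d K B).+1 * (tb + bcost phase1_cond))%N, (j < rounds1 n d K B)%N,
    phase1_inv d S c barrier x0 j.+1 st & ~~ beval st phase1_cond].
Proof.
move=> htb.
have [|||||t [st [j [E le hj P stop]]]] := @while_rule phase1_cond phase1_body
  (phase1_inv d S c barrier x0) (rounds1 n d K B) tb loaded.
- exact: isT.
- exact: loadedP.
- move=> j st P _; exact: (phase1_step ncell_gt0 P).
- move=> j st P hj; apply: (phase1_stop ncell_gt0 P gap1P _ (gap1_log n d K B) hj).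
  by move=> i; apply: (central_le1 i P.1).
- by move=> j st [C _]; apply: htb; apply: cen_tab C.
exists t, st; case: j hj P => [|j] hj P.
  case/negP: stop; rewrite phase1_condE; case: P => C ->; rewrite (cen_mu C) expr0; lra.
by exists j; split; [exact: E|exact: le|exact: hj|exact: P|exact: stop].
Qed.

Lemma phase2_solved m1 j st : phase2_inv d S c barrier x0 m1 j st ->
  qmem st 26 0 <= 0 -> solved st.
Proof.
move=> [C I] g0; case: j C I => [|j] C; first by move=> g; move: g0; rewrite g ler10.
move=> [ce G _ _ _]; split; [exact: cen_tab C|exact: cen_c C|exact: ce|].
apply/le_anti/andP; split; first by rewrite -G.
by apply: sumr_ge0 => i _; apply: mulr_ge0; [exact: (cert_x0 ce)|exact: (cert_s0 ce)].
Qed.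

Lemma phase2_run st1 j tb : phase1_inv d S c barrier x0 j.+1 st1 ->
  (j < rounds1 n d K B)%N -> ~~ beval st1 phase1_cond ->
  (forall st, tables n d K st -> (time_bound phase2_body (fun a => nmem st a 0) <= tb)%N) ->
  exists t st, [/\ exec (While phase2_cond (compile phase2_body)) (run switch_prg st1) t st,
    (t <= (rounds2 n d K B).+1 * (tb + bcost phase2_cond))%N & solved st].
Proof.
move=> P1 hj stop1 htb; set m1 := qmem st1 9 0.
have [|C2 G2] := phase1_switch P1 stop1.
  exact: off_live.
have e1 := common_denom_gt0 K n (marg_fun mu).
have e2 : (0 < common_denom n d (coords x) * common_denom n d (coords x))%N.
  by rewrite muln_gt0 !common_denom_gt0.
have m1E : m1 = (1 + (8 * N)%:R^-1) ^+ j.+1 by have [C _] := P1; rewrite /m1 (cen_mu C).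
have m10 : 0 <= m1 by apply: ltW; apply: cen_pos C2.
have m1le : m1 <= (2 ^ rounds1 n d K B)%:R.
  apply: le_trans (pow1_le n d K B); rewrite m1E.
  by rewrite (ler_eXn2l growth_gt1).
have [|||||t [st [j2 [E le hj2 P stop]]]] := @while_rule phase2_cond phase2_body
  (phase2_inv d S c barrier x0 m1) (rounds2 n d K B) tb (run switch_prg st1).
- exact: isT.
- by split; [rewrite expr0 mulr1|].
- move=> j' st P _; exact: (phase2_step ncell_gt0 P).
- move=> j' st P hj'.
  apply: (phase2_stop ncell_gt0 e1 e2 (fun r _ => rhs_x0_int r) live_cost_int _ m10 m1le
    (vertex_log n0 mg_bits pt_bits ncell_gt0) P hj').
  by move=> i /off_live[].
- by move=> j' st [C _]; apply: htb; apply: cen_tab C.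
exists t, st; split.
- exact: E.
- exact: le.
- apply: (phase2_solved P).
by move: stop; rewrite phase2_condE negbK.
Qed.

Definition finish_prg : prg := PSeq decomp_prg (PSeq carat_prg output_prg).

Lemma finishP st : solved st -> exists L : sparse_tensor n K,
  [/\ outputs (run finish_prg st) L, uniq [seq e.1 | e <- L], (size L <= n * K - K + 1)%N &
      MOT_solution (euler_cost sigma) (real_vectors R mu) (tensor_of R L)].
Proof.
move=> [T Vc ce g0].
have X0 i : (i < N)%N -> 0 <= qmem st 24 i.
  by move=> hi; have := cert_x0 ce (Ordinal hi); rewrite vecE.
have C0 i : (i < N)%N -> 0 <= qmem st 7 i.
  move=> hi; have := vecE st 7 (Ordinal hi); rewrite Vc /= => <-.
  have [iS|iS] := boolP (Ordinal hi \in S); last by rewrite live_cost_notin.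
  by rewrite live_costE // raw_cost_ge0.
have bal : balanced n K (qmem st 24).
  apply: (@balanced_rhs n K _ _ (marg_fun mu)) => r hr.
  by rewrite -dot_arow (cert_Ax ce) // dot_x0.
rewrite /finish_prg (runS decomp_prg) (runS carat_prg).
have [D X] := decomp_prgP T n0 K0 bal X0 C0; set s1 := run decomp_prg st in D X *.
have T1 : tables n d K s1 by apply: tables_run T.
set s2 := run carat_prg s1; have T2 : tables n d K s2 by apply: tables_run T1.
have hw e : (e < N)%N -> 0 <= qmem s1 28 e /\ 0 < qmem s1 21 e by move=> /D[].
have [Z0 Zw Zm Zc Zv] := carat_prgP T1 n0 ncell_gt0 hw.
rewrite -/s2 in Z0 Zw Zm Zc Zv.
pose p := path_of s1 K; pose z := qmem s2 20; pose wt := qmem s1 28.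
have p2 e t : path_of s2 K e t = p e t by rewrite /path_of /p /s2; frame.
have hp e : (e < N)%N -> valid_path n K (p e) by move=> /D[].
have mr t b (v : 'cV[rat]_N) : (t < K)%N -> (b < n)%N ->
    dot (marg_row N n p (t * n + b)) v = \sum_(e < N) v e 0 * (p e t == b)%:R.
  move=> ht hb; apply: eq_bigr => e _; rewrite mxE mulrC.
  by rewrite divnMDl // divn_small // addn0 modnMDl modn_small.
have zv : forall v : 'cV[rat]_N,
  (forall t b, (t < K)%N -> (b < n)%N -> \sum_(e < N) v e 0 * (p e t == b)%:R = 0) ->
  (forall e : 'I_N, z e = 0 -> v e 0 = 0) -> v = 0.
  move=> v h1 h2; apply: Zv => [r hr|e]; last by rewrite vecE; apply: h2.
  by rewrite (divn_eq r n) mr ?h1 ?ltn_mod // ltn_divLR.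
have z0 e : (e < N)%N -> 0 <= z e.
  by move=> he; have := Z0 (Ordinal he); rewrite vecE.
have OUT := output_prgP T2; rewrite -/z in OUT.
exists (answer k n0 z p); split.
- have [h1 h2] := OUT; split; first by rewrite size_map.
  case=> r hr; have hr' : (r < size (support_list z N))%N by rewrite size_map in hr.
  have [h3 h4] := h2 r hr'; set e := nth 0%N (support_list z N) r in h3 h4.
  have he : (e < N)%N.
    by have := mem_nth 0%N hr'; rewrite mem_filter mem_iota => /andP[_ /andP[]].
  have tE : tnth (in_tuple (answer k n0 z p)) (Ordinal hr) = (index_of k n0 (p e), z e).
    rewrite (tnth_nth (index_of k n0 (p e), z e)) /= (nth_map 0%N) //.
  rewrite tE; split=> [i|] /=; last exact: h4.
  rewrite h3 ?ltn_ord // p2 index_of_coord //; exact: hp.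
- exact: answer_uniq hp zv.
- exact: (answer_size n0 hp z0 zv).
apply: (answer_optimal n0 hs hmu (wt := wt) (G := qmem s1 21) ce g0 hp) => //.
- by move=> e /D[].
- by move=> i; rewrite vecE; apply: X.
- by move=> e he h; have := Zw (Ordinal he); rewrite !vecE; apply.
- move=> t b ht hb; have hr : (t * n + b < K * n)%N := pos_lt ht hb.
  have := Zm _ hr; rewrite !mr //; under eq_bigr do rewrite vecE.
  by under [in RHS]eq_bigr do rewrite vecE.
- move=> e we; have [vp _ _ hG] := D e (ltn_ord e); rewrite hG //; congr (_ + _).
  apply: eq_bigr => t _; rewrite -Vc vecE val_insubd.
  by rewrite (path_cell_lt K0 vp (ltn_ord t)).
- have := Zc; rewrite /dot; under eq_bigr do rewrite !vecE mulrC.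
  by under [X in _ <= X]eq_bigr do rewrite !vecE mulrC.
Qed.

End Solve.

(** * Polynomial running time *)

(** The contents of the arrays 10 to 18. *)
Definition size_of (n d K a : nat) : nat :=
  nth 0%N [:: n; d; K; ncell n K; nrow n K; 1; K * n * n; K * n; n * n]%N (a - 10).

Lemma size_of_tables n d K st a : tables n d K st ->
  a \in [:: 10; 12; 13; 14; 15; 17; 18]%N -> nmem st a 0 = size_of n 0 K a.
Proof.
move=> [h10 _ h12 h13 h14 h15 h17 h18 _ _]; rewrite !inE.
by do 6![case/orP=> [/eqP->|]; first by []]; move/eqP->.
Qed.

Definition time_of (p : prg) (n K : nat) : nat := time_bound p (size_of n 0 K).

Lemma time_tables p n d K st : tables n d K st ->
  all (mem [:: 10; 12; 13; 14; 15; 17; 18]%N) (loop_sizes p) ->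
  time_bound p (fun a => nmem st a 0) = time_of p n K.
Proof. by move=> T /allP h; apply: eq_time_bound => a /h; apply: size_of_tables T. Qed.

(** The array 11, which holds [d], is not among those allowed to bound a loop. *)
Lemma exec_tables p n d K st : wf p -> all (mem [:: 10; 12; 13; 14; 15; 17; 18]%N) (loop_sizes p) ->
  tables n d K st -> exists2 t, (t <= time_of p n K)%N & exec (compile p) st t (run p st).
Proof. by move=> w h T; rewrite -(time_tables T h); apply: exec_run. Qed.

(** ** Polynomial bounds *)

Lemma poly_le (f g : nat -> nat -> nat) :
  (forall n k, (f n k <= g n k)%N) -> poly_bounded g -> poly_bounded f.
Proof. by move=> h [c hc]; exists c => n k; apply: leq_trans (h n k) (hc n k). Qed.

Lemma poly_pow a e : poly_bounded (fun n k => a * (n + k).+1 ^ e)%N.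
Proof.
by exists (a + e)%N => n k; apply: leq_mul; rewrite ?leq_addr // leq_pexp2l ?leq_addl.
Qed.

Lemma poly_const a : poly_bounded (fun _ _ => a).
Proof. by apply: poly_le (poly_pow a 0) => n k; rewrite expn0 muln1. Qed.

Lemma poly_fst : poly_bounded (fun n _ => n).
Proof. by apply: poly_le (poly_pow 1 1) => n k; rewrite expn1 mul1n; lia. Qed.

Lemma poly_snd : poly_bounded (fun _ k => k).
Proof. by apply: poly_le (poly_pow 1 1) => n k; rewrite expn1 mul1n; lia. Qed.

Lemma poly_add f g : poly_bounded f -> poly_bounded g -> poly_bounded (fun n k => f n k + g n k)%N.
Proof.
move=> [c hc] [c' hc']; exists (c + c')%N => n k; rewrite mulnDl leq_add //.
  by apply: leq_trans (hc n k) _; rewrite leq_mul2l leq_pexp2l ?leq_addr ?orbT.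
by apply: leq_trans (hc' n k) _; rewrite leq_mul2l leq_pexp2l ?leq_addl ?orbT.
Qed.

Lemma poly_mul f g : poly_bounded f -> poly_bounded g -> poly_bounded (fun n k => f n k * g n k)%N.
Proof.
move=> [c hc] [c' hc']; apply: poly_le (poly_pow (c * c') (c + c')) => n k.
by rewrite expnD mulnACA leq_mul.
Qed.

Lemma poly_ncell : poly_bounded ncell.
Proof. exact: (poly_mul (poly_mul (poly_mul poly_snd poly_fst) poly_fst) poly_fst). Qed.

Lemma size_of_le n K a : (size_of n 0 K a <= (n + K).+1 ^ 4)%N.
Proof.
set S := (n + K).+1; have nS : (n <= S)%N by rewrite /S; lia.
have KS : (K <= S)%N by rewrite /S; lia.
have lift e m : (e <= 4)%N -> (m <= S ^ e)%N -> (m <= S ^ 4)%N.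
  by move=> he /leq_trans; apply; rewrite leq_pexp2l.
have S2 : (K * n <= S ^ 2)%N by rewrite leq_mul.
have S3 : (K * n * n <= S ^ 3)%N by rewrite expnSr leq_mul.
rewrite /size_of; move: (a - 10)%N => i; case: i => [|[|[|[|[|[|[|[|[|i]]]]]]]]] /=.
- exact: lift 1%N _ isT nS.
- by [].
- exact: lift 1%N _ isT KS.
- by rewrite expnSr leq_mul.
- apply: lift 3%N _ isT _; rewrite /nrow.
  apply: (@leq_trans (K.+1 * n * n.+1)); first by rewrite mulnS addnC leq_add // leq_mul2r leqnSn orbT.
  by rewrite !expnSr expn0 mul1n !leq_mul // /S; lia.
- by rewrite expn_gt0.
- exact: lift 3%N _ isT S3.
- exact: lift 2%N _ isT S2.
- by apply: lift 2%N _ isT _; rewrite leq_mul.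
- by rewrite nth_nil.
Qed.

Lemma poly_time p : poly_bounded (time_of p).
Proof.
have [c hc] := time_bound_poly p; apply: poly_le (poly_pow c (4 * loop_depth p)) => n K.
by rewrite expnM; apply: hc => [|a _]; [rewrite expn_gt0|exact: size_of_le].
Qed.

(** ** The solver *)

Definition solver : cmd :=
  Seq (compile sizes_prg) (Seq (compile tables_prg)
  (Seq (compile dist_prg) (Seq (compile load_prg)
  (Seq (While phase1_cond (compile phase1_body)) (Seq (compile switch_prg)
  (Seq (While phase2_cond (compile phase2_body)) (compile finish_prg))))))).

(** The only loop over the coordinates. *)
Lemma dist_time sz : (0 < sz 11%N)%N ->
  (time_bound dist_prg sz <= sz 11%N * (sz 18%N * 100 + 9))%N.
Proof.
move=> d0; rewrite /=; set u := sz 18%N; set v := sz 11%N in d0 *.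
rewrite [X in (_ <= X)%N]mulnDr leq_add ?leq_pmull // [X in (_ <= X)%N]mulnCA leq_mul2l.
by apply/orP; right; lia.
Qed.

Section Rounds.
Variables (n d K B : nat).
Hypothesis d0 : (0 < d)%N.
Local Notation N := (ncell n K).

Definition round_rate1 : nat := (8 * N * (N + 3 * B + 7) + 2)%N.
Definition round_rate2 : nat :=
  (8 * N * (round_rate1 + (2 * (N * N) + B * n * K + 2 * (B * n) + N + 2)) + 2)%N.

(** [d] enters the logarithm of the largest cost, at most linearly. *)
Lemma rounds1_le : ((rounds1 n d K B).+1 <= d * round_rate1)%N.
Proof.
rewrite /rounds1 /round_rate1 /log1 -addnS [X in (_ <= X)%N]mulnDr leq_add ?leq_pmull //.
rewrite [X in (_ <= X)%N]mulnCA leq_mul2l; apply/orP; right; rewrite !mulnDr; have : (d * N >= N)%N := leq_pmull _ d0.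
have : (d * (3 * B) >= 3 * B)%N := leq_pmull _ d0; lia.
Qed.

(** [d] enters the bit length of the common denominator of the coordinates
    linearly. *)
Lemma rounds2_le : ((rounds2 n d K B).+1 <= d * round_rate2)%N.
Proof.
have lift m : (m <= d * m)%N := leq_pmull m d0.
rewrite /rounds2 /round_rate2 -addnS [X in (_ <= X)%N]mulnDr leq_add //.
rewrite [X in (_ <= X)%N]mulnCA leq_mul2l; apply/orP; right.
rewrite [X in (_ <= X)%N]mulnDr leq_add //; first exact: ltnW rounds1_le.
have -> : log2 n d K B = (2 * (N * N) + B * n * K + d * (2 * (B * n)) + N + 2)%N.
  by rewrite /log2; congr (_ + _ + _ + _)%N; ring.
by rewrite !mulnDr !leq_add ?lift.
Qed.

End Rounds.

Lemma sum_le d a b a' b' : (a <= d * a' -> b <= d * b' -> a + b <= d * (a' + b'))%N.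
Proof. by move=> h h'; rewrite mulnDr leq_add. Qed.

Definition total_time (B : nat -> nat -> nat) (n K : nat) : nat :=
  (time_of sizes_prg n K + (time_of tables_prg n K + (n * n * 100 + 9 + (time_of load_prg n K +
   (round_rate1 n K (B n K) * (time_of phase1_body n K + bcost phase1_cond) +
    (time_of switch_prg n K +
     (round_rate2 n K (B n K) * (time_of phase2_body n K + bcost phase2_cond) +
      time_of finish_prg n K)))))))%N.

Lemma poly_total B : poly_bounded B -> poly_bounded (total_time B).
Proof.
move=> hB; rewrite /total_time /round_rate2 /round_rate1.
by repeat first [exact: poly_time | exact: hB | exact: poly_ncell | exact: poly_fst
  | exact: poly_snd | exact: poly_const | apply: poly_add | apply: poly_mul].
Qed.

(* The number of marginals is k.+1. *)
Theorem corollary5p7 :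
  exists prog : cmd,
  forall B : nat -> nat -> nat, poly_bounded B ->
  exists T : nat -> nat -> nat, poly_bounded T /\
  forall (R : realType) (n d k : nat)
    (x : 'I_n -> 'rV[rat]_d)
    (sigma : {perm point_set (real_vectors R x)})
    (s : 'I_n -> 'I_n)
    (mu : 'I_k.+1 -> 'rV[rat]_n),
  (0 < n)%N -> (0 < d)%N ->
  encodes sigma s ->
  (forall i, in_simplex (real_vectors R mu i)) ->
  (forall j l, (bit_complexity (x j 0%R l) <= B n k.+1)%N) ->
  (forall i a, (bit_complexity (mu i 0%R a) <= B n k.+1)%N) ->
  exists (t : nat) (st : state) (L : sparse_tensor n k.+1),
    [/\ exec prog (input_state x s mu) t st,
        (t <= d * T n k.+1)%N,
        outputs st L,
        uniq [seq e.1 | e <- L] /\ (size L <= n * k.+1 - k.+1 + 1)%N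
      & MOT_solution (euler_cost sigma) (real_vectors R mu)
          (tensor_of R L)].
Proof.
exists solver => B hB; exists (total_time B); split; first exact: poly_total.
move=> R n d k x sigma s mu n0 d0 hs hmu hx hm; set K := k.+1.
have lift c : (c <= d * c)%N by rewrite leq_pmull.
set st0 := input_state x s mu; set st1 := run sizes_prg st0.
have [[z10 z11 z12 z13 z14] [z15 z16 z17 z18]] :=
  sizes_prgP (st0 := st0) (erefl n) (erefl d) (erefl K).
have T2 : tables n d K (run tables_prg st1).
  exact: (tables_prgP (st0 := st0) n0 (erefl n) (erefl d) (erefl K)).
have T3 : tables n d K (run dist_prg (run tables_prg st1)) by apply: tables_run T2.
have e1 : exec (compile sizes_prg) st0 (time_of sizes_prg n K) st1 by apply: exec_straight.
have [t2 le2 e2] : exists2 t, (t <= time_of tables_prg n K)%N &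
    exec (compile tables_prg) st1 t (run tables_prg st1).
  rewrite /time_of -(@eq_time_bound _ (fun a => nmem st1 a 0)); first exact: exec_run.
  by move=> a; rewrite !inE => /or4P[] /eqP->.
have [t3 le3 e3] : exists2 t, (t <= d * (n * n * 100 + 9))%N &
    exec (compile dist_prg) (run tables_prg st1) t (run dist_prg (run tables_prg st1)).
  have [|t le e] := @exec_run dist_prg (run tables_prg st1); first exact: isT.
  exists t => //; apply: leq_trans le _; rewrite -(tab_d T2) -(tab_nn T2).
  by apply: dist_time; rewrite (tab_d T2).
have [t4 le4 e4] := @exec_tables load_prg _ _ _ _ isT isT T3.
have [t5 [st5 [j [e5 le5 hj P5 stop5]]]] := phase1_run s n0 hmu hx hm
  (fun st T => eq_leq (@time_tables phase1_body _ _ _ st T isT)).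
have T5 : tables n d K st5 := cen_tab P5.1.
have [t6 le6 e6] := @exec_tables switch_prg _ _ _ _ isT isT T5.
have [t7 [st7 [e7 le7 sol]]] := phase2_run n0 hmu hx hm P5 hj stop5
  (fun st T => eq_leq (@time_tables phase2_body _ _ _ st T isT)).
have T7 : tables n d K st7 by case: sol.
have [t8 le8 e8] := @exec_tables finish_prg _ _ _ _ isT isT T7.
have [L [hL uL sL opt]] := finishP n0 hs hmu sol.
exists (time_of sizes_prg n K + (t2 + (t3 + (t4 + (t5 + (t6 + (t7 + t8)))))))%N, (run finish_prg st7), L.
split; [| |exact: hL|by split|exact: opt].
  exact: ExecSeq e1 (ExecSeq e2 (ExecSeq e3 (ExecSeq e4 (ExecSeq e5 (ExecSeq e6 (ExecSeq e7 e8)))))).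
have h5 := leq_trans le5 (leq_mul (rounds1_le n K (B n K) d0) (leqnn _)).
have h7 := leq_trans le7 (leq_mul (rounds2_le n K (B n K) d0) (leqnn _)).
rewrite -mulnA in h5; rewrite -mulnA in h7.
rewrite /total_time -/K.
apply: (sum_le (lift _) _).
apply: (sum_le (leq_trans le2 (lift _)) _).
apply: (sum_le le3 _).
apply: (sum_le (leq_trans le4 (lift _)) _).
apply: (sum_le h5 _).
apply: (sum_le (leq_trans le6 (lift _)) _).
exact: (sum_le h7 (leq_trans le8 (lift _))).
Qed.
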